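(* (i) Let $0<\alpha<1$, $\delta\in(-1,1)$, $Z\sim S_\alpha(\delta)$ and $0<\beta<\alpha$. There is a class $\mathcal F_\beta$ of differentiable functions $f:\mathbb R\to\mathbb R$ (not depending on $F$) such that for every real-valued random variable $F$, $$d_{\mathrm W_\beta}(F,Z)\le \sup_{f\in\mathcal F_\beta}\Big|\mathbb E[\mathcal L^{\alpha,\delta}f(F)]-\frac1\alpha\,\mathbb E[Ff'(F)]\Big|,$$ and each $f\in\mathcal F_\beta$ satisfies: a. $|f(x)-f(y)|\le c_{\alpha,\beta}\,\big(|x-y|\wedge|x-y|^\beta\big)$ for all $x,y\in\mathbb R$; b. $\|f'\|_\alpha\le c_\alpha$, where $\|g\|_\alpha:=\|g\|_\infty+\sup_{x\ne y}\frac{|g(x)-g(y)|}{|x-y|^\alpha}$; c. $\|\mathcal L^{\alpha,\delta}f\|_\gamma\le c_{\alpha,\beta,\gamma}$ for every $\gamma\in(0,1)$, where $\|g\|_\gamma:=\|g\|_\infty+\sup_{x\ne y}\frac{|g(x)-g(y)|}{|x-y|^\gamma}$. (ii) Let $Z\sim S_1(0)$ and $0<\beta<1$. There is a class $\mathcal F_1$ of differentiable functions $f:\mathbb R\to\mathbb R$ (depending on $\beta$ but not on $F$) such that for every real-valued random variable $F$, $$d_{\mathrm W_\beta}(F,Z)\le \sup_{f\in\mathcal F_1}\Big|\mathbb E[\mathcal L^{1,0}f(F)]-\mathbb E[Ff'(F)]\Big|,$$ and each $f\in\mathcal F_1$ satisfies: a. $|f(x)-f(y)|\le c_{\beta}\,\big(|x-y|\wedge|x-y|^\beta\big)$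 for all $x,y\in\mathbb R$; b. $\|f'\|_{1,\log}\le c$, where $\|g\|_{1,\log}:=\|g\|_\infty+\sup_{x\neq y,\ |x-y|\le1}\frac{|g(x)-g(y)|}{|x-y|(1-\log|x-y|)}$; c. $\|\mathcal L^{1,0}f\|_{1,\log}\le c_\beta$.
   Context: For $\alpha\in(0,1]$ and $\delta\in(-1,1)$ (with $\delta=0$ if $\alpha=1$), $Z\sim S_\alpha(\delta)$ means that $Z$ is a real random variable with characteristic function $\mathbb E[e^{i\lambda Z}]=\exp\{-|\lambda|^\alpha(1-i\delta\,\mathrm{sign}(\lambda)\tan\frac{\pi\alpha}2)\}$ if $\alpha<1$ and $\mathbb E[e^{i\lambda Z}]=e^{-|\lambda|}$ if $\alpha=1$. Let $d_\alpha=\frac{-1}{\Gamma(-\alpha)\cos(\pi\alpha/2)}$ for $0<\alpha<1$, $d_1=\frac2\pi$, and $$\nu_{\alpha,\delta}(dx)=d_\alpha\Big(\tfrac{1+\delta}2x^{-1-\alpha}\mathbf 1_{(0,\infty)}(x)+\tfrac{1-\delta}2|x|^{-1-\alpha}\mathbf 1_{(-\infty,0)}(x)\Big)dx.$$ For sufficiently smooth $f$, $\mathcal L^{\alpha,\delta}f(x)=\int_{\mathbb R}(f(x+u)-f(x))\,\nu_{\alpha,\delta}(du)$ if $0<\alpha<1$, and $\mathcal L^{1,0}f(x)=\int_{\mathbb R}[f(x+u)-f(x)-uf'(x)\mathbf 1_{|u|\le1}]\,\nu_{1,0}(du)$. For $0<\beta<\alpha$, $\mathcal H_\beta$ is the set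 of $h:\mathbb R\to\mathbb R$ with $|h(x)-h(y)|\le|x-y|\wedge|x-y|^\beta$ for all $x,y$, and $d_{\mathrm W_\beta}(F,Z)=\sup_{h\in\mathcal H_\beta}|\mathbb E[h(F)]-\mathbb E[h(Z)]|$. The symbols $c_{\cdots}$ denote finite positive constants depending only on the displayed subscripts; $c$ without subscript is an absolute constant. Whenever an expectation in one of the two suprema is not well defined (not absolutely convergent), the corresponding term is interpreted as $+\infty$. *)

(* Defs.v *)
From HB Require Import structures.
From mathcomp Require Import all_boot all_order all_algebra.
From mathcomp Require Import all_classical all_reals all_analysis.
From mathcomp Require Import complex.

Set Implicit Arguments.
Unset Strict Implicit.
Unset Printing Implicit Defensive.

Import Order.TTheory GRing.Theory Num.Theory.
Import numFieldNormedType.Exports.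

Local Open Scope classical_set_scope.
Local Open Scope ring_scope.

Section stable_laws.
Context {R : realType}.

Definition cexp (z : R[i]) : R[i] :=
  (expR (complex.Re z))%:C%C * (cos (complex.Im z) +i* sin (complex.Im z))%C.

(* E[e^{ilX}], split into real and imaginary parts: both integrands are bounded,
   so [fine] loses nothing. *)
Definition char_fun d (T : measurableType d) (P : probability T R)
    (X : {RV P >-> R}) (l : R) : R[i] :=
  (fine ('E_P[fun w => cos (l * X w)])%E
     +i* fine ('E_P[fun w => sin (l * X w)])%E)%C.

(* X ~ S_a(dl); meant for 0 < a <= 1 and -1 < dl < 1, with dl = 0 if a = 1. *)
Definition stable_law d (T : measurableType d) (P : probability T R)
    (X : {RV P >-> R}) (a dl : R) : Prop :=
  forall l : R, char_fun X l =
    cexp (if a == 1 then (- `|l|)%:C%C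
          else (- (`|l| `^ a))%:C%C
                 * (1 - 'i%C * (dl * Num.sg l * tan (pi * a / 2))%:C%C)).

(* Euler's integral for s > 0, extended to -1 < s < 0 by Gamma (s + 1) = s Gamma s;
   only meaningful for s > -1, s != 0. *)
Definition Euler_integral (s : R) : R :=
  \int[lebesgue_measure]_(t in `]0, +oo[) (t `^ (s - 1) * expR (- t)).

Definition Gamma (s : R) : R :=
  if 0 < s then Euler_integral s else Euler_integral (s + 1) / s.

Definition levy_const (a : R) : R :=
  if a == 1 then 2 / pi else - 1 / (Gamma (- a) * cos (pi * a / 2)).

(* Density of nu_{a,dl} with respect to the Lebesgue measure. *)
Definition levy_density (a dl x : R) : R :=
  levy_const a *
    ((1 + dl) / 2 * x `^ (- 1 - a) * \1_(`]0, +oo[) x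
     + (1 - dl) / 2 * `|x| `^ (- 1 - a) * \1_(`]-oo, 0[) x).

(* L^{a,dl} for 0 < a < 1. *)
Definition stable_generator (a dl : R) (f : R -> R) (x : R) : R :=
  \int[lebesgue_measure]_u ((f (x + u) - f x) * levy_density a dl u).

(* L^{1,0}. *)
Definition cauchy_generator (f : R -> R) (x : R) : R :=
  \int[lebesgue_measure]_u
    ((f (x + u) - f x - u * derive1 f x * \1_[set v : R | `|v| <= 1] u)
       * levy_density 1 0 u).

Definition Hclass (b : R) : set (R -> R) :=
  [set h | forall x y : R,
     `|h x - h y| <= Num.min `|x - y| (`|x - y| `^ b)].

(* |E[X] - k E[Y]|, with value +oo as soon as one of the two expectations is not
   absolutely convergent. *)
Definition abs_diff_exp d1 (T1 : measurableType d1) (P1 : probability T1 R)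
    (X : T1 -> R) (k : R)
    d2 (T2 : measurableType d2) (P2 : probability T2 R) (Y : T2 -> R) : \bar R :=
  if `[< P1.-integrable setT (EFin \o X) /\ P2.-integrable setT (EFin \o Y) >]
  then `| 'E_P1[X] - k%:E * 'E_P2[Y] |%E
  else +oo%E.

Definition dW (b : R)
    d1 (T1 : measurableType d1) (P1 : probability T1 R) (F : {RV P1 >-> R})
    d2 (T2 : measurableType d2) (P2 : probability T2 R) (Z : {RV P2 >-> R})
    : \bar R :=
  ereal_sup [set abs_diff_exp P1 (h \o F) 1 P2 (h \o Z) | h in Hclass b].

(* sup over f in C of |E[L f(F)] - k E[F f'(F)]|. *)
Definition stein_sup (L : (R -> R) -> R -> R) (k : R) (C : set (R -> R))
    d (T : measurableType d) (P : probability T R) (F : {RV P >-> R}) : \bar R :=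
  ereal_sup [set abs_diff_exp P (L f \o F) k P (fun w => F w * derive1 f (F w))
            | f in C].

Definition sup_norm (g : R -> R) : \bar R :=
  ereal_sup [set (`|g x|)%:E | x in [set: R]].

Definition holder_norm (c : R) (g : R -> R) : \bar R :=
  (sup_norm g
   + ereal_sup [set (`|g p.1 - g p.2| / `|p.1 - p.2| `^ c)%:E
               | p in [set p : R * R | p.1 != p.2]])%E.

Definition loglip_norm (g : R -> R) : \bar R :=
  (sup_norm g
   + ereal_sup [set (`|g p.1 - g p.2|
                       / (`|p.1 - p.2| * (1 - ln `|p.1 - p.2|)))%:E
               | p in [set p : R * R | p.1 != p.2 /\ (`|p.1 - p.2| <= 1)%R]])%E.

End stable_laws.

(* Main.v *)
(* For a trigonometric polynomial [p] put
   [V_p(rho, x) = E p (rho^(1/al) x + (1 - rho)^(1/al) Z)], which is explicit on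
   exponentials.  Then [f_p(x) = - \int_0^1 rho^(-1) (V_p(rho, x) - V_p(rho, 0)) drho]
   solves the Stein equation [L f_p(x) - x f_p'(x) / al = p(x) - E p(Z)]; by linearity
   this is checked wave by wave with Fubini and the fundamental theorem of calculus.
   The estimates on [f_p] come from the smoothing bound
   [|V_(p')(rho, x) - V_(p')(rho, y)| <= C |x - y| (1 - rho)^(-1/al)], which is obtained
   without a density for [Z]: the frequency profile of the semigroup is a superposition
   of hat functions, and each hat multiplies the sup norm of a trigonometric polynomial
   by a bounded factor because the Fejer kernel is positive.
   Finally every [h] in [H_beta] is the limit of trigonometric polynomials with the same
   moduli of continuity up to a factor 3 (Bernstein operators in the variable
   [sin (x / N)]), so dominated convergence bounds [d_W] by the supremum over the [f_p];
   the moments of order [beta] needed for it are finite by Fatou. *)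

Require Import Defs.
From HB Require Import structures.
From mathcomp Require Import all_boot all_order all_algebra.
From mathcomp Require Import all_classical all_reals all_analysis.
From mathcomp Require Import measurable_realfun complex ring lra.

Set Implicit Arguments.
Unset Strict Implicit.
Unset Printing Implicit Defensive.
Import Order.TTheory GRing.Theory Num.Theory.
Import numFieldNormedType.Exports.
Local Open Scope classical_set_scope.
Local Open Scope ring_scope.

(** About [Z] only the characteristic function is given, so the estimates on f_p use two facts about
    finite sums of waves: the mean of p under the law of [Z] is at most the sup norm of p, and the
    profile exp (- l^al) smooths. The term V_p(rho, 0) is subtracted because the integrand is then
    of size rho^(1/al - 1) near 0, which stays bounded since al <= 1. The constants must not depend
    on the skewness, so smoothing is proved uniformly over all phases k with |k| <= |tan (pi al /
    2)|. The normalization of the Levy measure requires Gamma (- al), reached by a real-variable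
    form of contour rotation. For al = 1 the log-Lipschitz bound on f' alone would cost a squared
    logarithm in L f; a Zygmund bound on the second differences of f' saves one of them. Moments of
    [Z] are not assumed either: at x = 0 the drift of the Stein equation vanishes, so E p(Z) - p(0)
    is bounded uniformly over the class. *)

Section calculus.
Context {R : realType}.
Implicit Types (f g F : R -> R) (x a b : R).

Lemma is_deriveD1 f g x a b : is_derive x 1 f a -> is_derive x 1 g b ->
  is_derive x 1 (fun y => f y + g y) (a + b).
Proof. by move=> fa gb; exact: is_deriveD. Qed.

Lemma is_deriveM1 f g x a b : is_derive x 1 f a -> is_derive x 1 g b ->
  is_derive x 1 (fun y => f y * g y) (f x * b + g x * a).
Proof. by move=> fa gb; exact: is_deriveM. Qed.

Lemma is_deriveN1 f x a : is_derive x 1 f a ->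
  is_derive x 1 (fun y => - f y) (- a).
Proof. by move=> fa; exact: is_deriveN. Qed.

Lemma is_derive_comp1 f g x a b : is_derive (g x) 1 f a -> is_derive x 1 g b ->
  is_derive x 1 (fun y => f (g y)) (a * b).
Proof. by move=> fa gb; exact: is_derive1_comp. Qed.

Lemma is_derive_cst1 x a : is_derive x 1 (fun=> a) 0.
Proof. exact: is_derive_cst. Qed.

Lemma is_derive_id1 x : is_derive x 1 (fun y : R => y) 1.
Proof. exact: is_derive_id. Qed.

Lemma is_derive_expR1 f x a : is_derive x 1 f a ->
  is_derive x 1 (fun y => expR (f y)) (expR (f x) * a).
Proof. by move=> fa; apply: is_derive_comp1. Qed.

Lemma is_derive_cos1 f x a : is_derive x 1 f a ->
  is_derive x 1 (fun y => cos (f y)) (- sin (f x) * a).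
Proof. by move=> fa; apply: is_derive_comp1. Qed.

Lemma is_derive_sin1 f x a : is_derive x 1 f a ->
  is_derive x 1 (fun y => sin (f y)) (cos (f x) * a).
Proof. by move=> fa; apply: is_derive_comp1. Qed.

Lemma is_derive_inv1 f x a : f x != 0 -> is_derive x 1 f a ->
  is_derive x 1 (fun y => (f y)^-1) (- (f x) ^- 2 * a).
Proof. by move=> f0 fa; exact: is_deriveV. Qed.

Lemma is_derive_eq1 f x a b : is_derive x 1 f a -> a = b -> is_derive x 1 f b.
Proof. by move=> fa <-. Qed.

Lemma is_derive_ext f g x a : f =1 g -> is_derive x 1 g a -> is_derive x 1 f a.
Proof. by move=> /funext ->. Qed.

Lemma is_derive_exp1 n f x a : is_derive x 1 f a ->
  is_derive x 1 (fun y => f y ^+ n) (n%:R * f x ^+ n.-1 * a).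
Proof.
move=> fa; elim: n => [|n IH].
  apply: (is_derive_eq1 (is_derive_ext (fun y => expr0 (f y)) (is_derive_cst1 x 1))).
  by rewrite !mul0r.
apply: (is_derive_eq1 (is_derive_ext (fun y => exprS (f y) n) (is_deriveM1 fa IH))).
by case: n {IH} => [|n]; rewrite /= ?expr0 ?exprS -?natr1; ring.
Qed.

Lemma is_derive_powR1 p f x a : 0 < f x -> is_derive x 1 f a ->
  is_derive x 1 (fun y => f y `^ p) (p * f x `^ (p - 1) * a).
Proof.
move=> f0 fa; apply: (@is_derive_comp1 (fun y => y `^ p)) => //.
have fx : f x \in `]0, +oo[ by rewrite in_itv/= f0.
have := @derivable_powR _ 1 p _ fx => /derivableP.
by rewrite -derive1E powR_derive1.
Qed.

Lemma is_derive_ln1 f x a : 0 < f x -> is_derive x 1 f a ->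
  is_derive x 1 (fun y => ln (f y)) ((f x)^-1 * a).
Proof. by move=> f0 fa; apply: is_derive_comp1 => //; exact: is_derive1_ln. Qed.

Lemma is_derive_atan1 f x a : is_derive x 1 f a ->
  is_derive x 1 (fun y => atan (f y)) ((1 + f x ^+ 2)^-1 * a).
Proof. by move=> fa; apply: (@is_derive_comp1 atan) => //; exact: is_derive1_atan. Qed.

Lemma is_derive1_val f x a : is_derive x 1 f a -> derive1 f x = a.
Proof. by move=> fa; rewrite derive1E derive_val. Qed.

Lemma is_derive1_cont f x a : is_derive x 1 f a -> {for x, continuous f}.
Proof.
by move=> fa; apply/differentiable_continuous/derivable1_diffP; exact: ex_derive.
Qed.

Lemma is_derive_lipschitz f (df : R -> R) C :
  (forall x, is_derive x 1 f (df x)) -> (forall x, `|df x| <= C) ->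
  forall x y, `|f x - f y| <= C * `|x - y|.
Proof.
move=> fdf dfC.
suff H x y : x <= y -> `|f y - f x| <= C * `|y - x|.
  move=> x y; have [/H|/ltW/H //] := leP x y.
  by rewrite distrC [`|y - x|]distrC.
move=> xy; have [//|z _ ->] := @MVT_segment _ f df x y xy.
  apply: continuous_subspaceT => z; exact: is_derive1_cont (fdf z).
by rewrite normrM ler_wpM2r.
Qed.

Lemma lipschitz_is_derive_le f x a C : is_derive x 1 f a ->
  (forall y z, `|f y - f z| <= C * `|y - z|) -> `|a| <= C.
Proof.
move=> fa Lf.
have : (fun h => h^-1 *: (f (h *: 1 + x) - f x)) @ 0^' --> a.
  rewrite -(@derive_val _ _ _ _ _ _ _ fa).
  by apply: (@ex_derive _ _ _ _ _ _ _ fa).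
move=> /cvg_norm/= Ha.
apply: (cvgr_to_le Ha).
near=> h.
have h0 : h != 0 by near: h; exact: nbhs_dnbhs_neq.
have := Lf (h *: 1 + x) x.
rewrite addrK scaler1 => H.
rewrite normrZ normfV mulrC ler_pdivrMr ?normr_gt0//.
Unshelve. all: by end_near. Qed.

End calculus.

(** The value of the derivative stays an evar that the structural rules fill in; [der_eq] then
    leaves its comparison with the wanted value, mostly a matter of [ring] or [field]. Type class
    search is kept out because [is_derive] is itself a class. *)
Ltac der :=
  repeat (first
  [ notypeclasses refine (is_derive_cst1 _ _) | notypeclasses refine (is_derive_id1 _)
  | notypeclasses refine (is_deriveD1 _ _) | notypeclasses refine (is_deriveN1 _)
  | notypeclasses refine (is_deriveM1 _ _) | notypeclasses refine (is_derive_expR1 _)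
  | notypeclasses refine (is_derive_cos1 _) | notypeclasses refine (is_derive_sin1 _)
  | notypeclasses refine (is_derive_powR1 _ _ _) | notypeclasses refine (is_derive_exp1 _ _)
  | notypeclasses refine (is_derive_inv1 _ _) | notypeclasses refine (is_derive_ln1 _ _)
  | notypeclasses refine (is_derive_atan1 _) ]).

Ltac der_eq := notypeclasses refine (is_derive_eq1 _ _); [der | cbv beta].
Ltac der_cont := notypeclasses refine (is_derive1_cont _); der.

Ltac rlra :=
  repeat match goal with H := _ |- _ => clearbody H end; lra.

(** * Fundamental theorem of calculus on open intervals *)

Section exhaust.
Context {R : realType}.
Notation mu := (@lebesgue_measure R).
Implicit Types (f g F : R -> R) (x a b : R).

Lemma ftc_itv f F a b : a < b ->
  (forall x, a <= x <= b -> is_derive x 1 F (f x)) ->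
  (forall x, a <= x <= b -> {for x, continuous f}) ->
  (\int[mu]_(x in `[a, b]) (f x)%:E = (F b - F a)%:E)%E /\
  mu.-integrable `[a, b] (EFin \o f).
Proof.
move=> ab dF cf.
have cw : {within `[a, b], continuous f}.
  apply: continuous_in_subspaceT => x; rewrite inE/= in_itv/= => xab.
  exact: cf.
split; last first.
  by apply: continuous_compact_integrable => //; exact: segment_compact.
rewrite EFinB; apply: continuous_FTC2 => //.
  split.
  - move=> x; rewrite in_itv/= => /andP[ax xb].
    by have := dF x; rewrite !ltW// => /(_ isT) dFx; exact: ex_derive.
  - apply: cvg_at_right_filter; apply: is_derive1_cont; apply: dF.
    by rewrite lexx ltW.
  - apply: cvg_at_left_filter; apply: is_derive1_cont; apply: dF.
    by rewrite lexx ltW.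
move=> x; rewrite in_itv/= => /andP[ax xb].
by apply: is_derive1_val; apply: dF; rewrite !ltW.
Qed.

Section exhaust_def.
Variables (u v : R^nat) (D : set R) (f F : R -> R) (l : R).
Hypothesis uv : forall n, u n < v n.
Hypothesis und : forall n m, (n <= m)%N -> u m <= u n.
Hypothesis vnd : forall n m, (n <= m)%N -> v n <= v m.
Hypothesis DE : D = \bigcup_n `[u n, v n]%classic.
Hypothesis dF : forall x, D x -> is_derive x 1 F (f x).
Hypothesis cf : forall x, D x -> {for x, continuous f}.
Hypothesis Fl : (F (v n) - F (u n)) @[n --> \oo] --> l.

Let sub n x : u n <= x <= v n -> D x.
Proof. by move=> h; rewrite DE; exists n => //=; rewrite in_itv. Qed.

Let ftcn n := ftc_itv (uv n) (fun x h => dF (sub h)) (fun x h => cf (sub h)).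

Let mD : measurable D.
Proof. by rewrite DE; apply: bigcup_measurable => k _; exact: measurable_itv. Qed.

Lemma exhaust_measurable_fun : measurable_fun D f.
Proof.
rewrite DE; apply/measurable_fun_bigcup; first by move=> n; exact: measurable_itv.
move=> n; have [_ /measurable_int] := ftcn n.
by move/measurable_EFinP.
Qed.

Let Fnd n m : (n <= m)%N -> `[u n, v n]%classic `<=` `[u m, v m]%classic.
Proof.
move=> nm x/=; rewrite !in_itv/= => /andP[h1 h2].
by rewrite (le_trans (und nm) h1) (le_trans h2 (vnd nm)).
Qed.

(** Monotone convergence along the compact intervals. Only the limit of the increments of [F] is
    used, so both functions may be singular at the ends, and integrability is a result. *)
Lemma ge0_exhaust_ftc : (forall x, D x -> 0 <= f x) ->
  (\int[mu]_(x in D) (f x)%:E = l%:E)%E /\ mu.-integrable D (EFin \o f).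
Proof.
move=> f0.
have mf : measurable_fun D (EFin \o f).
  by apply/measurable_EFinP; exact: exhaust_measurable_fun.
have H : (\int[mu]_(x in D) (f x)%:E = l%:E)%E.
  rewrite {1}DE.
  have := @ge0_nondecreasing_set_cvg_integral _
    (measurableTypeR R) R
    (fun n => `[u n, v n]%classic) (EFin \o f) (@lebesgue_measure R).
  have h1 : nondecreasing_seq (fun n => `[u n, v n]%classic).
    by apply/nondecreasing_seqP => n; apply/subsetPset; apply: Fnd.
  have h2 n : measurable_fun `[u n, v n] (EFin \o f).
    by have [_ /measurable_int] := ftcn n.
  have h3 n x : `[u n, v n]%classic x -> (0 <= (EFin \o f) x)%E.
    by move=> /= xn; rewrite lee_fin f0// DE; exists n.
  move/(_ h1 (fun=> measurable_itv _) h2 h3)/cvg_lim => <- //.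
  apply/cvg_lim => //.
  rewrite (_ : (fun _ => _) = (fun n => (F (v n) - F (u n))%:E)); last first.
    by apply/funext => n; have [-> _] := ftcn n.
  exact: cvg_EFin Fl || (apply: cvg_EFin => //; exact: nearW).
split => //.
apply/integrableP; split => //.
under eq_integral.
  move=> x xD; rewrite /= ger0_norm; last by apply: f0; rewrite inE in xD.
  over.
by rewrite H ltry.
Qed.

(** For [f] without a sign the truncations are dominated by |f|, so integrability has to be known
    beforehand. *)
Lemma exhaust_ftc : mu.-integrable D (EFin \o f) ->
  \int[mu]_(x in D) f x = l.
Proof.
move=> intf; rewrite /Rintegral.
pose fn n := (EFin \o f) \_ (`[u n, v n]%classic).
have mf := measurable_int _ intf.
have mfn n : measurable_fun D (fn n).
  apply/(measurable_restrict (EFin \o f) (measurable_itv _) mD).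
  by apply: measurable_funS mf => // x [].
have [] := @dominated_convergence _ _ _ mu D mD fn (EFin \o f) (abse \o (EFin \o f)) mfn mf.
- apply: aeW => x Dx; apply: cvg_near_cst.
  move: (Dx); rewrite {1}DE => -[n _ xn].
  exists n => // m /= nm; rewrite /fn patchT// inE.
  exact: Fnd nm _ xn.
- exact: integrable_abse.
- apply: aeW => x n Dx; rewrite /fn /patch; case: ifPn => //= _.
  by rewrite normr0 lee_fin.
move=> _ _ H.
suff -> : (\int[mu]_(x in D) (f x)%:E = l%:E)%E by [].
move/cvg_lim : H => <-//; apply/cvg_lim => //.
rewrite (_ : (fun _ => _) = (fun n => (F (v n) - F (u n))%:E)); last first.
  apply/funext => n; have [<- _] := ftcn n.
  rewrite /fn -integral_mkcondr; congr (integral _ _ _).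
  rewrite setIC; apply/setIidPl => x; rewrite DE => xn.
  by exists n.
by apply: cvg_EFin => //; exact: nearW.
Qed.

End exhaust_def.

(** The index starts at 2 because at 1 the interval would be the single point 1, while the intervals
    have to be nondegenerate. *)
Lemma bigcup_itv0y :
  `]0, +oo[%classic = \bigcup_n `[n.+2%:R^-1, n.+2%:R]%classic :> set R.
Proof.
apply/seteqP; split=> x /=; rewrite in_itv/= andbT.
  move=> x0; exists (maxn (Num.truncn x) (Num.truncn x^-1)) => //=.
  rewrite in_itv/=; apply/andP; split.
    rewrite invf_ple ?posrE ?ltr0n//; apply: (le_trans (ltW (truncnS_gt _))).
    by rewrite ler_nat ltnS leqW// leq_maxr.
  apply: (le_trans (ltW (truncnS_gt _))).
  by rewrite ler_nat ltnS leqW// leq_maxl.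
by move=> [n _]/=; rewrite in_itv/= => /andP[+ _]; apply: lt_le_trans; rewrite invr_gt0.
Qed.

(** Here the index starts at 3: at 2 the interval would shrink to the point 1/2. *)
Lemma bigcup_itv01 :
  `]0, 1[%classic = \bigcup_n `[n.+3%:R^-1, 1 - n.+3%:R^-1]%classic :> set R.
Proof.
apply/seteqP; split=> x /=; rewrite in_itv/=.
  move=> /andP[x0 x1].
  exists (maxn (Num.truncn x^-1) (Num.truncn (1 - x)^-1)) => //=.
  rewrite in_itv/=; apply/andP; split.
    rewrite invf_ple ?posrE ?ltr0n//; apply: (le_trans (ltW (truncnS_gt _))).
    by rewrite ler_nat ltnS leqW// leqW// leq_maxl.
  rewrite lerBrDl -lerBrDr invf_ple ?posrE ?ltr0n ?subr_gt0//.
  apply: (le_trans (ltW (truncnS_gt _))).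
  by rewrite ler_nat ltnS leqW// leqW// leq_maxr.
move=> [n _]/=; rewrite in_itv/= => /andP[h1 h2].
by rewrite (lt_le_trans _ h1)// (le_lt_trans h2)// gtrBl.
Qed.

Lemma cvg_invSn k : ((n + k).+1%:R^-1 : R) @[n --> \oo] --> (0 : R).
Proof. by have := @cvg_harmonic R; rewrite -(cvg_shiftn k). Qed.

Lemma exhaust_itv0y F l0 l1 :
  F x @[x --> 0^'+] --> l0 -> F x @[x --> +oo] --> l1 ->
  (F (n.+2%:R : R) - F (n.+2%:R^-1)) @[n --> \oo] --> l1 - l0.
Proof.
move=> /cvg_at_rightP F0 Fy; apply: cvgB.
- apply: (cvg_comp _ _ _ Fy); apply/cvgryPge => A.
  exists (Num.truncn A) => // n /= An.
  apply: (le_trans (ltW (truncnS_gt _))).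
  by rewrite ler_nat ltnS leqW.
- apply: F0; split; first by move=> n; rewrite invr_gt0.
  by have := cvg_invSn 1; under eq_fun do rewrite addn1.
Qed.

Lemma exhaust_itv01 F l0 l1 :
  F x @[x --> 0^'+] --> l0 -> F x @[x --> 1^'-] --> l1 ->
  (F (1 - n.+3%:R^-1 : R) - F (n.+3%:R^-1)) @[n --> \oo] --> l1 - l0.
Proof.
move=> /cvg_at_rightP F0 /cvg_at_leftP F1.
have H : (n.+3%:R^-1 : R) @[n --> \oo] --> (0 : R).
  by have := cvg_invSn 2; under eq_fun do rewrite addn2.
apply: cvgB.
- apply: F1; split; first by move=> n; rewrite gtrBl.
  by rewrite -[X in _ --> X]subr0; apply: cvgB => //; exact: cvg_cst.
- by apply: F0; split; first by move=> n; rewrite invr_gt0.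
Qed.

Section itv_ftc.
Variables (f F : R -> R) (l0 l1 : R).

Section itv0y.
Hypothesis dF : forall x, 0 < x -> is_derive x 1 F (f x).
Hypothesis cf : forall x, 0 < x -> {for x, continuous f}.
Hypothesis F0 : F x @[x --> 0^'+] --> l0.
Hypothesis F1 : F x @[x --> +oo] --> l1.

Let uv n : n.+2%:R^-1 < n.+2%:R :> R.
Proof. by rewrite invf_plt ?posrE// (@lt_le_trans _ _ 1)// ?ler1n// invf_lt1// ltr1n. Qed.

Let dF' x : `]0, +oo[%classic x -> is_derive x 1 F (f x).
Proof. by rewrite /= in_itv/= andbT; exact: dF. Qed.

Let cf' x : `]0, +oo[%classic x -> {for x, continuous f}.
Proof. by rewrite /= in_itv/= andbT; exact: cf. Qed.

Let und n m : (n <= m)%N -> m.+2%:R^-1 <= n.+2%:R^-1 :> R.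
Proof. by move=> nm; rewrite lef_pV2 ?posrE// ler_nat !ltnS. Qed.

Let vnd n m : (n <= m)%N -> n.+2%:R <= m.+2%:R :> R.
Proof. by move=> nm; rewrite ler_nat !ltnS. Qed.

Lemma ge0_ftc_itv0y : (forall x, 0 < x -> 0 <= f x) ->
  (\int[mu]_(x in `]0%R, +oo[) (f x)%:E = (l1 - l0)%:E)%E /\
  mu.-integrable `]0, +oo[ (EFin \o f).
Proof.
move=> f0; apply: (ge0_exhaust_ftc uv und vnd bigcup_itv0y dF' cf').
  exact: exhaust_itv0y.
by move=> x /=; rewrite in_itv/= andbT; exact: f0.
Qed.

Lemma ftc_itv0y : mu.-integrable `]0, +oo[ (EFin \o f) ->
  \int[mu]_(x in `]0, +oo[) f x = l1 - l0.
Proof.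
apply: (exhaust_ftc uv und vnd bigcup_itv0y dF' cf').
exact: exhaust_itv0y.
Qed.
End itv0y.

Section itv01.
Hypothesis dF : forall x, 0 < x < 1 -> is_derive x 1 F (f x).
Hypothesis cf : forall x, 0 < x < 1 -> {for x, continuous f}.
Hypothesis F0 : F x @[x --> 0^'+] --> l0.
Hypothesis F1 : F x @[x --> 1^'-] --> l1.

Let uv n : n.+3%:R^-1 < 1 - n.+3%:R^-1 :> R.
Proof.
rewrite ltrBrDl -mulr2n -(mulr_natl _ 2) ltr_pdivrMr// mul1r ltr_nat//.
Qed.

Let dF' x : `]0, 1[%classic x -> is_derive x 1 F (f x).
Proof. by rewrite /= in_itv/=; exact: dF. Qed.

Let cf' x : `]0, 1[%classic x -> {for x, continuous f}.
Proof. by rewrite /= in_itv/=; exact: cf. Qed.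

Let und n m : (n <= m)%N -> m.+3%:R^-1 <= n.+3%:R^-1 :> R.
Proof. by move=> nm; rewrite lef_pV2 ?posrE// ler_nat !ltnS. Qed.

Let vnd n m : (n <= m)%N -> 1 - n.+3%:R^-1 <= 1 - m.+3%:R^-1 :> R.
Proof. by move=> nm; rewrite lerD2l lerN2 und. Qed.

Lemma ge0_ftc_itv01 : (forall x, 0 < x < 1 -> 0 <= f x) ->
  (\int[mu]_(x in `]0%R, 1%R[) (f x)%:E = (l1 - l0)%:E)%E /\
  mu.-integrable `]0, 1[ (EFin \o f).
Proof.
move=> f0; apply: (ge0_exhaust_ftc uv und vnd bigcup_itv01 dF' cf').
  exact: exhaust_itv01.
by move=> x /=; rewrite in_itv/=; exact: f0.
Qed.

Lemma ftc_itv01 : mu.-integrable `]0, 1[ (EFin \o f) ->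
  \int[mu]_(x in `]0, 1[) f x = l1 - l0.
Proof.
apply: (exhaust_ftc uv und vnd bigcup_itv01 dF' cf').
exact: exhaust_itv01.
Qed.
End itv01.
End itv_ftc.
End exhaust.

(** * Integrability and measurability of real-valued functions in pointwise form *)

Section integrable_fun.
Context d (T : measurableType d) (R : realType).
Variable m : {measure set T -> \bar R}.
Implicit Types (D : set T) (f g : T -> R).

Lemma integrableZl1 D k f : measurable D -> m.-integrable D (EFin \o f) ->
  m.-integrable D (EFin \o (fun x => k * f x)).
Proof. by move=> mD mf; exact: (integrableZl mD k mf). Qed.

Lemma integrableD1 D f g : measurable D -> m.-integrable D (EFin \o f) ->
  m.-integrable D (EFin \o g) -> m.-integrable D (EFin \o (fun x => f x + g x)).
Proof. by move=> mD mf mg; exact: (integrableD mD mf mg). Qed.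

Lemma integrableB1 D f g : measurable D -> m.-integrable D (EFin \o f) ->
  m.-integrable D (EFin \o g) -> m.-integrable D (EFin \o (fun x => f x - g x)).
Proof. by move=> mD mf mg; exact: (integrableB mD mf mg). Qed.

Lemma integrable_norm1 D f : m.-integrable D (EFin \o f) ->
  m.-integrable D (EFin \o (fun x => `|f x|)).
Proof. by move=> mf; exact: integrable_norm. Qed.

Lemma le_integrable1 D f g : measurable D -> measurable_fun D f ->
  m.-integrable D (EFin \o g) ->
  (forall x, D x -> `|f x| <= g x) -> m.-integrable D (EFin \o f).
Proof.
move=> mD mf ig fg; apply: (le_integrable mD _ _ ig).
  exact/measurable_EFinP.
by move=> x Dx; rewrite lee_fin (le_trans (fg _ Dx))// ler_norm.
Qed.

Lemma Rintegral_le_norm D f g : measurable D -> measurable_fun D f ->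
  m.-integrable D (EFin \o g) ->
  (forall x, D x -> `|f x| <= g x) ->
  `|\int[m]_(x in D) f x| <= \int[m]_(x in D) g x.
Proof.
move=> mD mf ig fg; have fi := le_integrable1 mD mf ig fg.
apply: (le_trans (le_normr_Rintegral mD fi)).
by apply: le_Rintegral => //; exact: integrable_norm1.
Qed.

End integrable_fun.

Section measurability.
Context d (T : measurableType d) (R : realType).
Implicit Types (D : set T) (f g : T -> R).

Lemma measurable_funD1 D f g : measurable_fun D f -> measurable_fun D g ->
  measurable_fun D (fun x => f x + g x).
Proof. exact: measurable_funD. Qed.

Lemma measurable_funM1 D f g : measurable_fun D f -> measurable_fun D g ->
  measurable_fun D (fun x => f x * g x).
Proof. exact: measurable_funM. Qed.

Lemma measurable_funN1 D f : measurable_fun D f -> measurable_fun D (fun x => - f x).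
Proof. exact: measurable_funN. Qed.

Lemma measurable_fun_cont D f (g : R -> R) : continuous g -> measurable_fun D f ->
  measurable_fun D (fun x => g (f x)).
Proof.
by move=> cg mf; apply: (measurableT_comp (f := g)) => //; exact: continuous_measurable_fun.
Qed.

Lemma measurable_fun_expR D f : measurable_fun D f -> measurable_fun D (fun x => expR (f x)).
Proof. by apply: measurable_fun_cont; exact: continuous_expR. Qed.

Lemma measurable_fun_cos D f : measurable_fun D f -> measurable_fun D (fun x => cos (f x)).
Proof. by apply: measurable_fun_cont; exact: continuous_cos. Qed.

Lemma measurable_fun_sin D f : measurable_fun D f -> measurable_fun D (fun x => sin (f x)).
Proof. by apply: measurable_fun_cont; exact: continuous_sin. Qed.

Lemma measurable_fun_powR1 D p f : measurable_fun D f -> measurable_fun D (fun x => f x `^ p).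
Proof.
by move=> mf; apply: (measurableT_comp (f := fun y => y `^ p)) => //; exact: measurable_powR.
Qed.

Lemma measurable_fun_norm D f : measurable_fun D f -> measurable_fun D (fun x => `|f x|).
Proof. by move=> mf; apply: measurableT_comp => //; exact: normr_measurable. Qed.

End measurability.

Ltac mfun :=
  repeat (first
  [ exact: measurable_cst | exact: measurable_id | apply: measurable_funD1
  | apply: measurable_funN1 | apply: measurable_funM1
  | apply: measurable_fun_expR | apply: measurable_fun_cos | apply: measurable_fun_sin
  | apply: measurable_fun_powR1 | apply: measurable_fun_norm ]).

(** * Majorants with explicit integrals and elementary inequalities *)

Section domination.
Context {R : realType}.
Notation mu := (@lebesgue_measure R).
Implicit Types (f g F : R -> R) (x a b : R).

Lemma powRDp x a b : 0 < x -> x `^ (a + b) = x `^ a * x `^ b.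
Proof. by move=> x0; rewrite powRD//; apply/implyP => _; rewrite gt_eqF. Qed.

Lemma powR_le1 x a : 0 <= x <= 1 -> 0 <= a -> x `^ a <= 1.
Proof.
move=> /andP[x0 x1] a0; have := ge0_ler_powR a0 _ _ x1.
by rewrite powR1 !nnegrE; apply.
Qed.

Lemma powR_ge1 x a : 1 <= x -> 0 <= a -> 1 <= x `^ a.
Proof. by move=> x1 a0; rewrite -(powRr0 x) ler_powR. Qed.

Lemma cvg0_powR_bound F l C p : 0 < p ->
  (forall x, 0 < x <= 1 -> `|F x - l| <= C * x `^ p) ->
  F x @[x --> 0^'+] --> l.
Proof.
move=> p0 FC; apply/subr_cvg0; apply: norm_cvg0.
apply: (@squeeze_cvgr _ _ _ R (fun=> 0) (fun x => C * x `^ p) _ _ 0).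
- near=> x; rewrite normr_ge0/=; apply: FC.
  apply/andP; split; near: x; first exact: nbhs_right_gt.
  exact: nbhs_right_le.
- exact: cvg_cst.
- rewrite -[X in _ --> X](mulr0 C); apply: cvgM; first exact: cvg_cst.
  exact: powR_cvg0.
Unshelve. all: by end_near. Qed.

Lemma cvgy_powRN p : 0 < p -> (x `^ (- p) : R) @[x --> +oo] --> (0 : R).
Proof.
move=> p0; apply/cvgrPdist_lt => e e0; near=> x.
have x0 : 0 < x by near: x; exact: nbhs_pinfty_gt.
rewrite sub0r normrN ger0_norm ?powR_ge0// powRN invf_plt ?posrE ?powR_gt0//.
rewrite -[ltLHS]powRr1 ?invr_ge0 ?ltW// -(@mulVf _ p) ?gt_eqF//.
rewrite powRrM gt0_ltr_powR ?nnegrE ?powR_ge0 ?(ltW x0)//.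
Unshelve. all: by end_near. Qed.

Lemma cvgy_powR_bound F l C p : 0 < p ->
  (forall x, 1 <= x -> `|F x - l| <= C * x `^ (- p)) ->
  F x @[x --> +oo] --> l.
Proof.
move=> p0 FC; apply/subr_cvg0; apply: norm_cvg0.
apply: (@squeeze_cvgr _ _ _ R (fun=> 0) (fun x => C * x `^ (- p)) _ _ 0).
- near=> x; rewrite normr_ge0/=; apply: FC.
  by near: x; exact: nbhs_pinfty_ge.
- exact: cvg_cst.
- rewrite -[X in _ --> X](mulr0 C); apply: cvgM; first exact: cvg_cst.
  exact: cvgy_powRN.
Unshelve. all: by end_near. Qed.

(** The derivative of - 1 / (p (1 + x^p)). It behaves like x^(p - 1) at 0 and like x^(- p - 1) at
    infinity, so it dominates any admissible power at one end while staying integrable at the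
    other. *)
Definition peak p x : R := x `^ (p - 1) * (1 + x `^ p) ^- 2.

Lemma peak_ge0 p x : 0 <= peak p x.
Proof. by rewrite mulr_ge0 ?powR_ge0// invr_ge0 sqr_ge0. Qed.

Lemma peak_integral p : 0 < p ->
  (\int[mu]_(x in `]0%R, +oo[) (peak p x)%:E = (p^-1)%:E)%E /\
  mu.-integrable `]0, +oo[ (EFin \o peak p).
Proof.
move=> p0.
have pos x : 0 < 1 + x `^ p by rewrite ltr_pwDl// powR_ge0.
have dF x : 0 < x -> is_derive x 1 (fun x => - p^-1 * (1 + x `^ p)^-1) (peak p x).
  move=> x0; der_eq; rewrite ?gt_eqF//.
  rewrite /peak; field; rewrite gt_eqF//=.
  by rewrite gt_eqF.
have := @ge0_ftc_itv0y _ _ _ (- p^-1) 0 dF.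
rewrite sub0r opprK; apply.
- move=> x x0; rewrite /peak.
  by der_cont => //; rewrite expf_neq0 ?gt_eqF.
- apply: (@cvg0_powR_bound _ _ p^-1 p p0) => x /andP[x0 x1].
  rewrite (_ : _ - _ = p^-1 * (x `^ p / (1 + x `^ p))); last first.
    by field; rewrite !gt_eqF.
  rewrite ger0_norm ?mulr_ge0 ?invr_ge0 ?powR_ge0 ?(ltW p0) ?(ltW (pos _))//.
  rewrite ler_wpM2l ?invr_ge0 ?(ltW p0)// ler_piMr ?powR_ge0//.
  by rewrite invf_le1// lerDl powR_ge0.
- apply: (@cvgy_powR_bound _ _ p^-1 p p0) => x x1.
  rewrite subr0 normrM normrN !ger0_norm ?invr_ge0 ?(ltW p0) ?(ltW (pos _))//.
  rewrite ler_wpM2l ?invr_ge0 ?(ltW p0)// powRN lef_pV2 ?posrE//.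
    by rewrite lerDr.
  by rewrite powR_gt0// (lt_le_trans _ x1).
- by move=> x _; exact: peak_ge0.
Qed.

(** On (0, 1] the factor (1 + x^(p + 1))^2 is at most 4. *)
Lemma le_peak0 p x : -1 < p -> 0 < x <= 1 -> x `^ p <= 4 * peak (p + 1) x.
Proof.
move=> p1 /andP[x0 x1]; rewrite /peak addrK mulrCA ler_peMr ?powR_ge0//.
have := powR_ge0 x (p + 1).
have : x `^ (p + 1) <= 1 by apply: powR_le1; [rewrite ltW//|lra].
set y := x `^ _ => y1 y0.
rewrite ler_pdivlMr ?mul1r ?exprn_gt0//; nra.
Qed.

(** With y = x^(- q - 1) >= 1 one has (1 + y)^2 <= 4 y^2, and x^q is the power that [peak]
    approaches at infinity. *)
Lemma le_peaky q x : q < -1 -> 1 <= x -> x `^ q <= 4 * peak (- q - 1) x.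
Proof.
move=> p1 x1; have x0 : 0 < x by exact: lt_le_trans x1.
rewrite /peak.
have -> : x `^ q = x `^ (- q - 1 - 1) * x `^ (- q - 1) ^- 2.
  rewrite expr2 invfM -powRN -!powRDp//; congr (_ `^ _); ring.
rewrite mulrCA ler_wpM2l ?powR_ge0//.
have : 1 <= x `^ (- q - 1) by apply: powR_ge1 => //; lra.
set y := x `^ _ => y1.
rewrite -[leLHS]mul1r ler_pdivrMr ?exprn_gt0//; last by lra.
rewrite mulrAC ler_pdivlMr ?exprn_gt0//; nra.
Qed.

Section dom0y.
Variables (f : R -> R) (p q C : R).
Hypothesis mf : measurable_fun setT f.
Hypotheses (p1 : -1 < p) (q1 : q < -1).
Hypothesis f0 : forall x, 0 < x <= 1 -> `|f x| <= C * x `^ p.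
Hypothesis f1 : forall x, 1 <= x -> `|f x| <= C * x `^ q.

Let C0 : 0 <= C.
Proof.
have := @f1 1 (lexx _); rewrite powR1 mulr1; apply: le_trans; exact: normr_ge0.
Qed.

(** One majorant for both ends, so that no integral is ever split at 1; its exact integral is the
    bound of [dom0y_le]. *)
Let g x := 4 * C * (peak (p + 1) x + peak (- q - 1) x).

Let fg x : 0 < x -> `|f x| <= g x.
Proof.
move=> x0; rewrite /g; have [x1|x1] := leP x 1.
  apply: (le_trans (f0 _)); first by rewrite x0.
  rewrite [4 * C]mulrC -mulrA ler_wpM2l//.
  apply: (le_trans (le_peak0 p1 _)); first by rewrite x0.
  by rewrite ler_wpM2l// lerDl peak_ge0.
apply: (le_trans (f1 (ltW x1))).
rewrite [4 * C]mulrC -mulrA ler_wpM2l//.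
apply: (le_trans (le_peaky q1 (ltW x1))).
by rewrite ler_wpM2l// lerDr peak_ge0.
Qed.

Let ig : mu.-integrable `]0, +oo[ (EFin \o g).
Proof.
have [|_ i1] := @peak_integral (p + 1); first by rewrite -ltrBlDr sub0r.
have [|_ i2] := @peak_integral (- q - 1); first by rewrite subr_gt0 ltrNr.
by apply: integrableZl1 => //; exact: integrableD1.
Qed.

Lemma dom0y_integrable : mu.-integrable `]0, +oo[ (EFin \o f).
Proof.
apply: (le_integrable1 _ _ ig) => //=; first exact: measurable_funTS.
by move=> x; rewrite in_itv/= andbT; exact: fg.
Qed.

Lemma dom0y_le : `|\int[mu]_(x in `]0, +oo[) f x| <=
  C * (4 * ((p + 1)^-1 + (- q - 1)^-1)).
Proof.
have [|e1 i1] := @peak_integral (p + 1); first by rewrite -ltrBlDr sub0r.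
have [|e2 i2] := @peak_integral (- q - 1); first by rewrite subr_gt0 ltrNr.
apply: (@le_trans _ _ (\int[mu]_(x in `]0, +oo[) g x)).
  apply: Rintegral_le_norm => //; first exact: measurable_funTS.
  by move=> x /=; rewrite in_itv/= andbT; exact: fg.
rewrite /g RintegralZl//; last exact: integrableD1.
rewrite RintegralD//; rewrite {1 2}/Rintegral e1 e2/=.
by rewrite mulrA [4 * C]mulrC.
Qed.

End dom0y.

Lemma powR_integral01 p : -1 < p ->
  (\int[mu]_(x in `]0%R, 1%R[) (x `^ p)%:E = ((p + 1)^-1)%:E)%E /\
  mu.-integrable `]0, 1[ (EFin \o (fun x => x `^ p)).
Proof.
move=> p1.
have pp : 0 < p + 1 by lra.
have dF x : 0 < x < 1 -> is_derive x 1 (fun x => (p + 1)^-1 * x `^ (p + 1)) (x `^ p).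
  move=> /andP[x0 _]; der_eq => //.
  by rewrite addrK; field; rewrite gt_eqF.
have := @ge0_ftc_itv01 _ _ _ 0 (p + 1)^-1 dF.
rewrite subr0; apply.
- move=> x /andP[x0 _]; apply: is_derive1_cont.
  by apply: is_derive_powR1 => //; exact: is_derive_id1.
- apply: (@cvg0_powR_bound _ _ (p + 1)^-1 (p + 1) pp) => x /andP[x0 x1].
  by rewrite subr0 ger0_norm// mulr_ge0 ?powR_ge0// invr_ge0 ltW.
- apply: cvg_at_left_filter.
  rewrite [X in _ --> X](_ : _ = (p + 1)^-1 * 1 `^ (p + 1)); last by rewrite powR1 mulr1.
  apply: (is_derive1_cont (f := fun x => (p + 1)^-1 * x `^ (p + 1))).
  by der.
- by move=> x _; exact: powR_ge0.
Qed.

Lemma dom01_integrable f p C : measurable_fun setT f -> -1 < p ->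
  (forall x, 0 < x < 1 -> `|f x| <= C * x `^ p) ->
  mu.-integrable `]0, 1[ (EFin \o f).
Proof.
move=> mf p1 fC; have [_ i1] := powR_integral01 p1.
apply: (le_integrable1 _ _ (integrableZl1 C _ i1)) => //=; first exact: measurable_funTS.
Qed.

Lemma dom01_le f p C : measurable_fun setT f -> -1 < p ->
  (forall x, 0 < x < 1 -> `|f x| <= C * x `^ p) ->
  `|\int[mu]_(x in `]0, 1[) f x| <= C * (p + 1)^-1.
Proof.
move=> mf p1 fC; have [e1 i1] := powR_integral01 p1.
apply: (@le_trans _ _ (\int[mu]_(x in `]0, 1[) (C * x `^ p))).
  apply: Rintegral_le_norm => //; first exact: measurable_funTS.
    exact: integrableZl1.
by rewrite RintegralZl// {1}/Rintegral e1.
Qed.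

Lemma expRN_le x : 0 < x -> expR (- x) <= x^-1.
Proof.
move=> x0; rewrite expRN lef_pV2 ?posrE ?expR_gt0//.
by apply: le_trans (expR_ge1Dx _); rewrite lerDr.
Qed.

(** The square of exp (- y) <= 1 / y at y = c x / 2. *)
Lemma expRN_le2 c x : 0 < c -> 0 < x -> expR (- (c * x)) <= (4 / c ^+ 2) * x `^ (- 2).
Proof.
move=> c0 x0.
have -> : expR (- (c * x)) = expR (- (c * x / 2)) ^+ 2.
  by rewrite expr2 -expRD; congr expR; field.
have -> : x `^ (- 2) = x ^- 2 by rewrite powR_invn// ltW.
have -> : 4 / c ^+ 2 / x ^+ 2 = ((c * x / 2)^-1) ^+ 2.
  by field; rewrite !gt_eqF.
rewrite ler_sqr ?nnegrE ?expR_ge0//; last by rewrite invr_ge0 divr_ge0 ?mulr_ge0 ?ltW.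
by apply: expRN_le; rewrite divr_gt0 ?mulr_gt0.
Qed.

Lemma abs_sin_le x : `|sin x| <= `|x|.
Proof.
rewrite -{1}[sin x]subr0 -(sin0 R) -{2}[x]subr0 -[`|x - 0|]mul1r.
by apply: (@is_derive_lipschitz _ sin cos) => y; exact: cos_max.
Qed.

Lemma cos_lip x y : `|cos x - cos y| <= `|x - y|.
Proof.
rewrite -[leRHS]mul1r; apply: (@is_derive_lipschitz _ cos (fun y => - sin y)) => z.
by rewrite normrN sin_max.
Qed.

Lemma sin_lip x y : `|sin x - sin y| <= `|x - y|.
Proof.
rewrite -[leRHS]mul1r; apply: (@is_derive_lipschitz _ sin cos) => z.
exact: cos_max.
Qed.

Lemma onem_cos_ge0 x : 0 <= 1 - cos x.
Proof. by rewrite subr_ge0 cos_le1. Qed.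

Lemma onem_cos_le x : 1 - cos x <= `|x|.
Proof.
by apply: (le_trans (ler_norm _)); rewrite -(cos0 R); apply: (le_trans (cos_lip _ _)); rewrite sub0r normrN.
Qed.

Lemma onem_cos_le2 x : 1 - cos x <= x ^+ 2.
Proof.
have -> : 1 - cos x = 2 * sin (x / 2) ^+ 2.
  have {1}-> : x = (x / 2) *+ 2 by rewrite -mulr_natr divfK.
  rewrite cos_mulr2n cos2sin2; ring.
have : sin (x / 2) ^+ 2 <= (x / 2) ^+ 2.
  by rewrite -[leLHS]real_normK ?num_real// -[leRHS]real_normK ?num_real// ler_sqr ?nnegrE// abs_sin_le.
rewrite exprMn; nra.
Qed.

Lemma onem_expRN x : 0 <= x -> 0 <= 1 - expR (- x) <= x.
Proof.
move=> x0; apply/andP; split.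
  by rewrite subr_ge0 expR_le1 oppr_le0.
have := expR_ge1Dx (- x); lra.
Qed.

End domination.

(** * The integrals of 1 - cos and sin against u^(- 1 - al), for al < 1 *)

Section rotation_algebra.
Context {R : comRingType}.
Implicit Types a c p q s k x y : R.

(** With z = s + i k the hypotheses say z (x - i y) = a (p + i q). Multiplication by c + i gives
    this identity as the real part and [rotation_derivY] as the imaginary part. *)
Lemma rotation_derivX a c s k x y p q : s * x + k * y = a * p -> s * y - k * x = - a * q ->
  (c * s - k) * x + (c * k + s) * y = a * (c * p - q).
Proof.
move=> hX hY.
have -> : (c * s - k) * x + (c * k + s) * y = c * (s * x + k * y) + (s * y - k * x) by ring.
by rewrite hX hY; ring.
Qed.

Lemma rotation_derivY a c s k x y p q : s * x + k * y = a * p -> s * y - k * x = - a * q ->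
  (c * k + s) * x - (c * s - k) * y = a * (c * q + p).
Proof.
move=> hX hY.
have -> : (c * k + s) * x - (c * s - k) * y = (s * x + k * y) - c * (s * y - k * x) by ring.
by rewrite hX hY; ring.
Qed.

Lemma rotation_solve c s p q r : c ^+ 2 + s ^+ 2 = 1 ->
  p * c + q * s = r -> q * c = p * s -> p = r * c /\ q = r * s.
Proof.
move=> cs <- h; split.
  rewrite -[LHS]mulr1 -cs mulrDr mulrDl [q * s * c]mulrAC h; ring.
rewrite -[LHS]mulr1 -cs mulrDr mulrDl [q * c ^+ 2]mulrA h; ring.
Qed.

End rotation_algebra.

Section rotation.
Context {R : realType}.
Notation mu := (@lebesgue_measure R).
Variables (al c : R).
Hypothesis al01 : 0 < al < 1.

Let al0 : 0 < al. Proof. by case/andP: al01. Qed.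
Let al1 : al < 1. Proof. by case/andP: al01. Qed.

(** z = S + i K = exp ((c + i) t) is a logarithmic spiral from 1 to i exp (c pi / 2). Below, P + i Q
    is the integral of (1 - exp (- z u)) u^(- 1 - al) and X - i Y that of exp (- z u) u^(- al). The
    goal is P + i Q = z^al J0 up to the end of the spiral on the imaginary axis, where 1 - cos and
    sin appear; [c] places that end at any frequency. *)
Let S (t : R) := expR (c * t) * cos t.
Let K (t : R) := expR (c * t) * sin t.
Let I f := \int[mu]_(u in `]0, +oo[) f u.

Let fP s k (u : R) := (1 - expR (- (s * u)) * cos (k * u)) * u `^ (- 1 - al).
Let fQ s k (u : R) := expR (- (s * u)) * sin (k * u) * u `^ (- 1 - al).
Let fX s k (u : R) := expR (- (s * u)) * cos (k * u) * u `^ (- al).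
Let fY s k (u : R) := expR (- (s * u)) * sin (k * u) * u `^ (- al).

Let expsu1 (s u : R) : 0 <= s -> 0 < u -> expR (- (s * u)) <= 1.
Proof. by move=> s0 u0; rewrite expR_le1 oppr_le0 mulr_ge0// ltW. Qed.

Let powSub (u : R) : 0 < u -> u * u `^ (- 1 - al) = u `^ (- al).
Proof. by move=> u0; rewrite -{1}[u]powRr1 ?ltW// -powRDp//; congr (_ `^ _); ring. Qed.

Lemma onem_expcos_le (s k u : R) : 0 <= s -> 0 < u ->
  `|1 - expR (- (s * u)) * cos (k * u)| <= (s + `|k|) * u.
Proof.
move=> s0 u0.
have su : 0 <= s * u by rewrite mulr_ge0// ltW.
have /andP[h1 h2] := onem_expRN su.
have h3 := onem_cos_le (k * u); have h4 := onem_cos_ge0 (k * u).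
rewrite normrM (gtr0_norm u0) in h3.
have e0 := expR_ge0 (- (s * u)); have e1 := expsu1 s0 u0.
have c1 := cos_le1 (k * u).
by rewrite ger0_norm; nra.
Qed.

Lemma onem_expcos_le2 (s k u : R) : 0 <= s -> 0 < u ->
  `|1 - expR (- (s * u)) * cos (k * u)| <= 2.
Proof.
move=> s0 u0; have e0 := expR_ge0 (- (s * u)); have e1 := expsu1 s0 u0.
have c1 := cos_le1 (k * u); have c2 := cos_geN1 (k * u).
by rewrite ler_norml; apply/andP; split; nra.
Qed.

Lemma expsin_le (s k u : R) : 0 <= s -> 0 < u ->
  `|expR (- (s * u)) * sin (k * u)| <= `|k| * u.
Proof.
move=> s0 u0; have e0 := expR_ge0 (- (s * u)); have e1 := expsu1 s0 u0.
rewrite normrM (ger0_norm e0); apply: (@le_trans _ _ `|sin (k * u)|).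
  by rewrite ler_piMl.
by rewrite (le_trans (abs_sin_le _))// normrM (gtr0_norm u0).
Qed.

Lemma expsin_le1 (s k u : R) : 0 <= s -> 0 < u ->
  `|expR (- (s * u)) * sin (k * u)| <= 1.
Proof.
move=> s0 u0; have e0 := expR_ge0 (- (s * u)); have e1 := expsu1 s0 u0.
by rewrite normrM (ger0_norm e0) mulr_ile1// sin_max.
Qed.

Let mfP s k : measurable_fun setT (fP s k). Proof. by rewrite /fP; mfun. Qed.
Let mfQ s k : measurable_fun setT (fQ s k). Proof. by rewrite /fQ; mfun. Qed.
Let mfX s k : measurable_fun setT (fX s k). Proof. by rewrite /fX; mfun. Qed.
Let mfY s k : measurable_fun setT (fY s k). Proof. by rewrite /fY; mfun. Qed.

Let fP0 s k u C : 0 <= s -> s + `|k| <= C -> 0 < u <= 1 ->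
  `|fP s k u| <= (2 + C) * u `^ (- al).
Proof.
move=> s0 kC /andP[u0 u1]; rewrite /fP normrM [`|_ `^ _|]ger0_norm ?powR_ge0//.
apply: (@le_trans _ _ (C * u * u `^ (- 1 - al))).
  rewrite ler_wpM2r ?powR_ge0//; apply: (le_trans (onem_expcos_le _ s0 u0)).
  by rewrite ler_wpM2r// ltW.
by rewrite -mulrA powSub// ler_wpM2r ?powR_ge0// lerDr.
Qed.

Let fP1 s k u C : 0 <= s -> s + `|k| <= C -> 1 <= u ->
  `|fP s k u| <= (2 + C) * u `^ (- 1 - al).
Proof.
move=> s0 kC u1; have u0 : 0 < u by exact: lt_le_trans u1.
rewrite /fP normrM [`|_ `^ _|]ger0_norm ?powR_ge0// ler_wpM2r ?powR_ge0//.
apply: (le_trans (onem_expcos_le2 _ s0 u0)); rewrite lerDl.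
by rewrite (le_trans _ kC)// addr_ge0.
Qed.

Let fQ0 s k u C : 0 <= s -> s + `|k| <= C -> 0 < u <= 1 ->
  `|fQ s k u| <= (2 + C) * u `^ (- al).
Proof.
move=> s0 kC /andP[u0 u1]; rewrite /fQ normrM [`|_ `^ _|]ger0_norm ?powR_ge0//.
apply: (@le_trans _ _ (C * u * u `^ (- 1 - al))).
  rewrite ler_wpM2r ?powR_ge0//; apply: (le_trans (expsin_le _ s0 u0)).
  by rewrite ler_wpM2r ?(ltW u0)// (le_trans _ kC)// lerDr.
by rewrite -mulrA powSub// ler_wpM2r ?powR_ge0// lerDr.
Qed.

Let fQ1 s k u C : 0 <= s -> s + `|k| <= C -> 1 <= u ->
  `|fQ s k u| <= (2 + C) * u `^ (- 1 - al).
Proof.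
move=> s0 kC u1; have u0 : 0 < u by exact: lt_le_trans u1.
rewrite /fQ normrM [`|_ `^ _|]ger0_norm ?powR_ge0// ler_wpM2r ?powR_ge0//.
apply: (le_trans (expsin_le1 _ s0 u0)).
have : 0 <= C by rewrite (le_trans _ kC)// addr_ge0.
rlra.
Qed.

Let iP s k : 0 <= s -> mu.-integrable `]0, +oo[ (EFin \o fP s k).
Proof.
move=> s0; apply: (@dom0y_integrable _ _ (- al) (- 1 - al) (2 + (s + `|k|))) => //.
- by rewrite ltrN2.
- by rewrite gtrDl oppr_lt0.
- by move=> u; exact: fP0.
- by move=> u; exact: fP1.
Qed.

Let iQ s k : 0 <= s -> mu.-integrable `]0, +oo[ (EFin \o fQ s k).
Proof.
move=> s0; apply: (@dom0y_integrable _ _ (- al) (- 1 - al) (2 + (s + `|k|))) => //.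
- by rewrite ltrN2.
- by rewrite gtrDl oppr_lt0.
- by move=> u; exact: fQ0.
- by move=> u; exact: fQ1.
Qed.

Let G s (u : R) := expR (- (s * u)) * u `^ (- al).

Let G0 s u : 0 < s -> 0 < u <= 1 -> `|G s u| <= (1 + 4 / s ^+ 2) * u `^ (- al).
Proof.
move=> s0 /andP[u0 u1]; rewrite /G normrM [`|_ `^ _|]ger0_norm ?powR_ge0//.
rewrite ler_wpM2r ?powR_ge0// ger0_norm ?expR_ge0//.
apply: (le_trans (expsu1 (ltW s0) u0)); rewrite lerDl divr_ge0//.
by rewrite exprn_ge0// ltW.
Qed.

Let G1 s u : 0 < s -> 1 <= u -> `|G s u| <= (1 + 4 / s ^+ 2) * u `^ (- 2).
Proof.
move=> s0 u1; have u0 : 0 < u by exact: lt_le_trans u1.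
rewrite /G normrM [`|_ `^ _|]ger0_norm ?powR_ge0// ger0_norm ?expR_ge0//.
apply: (@le_trans _ _ (expR (- (s * u)))).
  rewrite ler_piMr ?expR_ge0// powRN invf_le1 ?powR_gt0//.
  by apply: powR_ge1 => //; exact: ltW.
apply: (le_trans (expRN_le2 s0 u0)).
by rewrite ler_wpM2r ?powR_ge0// lerDr.
Qed.

Let iG s : 0 < s -> mu.-integrable `]0, +oo[ (EFin \o G s).
Proof.
move=> s0; apply: (@dom0y_integrable _ _ (- al) (- 2) (1 + 4 / s ^+ 2)) => //.
- by rewrite /G; mfun.
- by rewrite ltrN2.
- by rewrite ltrN2 ltr1n.
- by move=> u; exact: G0.
- by move=> u; exact: G1.
Qed.

Let iX s k : 0 < s -> mu.-integrable `]0, +oo[ (EFin \o fX s k).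
Proof.
move=> s0; apply: (le_integrable1 _ _ (iG s0)) => //; first exact: measurable_funTS (mfX s k).
move=> u /=; rewrite in_itv/= andbT => u0; rewrite /fX /G.
rewrite 2!normrM [`|_ `^ _|]ger0_norm ?powR_ge0// ler_wpM2r ?powR_ge0//.
by rewrite ger0_norm ?expR_ge0// ler_piMr ?expR_ge0 ?cos_max.
Qed.

Let iY s k : 0 < s -> mu.-integrable `]0, +oo[ (EFin \o fY s k).
Proof.
move=> s0; apply: (le_integrable1 _ _ (iG s0)) => //; first exact: measurable_funTS (mfY s k).
move=> u /=; rewrite in_itv/= andbT => u0; rewrite /fY /G.
rewrite 2!normrM [`|_ `^ _|]ger0_norm ?powR_ge0// ler_wpM2r ?powR_ge0//.
by rewrite ger0_norm ?expR_ge0// ler_piMr ?expR_ge0 ?sin_max.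
Qed.

Let powNal (u : R) : 0 < u -> u `^ (- al - 1) = u `^ (- 1 - al).
Proof. by move=> _; congr (_ `^ _); ring. Qed.

(** Real part of z (X - i Y) = al (P + i Q), by parts: (1 - exp (- z u)) u^(- al) vanishes at 0
    because al < 1 and at infinity because al > 0. [ibpY] is the imaginary part. *)
Let ibpX s k : 0 < s -> s * I (fX s k) + k * I (fY s k) = al * I (fP s k).
Proof.
move=> s0.
pose f (u : R) : R := s * fX s k u + k * fY s k u - al * fP s k u.
pose F (u : R) : R := (1 - expR (- (s * u)) * cos (k * u)) * u `^ (- al).
have dF (u : R) : 0 < u -> is_derive u (1 : R) F (f u).
  move=> u0; rewrite /F; der_eq => //.
  by rewrite powNal// /f /fX /fY /fP; ring.
have cf (u : R) : 0 < u -> {for u, continuous f}.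
  by move=> u0; rewrite /f /fX /fY /fP; der_cont.
have F0 : F u @[u --> 0^'+] --> 0.
  have p0 : 0 < 1 - al by rewrite subr_gt0.
  apply: (@cvg0_powR_bound _ _ _ (s + `|k|) _ p0) => u /andP[u0 u1].
  rewrite subr0 normrM [`|_ `^ _|]ger0_norm ?powR_ge0//.
  rewrite powRDp// powRr1 ?(ltW u0)// mulrA ler_wpM2r ?powR_ge0//.
  by apply: onem_expcos_le => //; exact: ltW.
have F1 : F u @[u --> +oo] --> 0.
  apply: (@cvgy_powR_bound _ _ _ 2 _ al0) => u u1.
  have u0 : 0 < u by exact: lt_le_trans u1.
  rewrite subr0 normrM [`|_ `^ _|]ger0_norm ?powR_ge0// ler_wpM2r ?powR_ge0//.
  by apply: onem_expcos_le2 => //; exact: ltW.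
have ifn : mu.-integrable `]0, +oo[ (EFin \o f).
  apply: integrableB1 => //; last by apply: integrableZl1 => //; apply: iP; exact: ltW.
  by apply: integrableD1 => //; apply: integrableZl1 => //; [exact: iX|exact: iY].
have e := ftc_itv0y dF cf F0 F1 ifn.
move: e; rewrite subr0 /f RintegralB//; last 2 first.
- by apply: integrableD1 => //; apply: integrableZl1 => //; [exact: iX|exact: iY].
- by apply: integrableZl1 => //; apply: iP; exact: ltW.
rewrite RintegralD//; last 2 first.
- by apply: integrableZl1 => //; exact: iX.
- by apply: integrableZl1 => //; exact: iY.
rewrite !RintegralZl//; do ?[exact: iX|exact: iY|by apply: iP; exact: ltW].
by move/eqP; rewrite subr_eq0 => /eqP.
Qed.

Let ibpY s k : 0 < s -> s * I (fY s k) - k * I (fX s k) = - al * I (fQ s k).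
Proof.
move=> s0.
pose f (u : R) : R := k * fX s k u - s * fY s k u - al * fQ s k u.
pose F (u : R) : R := expR (- (s * u)) * sin (k * u) * u `^ (- al).
have dF (u : R) : 0 < u -> is_derive u (1 : R) F (f u).
  move=> u0; rewrite /F; der_eq => //.
  by rewrite powNal// /f /fX /fY /fQ; ring.
have cf (u : R) : 0 < u -> {for u, continuous f}.
  by move=> u0; rewrite /f /fX /fY /fQ; der_cont.
have F0 : F u @[u --> 0^'+] --> 0.
  have p0 : 0 < 1 - al by rewrite subr_gt0.
  apply: (@cvg0_powR_bound _ _ _ `|k| _ p0) => u /andP[u0 u1].
  rewrite subr0 normrM [`|_ `^ _|]ger0_norm ?powR_ge0//.
  rewrite powRDp// powRr1 ?(ltW u0)// mulrA ler_wpM2r ?powR_ge0//.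
  by apply: expsin_le => //; exact: ltW.
have F1 : F u @[u --> +oo] --> 0.
  apply: (@cvgy_powR_bound _ _ _ 1 _ al0) => u u1.
  have u0 : 0 < u by exact: lt_le_trans u1.
  rewrite subr0 normrM [`|_ `^ _|]ger0_norm ?powR_ge0// ler_wpM2r ?powR_ge0//.
  by apply: expsin_le1 => //; exact: ltW.
have ifn : mu.-integrable `]0, +oo[ (EFin \o f).
  apply: integrableB1 => //; last by apply: integrableZl1 => //; apply: iQ; exact: ltW.
  by apply: integrableB1 => //; apply: integrableZl1 => //; [exact: iX|exact: iY].
have e := ftc_itv0y dF cf F0 F1 ifn.
move: e; rewrite subr0 /f RintegralB//; last 2 first.
- by apply: integrableB1 => //; apply: integrableZl1 => //; [exact: iX|exact: iY].
- by apply: integrableZl1 => //; apply: iQ; exact: ltW.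
rewrite RintegralB//; last 2 first.
- by apply: integrableZl1 => //; exact: iX.
- by apply: integrableZl1 => //; exact: iY.
rewrite !RintegralZl//; do ?[exact: iX|exact: iY|by apply: iQ; exact: ltW].
by rewrite /I => h; have {}h := subr0_eq h; rewrite mulNr -h opprB.
Qed.


Let dS t : is_derive t (1 : R) S (c * S t - K t).
Proof. by rewrite /S /K; der_eq; ring. Qed.

Let dK t : is_derive t (1 : R) K (c * K t + S t).
Proof. by rewrite /S /K; der_eq; ring. Qed.

Section derivative.
Variable t : R.
Hypothesis t0 : 0 < t < pi / 2.

(** The neighbourhood ]u, v[ of t stays away from 0 and pi / 2. There [S] is at least [s0] > 0, so
    the derivatives of the integrands are dominated by a multiple of exp (- s0 y) y^(- al). *)
Let u := t / 2.
Let v := (t + pi / 2) / 2.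
Let E := expR (`|c| * (pi / 2)).
Let s0 := E^-1 * cos v.

Let pih : 0 < pi / 2 :> R. Proof. by rewrite divr_gt0 ?pi_gt0. Qed.

Let utv : `]u, v[%classic t.
Proof. by case/andP: t0 => h1 h2; rewrite /= in_itv/= /u /v; apply/andP; split; rlra. Qed.

Let uv0 x : u < x < v -> 0 < x < pi / 2.
Proof. by case/andP: t0 => h1 h2; rewrite /u /v => /andP[h3 h4]; apply/andP; split; rlra. Qed.

Let cE x : 0 < x < pi / 2 -> E^-1 <= expR (c * x) <= E.
Proof.
move=> /andP[x0 x1]; rewrite -expRN !ler_expR -ler_norml normrM (gtr0_norm x0).
by rewrite ler_wpM2l// ltW.
Qed.

Let s0_gt0 : 0 < s0.
Proof.
rewrite mulr_gt0 ?invr_gt0 ?expR_gt0//; apply: cos_gt0_pihalf.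
by case/andP: t0 => h3 h4; rewrite /v; apply/andP; split; rlra.
Qed.

Let s0S x : u < x < v -> s0 <= S x.
Proof.
move=> xuv; have /andP[h1 h2] := cE (uv0 xuv); rewrite /s0 /S.
apply: ler_pM => //; first by rewrite invr_ge0 expR_ge0.
  by apply/ltW; apply: cos_gt0_pihalf; case/andP: t0 => h3 h4; rewrite /v; apply/andP; split; rlra.
have xv : x < v by case/andP: xuv.
have /andP[x0 x1] := uv0 xuv.
apply/ltW; rewrite ltr_cos// in_itv/=; case/andP: t0 => h3 h4; rewrite /v in xv *; apply/andP; split; rlra.
Qed.

Let SE x : u < x < v -> `|S x| <= E.
Proof.
move=> xuv; have /andP[h1 h2] := cE (uv0 xuv).
by rewrite normrM (ger0_norm (expR_ge0 _)) (le_trans _ h2)// ler_piMr ?expR_ge0 ?cos_max.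
Qed.

Let KE x : u < x < v -> `|K x| <= E.
Proof.
move=> xuv; have /andP[h1 h2] := cE (uv0 xuv).
by rewrite normrM (ger0_norm (expR_ge0 _)) (le_trans _ h2)// ler_piMr ?expR_ge0 ?sin_max.
Qed.

Let M := 2 * (`|c| + 1) * E.

Let S'M x : u < x < v -> `|c * S x - K x| + `|c * K x + S x| <= M.
Proof.
move=> xuv; have := SE xuv; have := KE xuv => hK hS.
have h1 : `|c * S x - K x| <= `|c| * E + E.
  apply: (le_trans (ler_normB _ _)); rewrite normrM lerD// ler_wpM2l//.
have h2 : `|c * K x + S x| <= `|c| * E + E.
  apply: (le_trans (ler_normD _ _)); rewrite normrM lerD// ler_wpM2l//.
by rewrite /M; rlra.
Qed.

Let GM y := M * G s0 y.

Let GM_ge0 y : 0 <= GM y.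
Proof. by rewrite /GM /M /G !mulr_ge0 ?addr_ge0 ?expR_ge0 ?powR_ge0. Qed.

Let iGM : mu.-integrable `]0, +oo[ (EFin \o GM).
Proof. by apply: integrableZl1 => //; apply: iG; exact: s0_gt0. Qed.

Let dfPg (s k : R -> R) x a b y : 0 < y ->
  is_derive x (1 : R) s a -> is_derive x (1 : R) k b ->
  is_derive x (1 : R) (fun x => fP (s x) (k x) y)
    (a * fX (s x) (k x) y + b * fY (s x) (k x) y).
Proof.
move=> y0 sa kb; rewrite /fP; notypeclasses refine (is_derive_eq1 _ _).
  by der; first [exact: sa|exact: kb].
by rewrite /fX /fY -powSub//; ring.
Qed.

Let dfQg (s k : R -> R) x a b y : 0 < y ->
  is_derive x (1 : R) s a -> is_derive x (1 : R) k b ->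
  is_derive x (1 : R) (fun x => fQ (s x) (k x) y)
    (b * fX (s x) (k x) y - a * fY (s x) (k x) y).
Proof.
move=> y0 sa kb; rewrite /fQ; notypeclasses refine (is_derive_eq1 _ _).
  by der; first [exact: sa|exact: kb].
by rewrite /fX /fY -powSub//; ring.
Qed.

Let dfP x y : 0 < y -> is_derive x (1 : R) (fun x => fP (S x) (K x) y)
  ((c * S x - K x) * fX (S x) (K x) y + (c * K x + S x) * fY (S x) (K x) y).
Proof. by move=> y0; apply: dfPg. Qed.

Let dfQ x y : 0 < y -> is_derive x (1 : R) (fun x => fQ (S x) (K x) y)
  ((c * K x + S x) * fX (S x) (K x) y - (c * S x - K x) * fY (S x) (K x) y).
Proof. by move=> y0; apply: dfQg. Qed.

Let fXG x y : u < x < v -> 0 < y -> `|fX (S x) (K x) y| <= G s0 y.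
Proof.
move=> xuv y0; rewrite /fX /G 2!normrM [`|_ `^ _|]ger0_norm ?powR_ge0//.
rewrite ler_wpM2r ?powR_ge0// ger0_norm ?expR_ge0//.
apply: (@le_trans _ _ (expR (- (S x * y)))).
  by rewrite ler_piMr ?expR_ge0 ?cos_max.
by rewrite ler_expR lerN2 ler_wpM2r ?(ltW y0) ?s0S.
Qed.

Let fYG x y : u < x < v -> 0 < y -> `|fY (S x) (K x) y| <= G s0 y.
Proof.
move=> xuv y0; rewrite /fY /G 2!normrM [`|_ `^ _|]ger0_norm ?powR_ge0//.
rewrite ler_wpM2r ?powR_ge0// ger0_norm ?expR_ge0//.
apply: (@le_trans _ _ (expR (- (S x * y)))).
  by rewrite ler_piMr ?expR_ge0 ?sin_max.
by rewrite ler_expR lerN2 ler_wpM2r ?(ltW y0) ?s0S.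
Qed.

Let combo (a b X Y g m : R) : `|a| + `|b| <= m -> 0 <= g -> `|X| <= g -> `|Y| <= g ->
  `|a * X + b * Y| <= m * g.
Proof.
move=> ab g0 Xg Yg; apply: (le_trans (ler_normD _ _)); rewrite !normrM.
apply: (@le_trans _ _ ((`|a| + `|b|) * g)); last by rewrite ler_wpM2r.
by rewrite mulrDl lerD// ler_wpM2l.
Qed.

Let G_ge0 s y : 0 <= G s y.
Proof. by rewrite mulr_ge0 ?expR_ge0 ?powR_ge0. Qed.

Let S_gt0 x : u < x < v -> 0 < S x.
Proof. by move=> /s0S; apply: lt_le_trans; exact: s0_gt0. Qed.

(** Along the spiral dz = (c + i) z dt, so differentiating under the integral gives (c + i) z (X - i
    Y), which the integration by parts turns into al (c + i) (P + i Q): a linear differential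
    equation. *)
Lemma is_derive_P : is_derive t (1 : R) (fun t => I (fP (S t) (K t)))
  (al * (c * I (fP (S t) (K t)) - I (fQ (S t) (K t)))).
Proof.
pose f x y := fP (S x) (K x) y.
have intf x : `]u, v[%classic x -> mu.-integrable `]0, +oo[ (EFin \o f x).
  by rewrite /= in_itv/= => /S_gt0/ltW; exact: iP.
have derf x y : `]u, v[%classic x -> `]0, +oo[%classic y -> derivable (f ^~ y) x 1.
  by move=> _; rewrite /= in_itv/= andbT => /(dfP x) H; exact: ex_derive.
have fub x y : `]u, v[%classic x -> `]0, +oo[%classic y -> `|partial1of2 f x y| <= GM y.
  rewrite /= !in_itv/= andbT => xuv y0; rewrite /partial1of2 (is_derive1_val (dfP x y0)).
  by apply: combo; [exact: S'M|exact: G_ge0|exact: fXG|exact: fYG].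
have mB : measurable (`]0, +oo[%classic : set (measurableTypeR R)) by [].
have d1 := derivable_under_integral mB utv intf derf GM_ge0 iGM fub.
have d2 := differentiation_under_integral mB utv intf derf GM_ge0 iGM fub.
have St : 0 < S t by apply: S_gt0; move: utv; rewrite /= in_itv/=.
apply: DeriveDef => //; rewrite -derive1E d2.
have -> : \int[mu]_(y in `]0, +oo[) partial1of2 f t y = I (fun y =>
    (c * S t - K t) * fX (S t) (K t) y + (c * K t + S t) * fY (S t) (K t) y).
  apply: eq_Rintegral => y; rewrite inE/= in_itv/= andbT => y0.
  by rewrite /partial1of2 (is_derive1_val (dfP t y0)).
rewrite /I RintegralD//; last 2 first.
- by apply: integrableZl1 => //; exact: iX.
- by apply: integrableZl1 => //; exact: iY.
rewrite !RintegralZl//; [|exact: iY|exact: iX].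
have := ibpX (K t) St; have := ibpY (K t) St; rewrite /I.
set Y := Rintegral _ _ _; set X := Rintegral _ _ _; set QQ := Rintegral _ _ _; set PP := Rintegral _ _ _.
by move=> hY hX; exact: rotation_derivX hX hY.
Qed.

Lemma is_derive_Q : is_derive t (1 : R) (fun t => I (fQ (S t) (K t)))
  (al * (c * I (fQ (S t) (K t)) + I (fP (S t) (K t)))).
Proof.
pose f x y := fQ (S x) (K x) y.
have intf x : `]u, v[%classic x -> mu.-integrable `]0, +oo[ (EFin \o f x).
  by rewrite /= in_itv/= => /S_gt0/ltW; exact: iQ.
have derf x y : `]u, v[%classic x -> `]0, +oo[%classic y -> derivable (f ^~ y) x 1.
  by move=> _; rewrite /= in_itv/= andbT => /(dfQ x) H; exact: ex_derive.
have fub x y : `]u, v[%classic x -> `]0, +oo[%classic y -> `|partial1of2 f x y| <= GM y.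
  rewrite /= !in_itv/= andbT => xuv y0; rewrite /partial1of2 (is_derive1_val (dfQ x y0)).
  rewrite -mulNr; apply: combo; [|exact: G_ge0|exact: fXG|exact: fYG].
  by rewrite normrN addrC; exact: S'M.
have mB : measurable (`]0, +oo[%classic : set (measurableTypeR R)) by [].
have d1 := derivable_under_integral mB utv intf derf GM_ge0 iGM fub.
have d2 := differentiation_under_integral mB utv intf derf GM_ge0 iGM fub.
have St : 0 < S t by apply: S_gt0; move: utv; rewrite /= in_itv/=.
apply: DeriveDef => //; rewrite -derive1E d2.
have -> : \int[mu]_(y in `]0, +oo[) partial1of2 f t y = I (fun y =>
    (c * K t + S t) * fX (S t) (K t) y - (c * S t - K t) * fY (S t) (K t) y).
  apply: eq_Rintegral => y; rewrite inE/= in_itv/= andbT => y0.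
  by rewrite /partial1of2 (is_derive1_val (dfQ t y0)).
rewrite /I RintegralB//; last 2 first.
- by apply: integrableZl1 => //; exact: iX.
- by apply: integrableZl1 => //; exact: iY.
rewrite !RintegralZl//; [|exact: iY|exact: iX].
have := ibpX (K t) St; have := ibpY (K t) St; rewrite /I.
set Y := Rintegral _ _ _; set X := Rintegral _ _ _; set QQ := Rintegral _ _ _; set PP := Rintegral _ _ _.
by move=> hY hX; exact: rotation_derivY hX hY.
Qed.

End derivative.

(** The absolute value keeps the damping nonnegative for all real t, so continuity holds on the
    whole line and no one-sided argument is needed at 0 and pi / 2. *)
Let aS t := expR (c * t) * `|cos t|.

(** The majorants depend only on a bound [C] of [aS t + |K t|], hence hold locally uniformly in t.
    This includes t = pi / 2, where the exponential damping is lost and differentiation under the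
    integral is no longer available. *)
Let cont_int (f : R -> R -> R -> R) :
  (forall s k, measurable_fun setT (f s k)) ->
  (forall s k u C, 0 <= s -> s + `|k| <= C -> 0 < u <= 1 -> `|f s k u| <= (2 + C) * u `^ (- al)) ->
  (forall s k u C, 0 <= s -> s + `|k| <= C -> 1 <= u -> `|f s k u| <= (2 + C) * u `^ (- 1 - al)) ->
  (forall u t, 0 < u -> {for t, continuous (fun t => f (aS t) (K t) u)}) ->
  continuous (fun t => I (f (aS t) (K t))).
Proof.
move=> mf f0 f1 cf t.
pose C := 2 * expR (`|c| * (`|t| + 1)).
have bC x : t - 1 < x < t + 1 -> aS x + `|K x| <= C.
  move=> /andP[x1 x2].
  have xt : `|x| <= `|t| + 1.
    have := ler_norm t; have := ler_norm (- t); rewrite normrN => h1 h2.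
    by rewrite ler_norml; apply/andP; split; rlra.
  have e1 : expR (c * x) <= expR (`|c| * (`|t| + 1)).
    rewrite ler_expR (le_trans (ler_norm _))// normrM ler_wpM2l//.
  rewrite /aS /K /C mulr_natl mulr2n normrM (ger0_norm (expR_ge0 _)).
  by apply: lerD; (apply: (le_trans _ e1); rewrite ler_piMr ?expR_ge0 ?cos_max ?sin_max).
have aS0 x : 0 <= aS x by rewrite mulr_ge0 ?expR_ge0.
pose g u : R := (2 + C) * (4 * (peak (- al + 1) u + peak (- (- 1 - al) - 1) u)).
have ig : mu.-integrable `]0, +oo[ (EFin \o g).
  apply: integrableZl1 => //; apply: integrableZl1 => //; apply: integrableD1 => //.
    by have [] := @peak_integral R (- al + 1); first by rewrite addrC subr_gt0.
  have [] := @peak_integral R (- (- 1 - al) - 1) => //.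
  by rewrite opprB opprK addrK.
have int_f x : `]t - 1, t + 1[%classic x -> mu.-integrable `]0, +oo[ (EFin \o f (aS x) (K x)).
  move=> _; apply: (@dom0y_integrable _ _ (- al) (- 1 - al) (2 + (aS x + `|K x|))) => //.
  - by rewrite ltrN2.
  - by rewrite gtrDl oppr_lt0.
  - by move=> u; exact: f0.
  - by move=> u; exact: f1.
have mB : measurable (`]0, +oo[%classic : set (measurableTypeR R)) by [].
have C0 : 0 <= C by rewrite mulr_ge0 ?expR_ge0.
have gub x : `]t - 1, t + 1[%classic x ->
    {ae mu, forall u, `]0, +oo[%classic u -> `|f (aS x) (K x) u| <= g u}.
  rewrite /= in_itv/= => xt; apply: aeW => u; rewrite /= in_itv/= andbT => u0.
  have bx := bC _ xt; rewrite /g.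
  have [u1|u1] := leP u 1.
    have u01 : 0 < u <= 1 by rewrite u0.
    apply: (le_trans (f0 _ _ _ _ (aS0 x) bx u01)).
    rewrite ler_wpM2l ?addr_ge0//; apply: (@le_trans _ _ (4 * peak (- al + 1) u)).
      by apply: le_peak0 => //; rewrite ltrN2.
    by rewrite ler_wpM2l// lerDl peak_ge0.
  apply: (le_trans (f1 _ _ _ _ (aS0 x) bx (ltW u1))).
  rewrite ler_wpM2l ?addr_ge0//; apply: (@le_trans _ _ (4 * peak (- (- 1 - al) - 1) u)).
    by apply: le_peaky (ltW u1); rewrite gtrDl oppr_lt0.
  by rewrite ler_wpM2l// lerDr peak_ge0.
have cfa : {ae mu, forall u, `]0, +oo[%classic u ->
    {in `]t - 1, t + 1[%classic, continuous ((fun x => f (aS x) (K x)) ^~ u)}}.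
  by apply: aeW => u; rewrite /= in_itv/= andbT => u0 x _; exact: cf.
apply: (continuity_under_integral mB int_f cfa ig gub).
by rewrite inE/= in_itv/= ltrBlDr ltrDl ltr01.
Qed.

Let caS : continuous aS.
Proof.
move=> t; apply: cvgM; last first.
  by apply: cvg_norm; exact: continuous_cos.
by apply: (@is_derive1_cont _ (fun t => expR (c * t))); der.
Qed.

Let cK : continuous K.
Proof. by move=> t; exact: is_derive1_cont (dK t). Qed.

Let cexpS u : continuous (fun t => expR (- (aS t * u))).
Proof.
move=> t; apply: (@continuous_comp _ _ _ (fun t => - (aS t * u)) expR).
  by apply: cvgN; apply: cvgM; [exact: caS|exact: cvg_cst].
exact: continuous_expR.
Qed.

Let ccosK u : continuous (fun t => cos (K t * u)).
Proof.
move=> t; apply: (@continuous_comp _ _ _ (fun t => K t * u) cos).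
  by apply: cvgM; [exact: cK|exact: cvg_cst].
exact: continuous_cos.
Qed.

Let csinK u : continuous (fun t => sin (K t * u)).
Proof.
move=> t; apply: (@continuous_comp _ _ _ (fun t => K t * u) sin).
  by apply: cvgM; [exact: cK|exact: cvg_cst].
exact: continuous_sin.
Qed.

Let P t := I (fP (aS t) (K t)).
Let Q t := I (fQ (aS t) (K t)).

Let cP : continuous P.
Proof.
apply: (cont_int mfP fP0 fP1).
move=> u t u0; rewrite /fP; apply: cvgM; last exact: cvg_cst.
by apply: cvgB; [exact: cvg_cst|apply: cvgM; [exact: cexpS|exact: ccosK]].
Qed.

Let cQ : continuous Q.
Proof.
apply: (cont_int mfQ fQ0 fQ1).
move=> u t u0; rewrite /fQ; apply: cvgM; last exact: cvg_cst.
by apply: cvgM; [exact: cexpS|exact: csinK].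
Qed.

Let aSE t : 0 < t < pi / 2 -> aS t = S t.
Proof.
move=> /andP[t0 t1]; rewrite /aS gtr0_norm//; apply: cos_gt0_pihalf.
by rewrite t1 andbT (lt_trans _ t0)// oppr_lt0 divr_gt0 ?pi_gt0.
Qed.

Let near_aSE t : 0 < t < pi / 2 -> \near t, S t = aS t.
Proof.
move=> /andP[t0 t1]; near=> x; rewrite aSE//; apply/andP; split; near: x.
  exact: lt_nbhsr.
exact: lt_nbhsl.
Unshelve. all: by end_near. Qed.

Let dP t : 0 < t < pi / 2 -> is_derive t (1 : R) P (al * (c * P t - Q t)).
Proof.
move=> t0; rewrite /P /Q aSE//; apply: near_eq_is_derive (is_derive_P t0).
by apply: filterS (near_aSE t0) => x ->.
Qed.

Let dQ t : 0 < t < pi / 2 -> is_derive t (1 : R) Q (al * (c * Q t + P t)).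
Proof.
move=> t0; rewrite /P /Q aSE//; apply: near_eq_is_derive (is_derive_Q t0).
by apply: filterS (near_aSE t0) => x ->.
Qed.

Let pih : 0 < pi / 2 :> R. Proof. by rewrite divr_gt0 ?pi_gt0. Qed.

Let const_pihalf (W : R -> R) : continuous W ->
  (forall t, 0 < t < pi / 2 -> is_derive t (1 : R) W 0) -> W (pi / 2) = W 0.
Proof.
move=> cW dW.
have dW' x : x \in `]0, pi / 2[ -> is_derive x (1 : R) W 0 by rewrite in_itv; exact: dW.
have [x _] := MVT pih dW' (continuous_subspaceT cW).
by rewrite mul0r => /eqP; rewrite subr_eq0 => /eqP.
Qed.

Let e t := expR (- (al * c * t)).

(** [W1] and [W2] are the real and imaginary parts of exp (- al (c + i) t) (P + i Q), which the
    differential equation makes constant on ]0, pi / 2[ and continuity extends to the ends. *)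
Let W1 t := e t * (P t * cos (al * t) + Q t * sin (al * t)).
Let W2 t := e t * (Q t * cos (al * t) - P t * sin (al * t)).

Let ce : continuous e.
Proof. by move=> t; rewrite /e; der_cont. Qed.

Let ccos : continuous (fun t => cos (al * t)).
Proof. by move=> t; der_cont. Qed.

Let csin : continuous (fun t => sin (al * t)).
Proof. by move=> t; der_cont. Qed.

Let W1E : W1 (pi / 2) = W1 0.
Proof.
apply: const_pihalf.
  move=> t; apply: cvgM; first exact: ce.
  by apply: cvgD; apply: cvgM; [exact: cP|exact: ccos|exact: cQ|exact: csin].
move=> t t0; have hP := dP t0; have hQ := dQ t0; rewrite /W1 /e.
clearbody P Q.
notypeclasses refine (is_derive_eq1 _ _); first by der; first [exact: hP|exact: hQ].
by cbv beta; ring.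
Qed.

Let W2E : W2 (pi / 2) = W2 0.
Proof.
apply: const_pihalf.
  move=> t; apply: cvgM; first exact: ce.
  by apply: cvgB; apply: cvgM; [exact: cQ|exact: ccos|exact: cP|exact: csin].
move=> t t0; have hP := dP t0; have hQ := dQ t0; rewrite /W2 /e.
clearbody P Q.
notypeclasses refine (is_derive_eq1 _ _); first by der; first [exact: hP|exact: hQ].
by cbv beta; ring.
Qed.

Let P0 : P 0 = \int[mu]_(u in `]0, +oo[) ((1 - expR (- u)) * u `^ (- 1 - al)).
Proof.
apply: eq_Rintegral => u _; rewrite /fP /aS /K !(mulr0, mul0r) expR0 cos0 normr1 sin0.
by rewrite !(mulr0, mul0r, mul1r) cos0 mulr1.
Qed.

Let Q0 : Q 0 = 0.
Proof.
rewrite /Q /I; under eq_Rintegral.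
  move=> u _; rewrite /fQ /K sin0 mulr0 mul0r sin0 mulr0 mul0r; over.
by rewrite Rintegral_cst// mul0r.
Qed.

Let lam := expR (c * (pi / 2)).

Let Ppih : P (pi / 2) =
  \int[mu]_(u in `]0, +oo[) ((1 - cos (lam * u)) * u `^ (- 1 - al)).
Proof.
apply: eq_Rintegral => u _; rewrite /fP /aS /K cos_pihalf normr0 sin_pihalf mulr0 mulr1.
by rewrite mul0r oppr0 expR0 mul1r.
Qed.

Let Qpih : Q (pi / 2) =
  \int[mu]_(u in `]0, +oo[) (sin (lam * u) * u `^ (- 1 - al)).
Proof.
apply: eq_Rintegral => u _; rewrite /fQ /aS /K cos_pihalf normr0 sin_pihalf mulr0 mulr1.
by rewrite mul0r oppr0 expR0 mul1r.
Qed.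

Let J0 := \int[mu]_(u in `]0, +oo[) ((1 - expR (- u)) * u `^ (- 1 - al)).

(** At t = 0 the pair (P, Q) is (J0, 0); equating the two invariants with their values at pi / 2 and
    inverting the rotation by the angle pi al / 2 gives both integrals. *)
Lemma rotation_integrals :
  \int[mu]_(u in `]0, +oo[) ((1 - cos (lam * u)) * u `^ (- 1 - al)) =
    lam `^ al * J0 * cos (pi * al / 2) /\
  \int[mu]_(u in `]0, +oo[) (sin (lam * u) * u `^ (- 1 - al)) =
    lam `^ al * J0 * sin (pi * al / 2).
Proof.
have := W1E; have := W2E; rewrite /W1 /W2 Q0 -Ppih -Qpih /J0 -P0 /e.
rewrite !mulr0 sin0 cos0 oppr0 expR0 !(mulr0, mul0r, mulr1, mul1r) subr0 addr0.
have -> : al * (pi / 2) = pi * al / 2 by rewrite mulrA [al * _]mulrC.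
have -> : lam `^ al = (expR (- (al * c * (pi / 2))))^-1.
  by rewrite -expRM -expRN opprK; congr expR; ring.
set E := expR _; have E0 : E != 0 by rewrite gt_eqF ?expR_gt0.
have := cos2Dsin2 (pi * al / 2).
set C := cos _; set D := sin _.
move=> CD h2 h1.
have {}h2 : Q (pi / 2) * C - P (pi / 2) * D = 0.
  by apply: (mulfI E0); rewrite h2 mulr0.
have {}h1 : P (pi / 2) * C + Q (pi / 2) * D = E^-1 * P 0.
  by rewrite -h1 mulrA mulVf// mul1r.
by apply: (rotation_solve CD h1); apply/eqP; rewrite -subr_eq0 h2.
Qed.

Lemma onem_cos_powR_integrable (k : R) :
  mu.-integrable `]0, +oo[ (EFin \o (fun u => (1 - cos (k * u)) * u `^ (- 1 - al))).
Proof.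
have := @iP 0 k (lexx _); apply: eq_integrable => // u _.
by rewrite /fP /= mul0r oppr0 expR0 mul1r.
Qed.

Lemma sin_powR_integrable (k : R) :
  mu.-integrable `]0, +oo[ (EFin \o (fun u => sin (k * u) * u `^ (- 1 - al))).
Proof.
have := @iQ 0 k (lexx _); apply: eq_integrable => // u _.
by rewrite /fQ /= mul0r oppr0 expR0 mul1r.
Qed.

End rotation.

(** * Tonelli and Fubini on rectangles *)

Section fubini.
Context {R : realType} d1 d2 (T1 : measurableType d1) (T2 : measurableType d2).
Variables (m1 : {sigma_finite_measure set T1 -> \bar R}) (m2 : {sigma_finite_measure set T2 -> \bar R}).
Variables (D : set T1) (E : set T2) (f : T1 -> T2 -> R).
Hypotheses (mD : measurable D) (mE : measurable E).
Hypothesis mf : measurable_fun setT (fun z : T1 * T2 => f z.1 z.2).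

Let g (z : T1 * T2) : R := f z.1 z.2 * (\1_D z.1 * \1_E z.2).

Let mg : measurable_fun setT g.
Proof.
apply: measurable_funM1 => //; apply: measurable_funM1.
  by apply: (measurableT_comp (f := \1_D : T1 -> R)); [exact: measurable_indic|exact: measurable_fst].
by apply: (measurableT_comp (f := \1_E : T2 -> R)); [exact: measurable_indic|exact: measurable_snd].
Qed.

Let mf1 x : measurable_fun setT (f x).
Proof. by apply: (measurableT_comp mf (measurable_pair1 x)). Qed.

Let mf2 y : measurable_fun setT (f ^~ y).
Proof. by apply: (measurableT_comp mf (measurable_pair2 y)). Qed.

Let inner1 x : (\int[m2]_y (g (x, y))%:E = ((fun x => \int[m2]_(y in E) (f x y)%:E) \_ D) x)%E.
Proof.
rewrite patchE; case: ifPn => xD.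
  rewrite [RHS]integral_mkcond; apply: eq_integral => y _; rewrite /g /= patchE /indic xD/= mul1r.
  by case: (y \in E); rewrite ?mulr1 ?mulr0.
by transitivity (0 : \bar R)%E => //; apply: integral0_eq => y _; rewrite /g /= /indic (negbTE xD) mul0r mulr0.
Qed.

Let inner2 y : (\int[m1]_x (g (x, y))%:E = ((fun y => \int[m1]_(x in D) (f x y)%:E) \_ E) y)%E.
Proof.
rewrite patchE; case: ifPn => yE.
  rewrite [RHS]integral_mkcond; apply: eq_integral => x _; rewrite /g /= patchE /indic yE/= mulr1.
  by case: (x \in D); rewrite ?mulr1 ?mulr0.
by transitivity (0 : \bar R)%E => //; apply: integral0_eq => x _; rewrite /g /= /indic (negbTE yE) mulr0 mulr0.
Qed.

Lemma tonelli_in : (forall x y, D x -> E y -> 0 <= f x y) ->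
  (\int[m1]_(x in D) \int[m2]_(y in E) (f x y)%:E =
   \int[m2]_(y in E) \int[m1]_(x in D) (f x y)%:E)%E.
Proof.
move=> f0.
have g0 z : (0 <= (EFin \o g) z)%E.
  rewrite lee_fin /g /indic; case: (boolP (z.1 \in D)) => [/set_mem zD|_]; last by rewrite mul0r mulr0.
  case: (boolP (z.2 \in E)) => [/set_mem zE|_]; last by rewrite !mulr0.
  by rewrite !mulr1 f0.
have mgE : measurable_fun setT (EFin \o g) by exact/measurable_EFinP.
have := @fubini_tonelli _ _ _ _ R m1 m2 (EFin \o g) mgE g0.
under eq_integral do rewrite inner1.
under [in RHS]eq_integral do rewrite inner2.
by rewrite -!integral_mkcond.
Qed.

Variables (A : T1 -> R) (B : T2 -> R).
Hypotheses (iA : m1.-integrable D (EFin \o A)) (iB : m2.-integrable E (EFin \o B)).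
Hypothesis fAB : forall x y, D x -> E y -> `|f x y| <= A x * B y.

Let iA' : m1.-integrable setT (EFin \o (A \_ D)).
Proof. by rewrite -restrict_EFin; apply/integrable_restrict; rewrite ?setTI. Qed.

Let iB' : m2.-integrable setT (EFin \o (B \_ E)).
Proof. by rewrite -restrict_EFin; apply/integrable_restrict; rewrite ?setTI. Qed.

Let gAB x y : `|g (x, y)| <= `|(A \_ D) x| * `|(B \_ E) y|.
Proof.
rewrite /g /= /indic !patchE.
case: (boolP (x \in D)) => [xD|_]; last by rewrite mul0r mulr0 normr0 mul0r.
case: (boolP (y \in E)) => [yE|_]; last by rewrite !mulr0 normr0 mulr0.
rewrite !mulr1 -normrM (le_trans _ (ler_norm _))//.
by apply: fAB; rewrite -inE.
Qed.

Let ig : (m1 \x m2)%E.-integrable setT (EFin \o g).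
Proof.
have mgE : measurable_fun setT (EFin \o g) by exact/measurable_EFinP.
apply/(integrable12ltyP m1 m2 mgE).
have iAn := integrable_norm1 iA'; have iBn := integrable_norm1 iB'.
have mAn := measurable_int _ iAn; have mBn := measurable_int _ iBn.
apply: (@le_lt_trans _ _ (\int[m1]_x (`|(A \_ D) x|%:E * \int[m2]_y `|(B \_ E) y|%:E))%E).
  apply: ge0_le_integral => //.
  - by move=> x _; apply: integral_ge0.
  - apply: (measurable_fun_fubini_tonelli_F (m2 := m2) (abse \o (EFin \o g))) => //.
      exact: measurableT_comp.
    by move=> z; exact: abse_ge0.
  - apply: emeasurable_funM => //; exact: measurable_cst.
  - move=> x _.
    have bn0 y : [set: T2] y -> (0 <= `|(B \_ E) y|%:E)%E by move=> _; rewrite lee_fin.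
    have -> : (`|(A \_ D) x|%:E * \int[m2]_y `|(B \_ E) y|%:E =
      \int[m2]_y (`|(A \_ D) x|%:E * `|(B \_ E) y|%:E))%E.
      by rewrite ge0_integralZl.
    apply: ge0_le_integral => //.
    + apply: measurableT_comp => //; apply/measurable_EFinP.
      exact: measurableT_comp mg (measurable_pair1 x).
    + by apply: emeasurable_funM => //; exact: measurable_cst.
    + by move=> y _; rewrite -EFinM lee_fin; exact: gAB.
have Bfin : (\int[m2]_y `|(B \_ E) y|%:E)%E \is a fin_num by apply: (integrable_fin_num _ iBn).
rewrite -(fineK Bfin).
under eq_integral do rewrite muleC.
have := integrable_lty measurableT (integrableZl1 (fine (\int[m2]_y `|(B \_ E) y|%:E)%E) measurableT iAn).
by under eq_integral do rewrite /= EFinM.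
Qed.

Let if1 x : D x -> m2.-integrable E (EFin \o f x).
Proof.
move=> Dx; apply: (le_integrable1 _ _ (integrableZl1 (A x) mE iB)) => //.
  exact: measurable_funTS.
by move=> y Ey; exact: fAB.
Qed.

Let if2 y : E y -> m1.-integrable D (EFin \o (f ^~ y)).
Proof.
move=> Ey; apply: (le_integrable1 _ _ (integrableZl1 (B y) mD iA)) => //.
  exact: measurable_funTS.
by move=> x Dx; rewrite mulrC; exact: fAB.
Qed.

Lemma fubini_in :
  \int[m1]_(x in D) \int[m2]_(y in E) f x y = \int[m2]_(y in E) \int[m1]_(x in D) f x y.
Proof.
have := Fubini ig; rewrite /comp.
under eq_integral do rewrite inner1.
under [in RHS]eq_integral do rewrite inner2.
rewrite -!integral_mkcond => h.
rewrite /Rintegral; congr fine; transitivity (\int[m1]_(x in D) \int[m2]_(y in E) (f x y)%:E)%E.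
  apply: eq_integral => x; rewrite inE => Dx; rewrite fineK//.
  exact: (integrable_fin_num mE (if1 Dx)).
rewrite h; apply: eq_integral => y; rewrite inE => Ey; rewrite fineK//.
exact: (integrable_fin_num mD (if2 Ey)).
Qed.

Lemma fubini_in_integrable :
  m1.-integrable D (EFin \o (fun x => \int[m2]_(y in E) f x y)).
Proof.
have := integrable_fubini_F ig.
rewrite /fubini_F /comp.
under eq_fun do rewrite inner1.
move=> /(integrable_mkcond _ mD) H.
apply: eq_integrable H => // x; rewrite inE => Dx /=.
rewrite /Rintegral fineK//; exact: (integrable_fin_num mE (if1 Dx)).
Qed.

End fubini.

Lemma ge0_integralZl1 d (T : measurableType d) (R : realType)
    (m : {measure set T -> \bar R}) (D : set T) (k : R) (g : T -> R) :
  measurable D -> measurable_fun D g -> (forall x, D x -> 0 <= g x) -> 0 <= k ->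
  (\int[m]_(x in D) (k * g x)%:E = k%:E * \int[m]_(x in D) (g x)%:E)%E.
Proof.
move=> mD mg g0 k0; under eq_integral do rewrite EFinM.
by apply: ge0_integralZl => //; exact/measurable_EFinP.
Qed.

(** * The Gamma constant and the integral for al = 1 *)

Section levy_integrals.
Context {R : realType}.
Notation mu := (@lebesgue_measure R).

Lemma exp_integral (s : R) : 0 < s ->
  (\int[mu]_(u in `]0%R, +oo[) (expR (- (s * u)))%:E = (s^-1)%:E)%E /\
  mu.-integrable `]0, +oo[ (EFin \o (fun u => expR (- (s * u)))).
Proof.
move=> s0; pose F (u : R) := - s^-1 * expR (- (s * u)).
have dF (u : R) : 0 < u -> is_derive u (1 : R) F (expR (- (s * u))).
  by move=> u0; rewrite /F; der_eq; field; rewrite gt_eqF.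
have cf (u : R) : 0 < u -> {for u, continuous (fun u => expR (- (s * u)))}.
  by move=> u0; der_cont.
have F0 : F u @[u --> 0^'+] --> - s^-1.
  apply: cvg_at_right_filter.
  rewrite [X in _ --> X](_ : _ = F 0); last by rewrite /F mulr0 oppr0 expR0 mulr1.
  have : {for 0, continuous F} by rewrite /F; der_cont.
  by [].
have F1 : F u @[u --> +oo] --> 0.
  have p1 : 0 < 2 :> R by [].
  apply: (@cvgy_powR_bound _ _ _ (s^-1 * (4 / s ^+ 2)) _ p1) => u u1.
  have u0 : 0 < u by exact: lt_le_trans u1.
  rewrite subr0 /F normrM normrN (gtr0_norm (expR_gt0 _)) gtr0_norm ?invr_gt0//.
  by rewrite -mulrA ler_wpM2l ?invr_ge0 ?(ltW s0)// expRN_le2.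
have := ge0_ftc_itv0y dF cf F0 F1; rewrite sub0r opprK; apply.
by move=> u _; exact: expR_ge0.
Qed.

Section stable_constant.
Variable al : R.
Hypothesis al01 : 0 < al < 1.

Let al0 : 0 < al. Proof. by case/andP: al01. Qed.
Let al1 : al < 1. Proof. by case/andP: al01. Qed.

Let J0 := \int[mu]_(u in `]0, +oo[) ((1 - expR (- u)) * u `^ (- 1 - al)).

Let h1 (u : R) := expR (- u) * u `^ (- al).
Let h2 (u : R) := (1 - expR (- u)) * u `^ (- 1 - al).

Let ih1 : mu.-integrable `]0, +oo[ (EFin \o h1).
Proof.
have al1' : -1 < - al by rewrite ltrN2.
apply: (@dom0y_integrable _ _ (- al) (- 2) 4 _ al1').
- by rewrite /h1; mfun.
- by rewrite ltrN2 ltr1n.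
- move=> u /andP[u0 u1]; rewrite /h1 normrM [`|_ `^ _|]ger0_norm ?powR_ge0//.
  rewrite ler_wpM2r ?powR_ge0// ger0_norm ?expR_ge0// (@le_trans _ _ 1)//; last by rewrite ler1n.
  by rewrite expR_le1 oppr_le0 ltW.
- move=> u u1; have u0 : 0 < u by exact: lt_le_trans u1.
  rewrite /h1 normrM [`|_ `^ _|]ger0_norm ?powR_ge0// ger0_norm ?expR_ge0//.
  apply: (@le_trans _ _ (expR (- u))).
    rewrite ler_piMr ?expR_ge0// powRN invf_le1 ?powR_gt0//.
    by apply: powR_ge1 => //; exact: ltW.
  have := expRN_le2 ltr01 u0; rewrite mul1r expr1n divr1; exact.
Qed.

Let ih2 : mu.-integrable `]0, +oo[ (EFin \o h2).
Proof.
have al1' : -1 < - al by rewrite ltrN2.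
have al2' : - 1 - al < -1 by rewrite gtrDl oppr_lt0.
apply: (@dom0y_integrable _ _ (- al) (- 1 - al) 2 _ al1' al2').
- by rewrite /h2; mfun.
- move=> u /andP[u0 u1]; rewrite /h2 normrM [`|_ `^ _|]ger0_norm ?powR_ge0//.
  apply: (@le_trans _ _ (u * u `^ (- 1 - al))).
    rewrite ler_wpM2r ?powR_ge0//; have /andP[e0 e1] := onem_expRN (ltW u0).
    by rewrite ger0_norm.
  rewrite -{1}[u]powRr1 ?(ltW u0)// -powRDp// addrA subrr add0r.
  by rewrite ler_peMl ?powR_ge0// ler1n.
- move=> u u1; have u0 : 0 < u by exact: lt_le_trans u1.
  rewrite /h2 normrM [`|_ `^ _|]ger0_norm ?powR_ge0// ler_wpM2r ?powR_ge0//.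
  have /andP[e0 e1] := onem_expRN (ltW u0); rewrite ger0_norm//.
  by rewrite (@le_trans _ _ 1)// ?ler1n// gerDl oppr_le0 expR_ge0.
Qed.

Let J0_ibp : \int[mu]_(u in `]0, +oo[) h1 u = al * J0.
Proof.
pose f (u : R) : R := h1 u - al * h2 u.
pose F (u : R) : R := (1 - expR (- u)) * u `^ (- al).
have dF (u : R) : 0 < u -> is_derive u (1 : R) F (f u).
  move=> u0; rewrite /F; der_eq => //.
  by rewrite /f /h1 /h2 (_ : - al - 1 = - 1 - al); [ring|rewrite addrC].
have cf (u : R) : 0 < u -> {for u, continuous f}.
  by move=> u0; rewrite /f /h1 /h2; der_cont.
have F0 : F u @[u --> 0^'+] --> 0.
  have p0 : 0 < 1 - al by rewrite subr_gt0.
  apply: (@cvg0_powR_bound _ _ _ 1 _ p0) => u /andP[u0 u1].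
  rewrite subr0 mul1r normrM [`|_ `^ _|]ger0_norm ?powR_ge0//.
  rewrite powRDp// powRr1 ?(ltW u0)// ler_wpM2r ?powR_ge0//.
  by have /andP[e0 e1] := onem_expRN (ltW u0); rewrite ger0_norm.
have F1 : F u @[u --> +oo] --> 0.
  apply: (@cvgy_powR_bound _ _ _ 1 _ al0) => u u1.
  have u0 : 0 < u by exact: lt_le_trans u1.
  rewrite subr0 normrM [`|_ `^ _|]ger0_norm ?powR_ge0// ler_wpM2r ?powR_ge0//.
  have /andP[e0 e1] := onem_expRN (ltW u0); rewrite ger0_norm//.
have ifn : mu.-integrable `]0, +oo[ (EFin \o f).
  by apply: integrableB1 => //; exact: integrableZl1.
have := ftc_itv0y dF cf F0 F1 ifn; rewrite subr0 /f RintegralB//; last exact: integrableZl1.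
by rewrite RintegralZl// => /subr0_eq.
Qed.

(** By parts Gamma (1 - al) = al J0, and on (-1, 0) the function is defined by Gamma (- al) = Gamma
    (1 - al) / (- al). *)
Lemma Gamma_opp : - Gamma (- al) = J0.
Proof.
rewrite /Gamma oppr_gt0 ltNge (ltW al0)/=.
have -> : Euler_integral (- al + 1) = \int[mu]_(u in `]0, +oo[) h1 u.
  by rewrite /Euler_integral addrK; apply: eq_Rintegral => u _; rewrite /h1 mulrC.
rewrite J0_ibp; field; by rewrite gt_eqF.
Qed.

(** From ln u <= u follows u^(- al) >= exp (- al u), which bounds Gamma (1 - al) below by the
    integral of exp (- (1 + al) u). *)
Lemma Gamma_opp_gt0 : 0 < - Gamma (- al).
Proof.
rewrite Gamma_opp -(pmulr_rgt0 _ al0) -J0_ibp.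
have s0 : 0 < 1 + al by rewrite addr_gt0.
have [e i] := exp_integral s0.
apply: (@lt_le_trans _ _ (\int[mu]_(u in `]0, +oo[) (expR (- ((1 + al) * u))))).
  by rewrite /Rintegral e invr_gt0.
apply: le_Rintegral => // u /=; rewrite in_itv/= andbT => u0.
rewrite mulrDl mul1r opprD expRD /h1 ler_wpM2l ?expR_ge0//.
rewrite /powR gt_eqF// ler_expR !mulNr lerN2 ler_wpM2l ?(ltW al0)//.
by rewrite ltW// ln_sublinear.
Qed.

Lemma stable_integrals (k : R) : 0 < k ->
  \int[mu]_(u in `]0, +oo[) ((1 - cos (k * u)) * u `^ (- 1 - al)) =
    k `^ al * - Gamma (- al) * cos (pi * al / 2) /\
  \int[mu]_(u in `]0, +oo[) (sin (k * u) * u `^ (- 1 - al)) =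
    k `^ al * - Gamma (- al) * sin (pi * al / 2).
Proof.
(* This pitch makes the spiral end exactly at i k. *)
move=> k0; have := rotation_integrals (ln k / (pi / 2)) al01.
by rewrite divfK ?gt_eqF ?divr_gt0 ?pi_gt0// lnK ?posrE// Gamma_opp.
Qed.

Lemma cos_stable_gt0 : 0 < cos (pi * al / 2).
Proof.
have p0 : 0 < pi :> R := pi_gt0 R.
apply: cos_gt0_pihalf; apply/andP; split.
  by rewrite (@lt_trans _ _ 0)// ?oppr_lt0 divr_gt0// mulr_gt0.
by rewrite ltr_pM2r// gtr_pMr.
Qed.

End stable_constant.

Section cauchy_constant.
Variable c : R.
Hypothesis c0 : 0 < c.

Let p2 (u : R) : 0 < u -> u `^ (- 1 - 1) = u ^- 2.
Proof. by move=> u0; rewrite -powR_invn ?ltW//; congr (_ `^ _); rewrite opprD. Qed.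

Let ints (u : R) : 0 < u ->
  (\int[mu]_(s in `]0%R, +oo[) (s * expR (- (u * s)))%:E = (u ^- 2)%:E)%E.
Proof.
move=> u0; pose F (s : R) := - (s * u^-1 + u ^- 2) * expR (- (u * s)).
have dF (s : R) : 0 < s -> is_derive s (1 : R) F (s * expR (- (u * s))).
  by move=> s0; rewrite /F; der_eq; field; rewrite gt_eqF.
have cf (s : R) : 0 < s -> {for s, continuous (fun s : R => s * expR (- (u * s)))}.
  by move=> s0; der_cont.
have F0 : F s @[s --> 0^'+] --> - u ^- 2.
  apply: cvg_at_right_filter.
  rewrite [X in _ --> X](_ : _ = F 0); last by rewrite /F mulr0 oppr0 expR0 mulr1 mul0r add0r.
  have : {for 0, continuous F} by rewrite /F; der_cont.
  by [].
have F1 : F s @[s --> +oo] --> 0.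
  apply: (@cvgy_powR_bound _ _ _ ((u^-1 + u ^- 2) * (4 / u ^+ 2)) 1 ltr01) => s s1.
  have s0 : 0 < s by exact: lt_le_trans s1.
  have v0 : 0 < s / u + u ^- 2 by rewrite addr_gt0 ?divr_gt0 ?invr_gt0 ?exprn_gt0.
  rewrite subr0 /F normrM normrN (gtr0_norm (expR_gt0 _)) gtr0_norm//.
  apply: (@le_trans _ _ (((u^-1 + u ^- 2) * s) * (4 / u ^+ 2 * s `^ (- 2)))).
    apply: ler_pM; [exact: ltW|exact: expR_ge0| |exact: expRN_le2].
    by rewrite mulrDl [s / u]mulrC lerD2l ler_peMr// invr_ge0 exprn_ge0 ?ltW.
  have sp : s * s `^ (- 2) = s `^ (- 1).
    by rewrite -{1}[s]powRr1 ?(ltW s0)// -powRDp//; congr (_ `^ _); ring.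
  rewrite -sp; set a := _ + _; set b := _ / _; set q := _ `^ _.
  by rewrite (_ : a * s * (b * q) = a * b * (s * q))//; ring.
have := ge0_ftc_itv0y dF cf F0 F1; rewrite sub0r opprK => -[]// s s0.
by rewrite mulr_ge0 ?expR_ge0 ?(ltW s0).
Qed.

Let intu (s : R) : 0 < s ->
  (\int[mu]_(u in `]0%R, +oo[) ((1 - cos (c * u)) * expR (- (u * s)))%:E =
   (s^-1 - s / (s ^+ 2 + c ^+ 2))%:E)%E.
Proof.
move=> s0; have q0 : 0 < s ^+ 2 + c ^+ 2 by rewrite addr_gt0 ?exprn_gt0.
pose F (u : R) := (- s^-1 + (s * cos (c * u) - c * sin (c * u)) / (s ^+ 2 + c ^+ 2))
  * expR (- (u * s)).
have dF (u : R) : 0 < u -> is_derive u (1 : R) F ((1 - cos (c * u)) * expR (- (u * s))).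
  by move=> u0; rewrite /F; der_eq; field; rewrite !gt_eqF.
have cf (u : R) : 0 < u -> {for u, continuous (fun u : R => (1 - cos (c * u)) * expR (- (u * s)))}.
  by move=> u0; der_cont.
have F0 : F u @[u --> 0^'+] --> - s^-1 + s / (s ^+ 2 + c ^+ 2).
  apply: cvg_at_right_filter.
  rewrite [X in _ --> X](_ : _ = F 0); last first.
    by rewrite /F mulr0 mul0r oppr0 expR0 mulr1 cos0 sin0 mulr0 subr0 mulr1.
  have : {for 0, continuous F} by rewrite /F; der_cont.
  by [].
have F1 : F u @[u --> +oo] --> 0.
  have p1 : 0 < 2 :> R by [].
  apply: (@cvgy_powR_bound _ _ _ ((s^-1 + (s + c) / (s ^+ 2 + c ^+ 2)) * (4 / s ^+ 2)) _ p1) => u u1.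
  have u0 : 0 < u by exact: lt_le_trans u1.
  rewrite subr0 /F normrM (gtr0_norm (expR_gt0 _)) -[_ * _ * u `^ _]mulrA.
  apply: ler_pM; [exact: normr_ge0|exact: expR_ge0| |by rewrite mulrC; exact: expRN_le2].
  apply: (le_trans (ler_normD _ _)); rewrite normrN gtr0_norm ?invr_gt0// lerD2l.
  rewrite normrM [`|_^-1|]gtr0_norm ?invr_gt0// ler_wpM2r ?invr_ge0 ?(ltW q0)//.
  apply: (le_trans (ler_normB _ _)); rewrite !normrM (gtr0_norm s0) (gtr0_norm c0).
  by apply: lerD; rewrite ler_piMr ?cos_max ?sin_max ?(ltW s0) ?(ltW c0).
have := ge0_ftc_itv0y dF cf F0 F1; rewrite sub0r opprD opprK => -[]//.
Qed.

Let intsu : (\int[mu]_(s in `]0%R, +oo[) (c ^+ 2 / (s ^+ 2 + c ^+ 2))%:E = (c * (pi / 2))%:E)%E.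
Proof.
pose F (s : R) := c * atan (c^-1 * s).
have dF (s : R) : 0 < s -> is_derive s (1 : R) F (c ^+ 2 / (s ^+ 2 + c ^+ 2)).
  move=> s0; rewrite /F.
  have q0 : 0 < s ^+ 2 + c ^+ 2 by rewrite addr_gt0 ?exprn_gt0.
  der_eq; rewrite exprMn exprVn; field; rewrite !gt_eqF// ?addr_gt0 ?exprn_gt0//.
have cf (s : R) : 0 < s -> {for s, continuous (fun s : R => c ^+ 2 / (s ^+ 2 + c ^+ 2))}.
  move=> s0; der_cont.
  by rewrite gt_eqF// addr_gt0 ?exprn_gt0.
have F0 : F u @[u --> 0^'+] --> 0.
  apply: cvg_at_right_filter.
  rewrite [X in _ --> X](_ : _ = F 0); last by rewrite /F mulr0 atan0 mulr0.
  apply: (@is_derive1_cont _ F _ (c * (1 + (c^-1 * 0) ^+ 2)^-1 * c^-1)).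
  by rewrite /F; der_eq; ring.
have F1 : F u @[u --> +oo] --> c * (pi / 2).
  apply: cvgM; first exact: cvg_cst.
  apply: (cvg_comp _ _ _ (@cvgy_atan R)).
  apply/cvgryPge => A; near=> x.
  rewrite mulrC ler_pdivlMr//; near: x; exact: nbhs_pinfty_ge.
have := ge0_ftc_itv0y dF cf F0 F1; rewrite subr0 => -[]// s s0.
by rewrite divr_ge0 ?addr_ge0 ?exprn_ge0 ?(ltW c0) ?(ltW s0).
Unshelve. all: by end_near. Qed.

(** The rotation argument stops at al = 1, where exp (- z u) / u is not integrable at 0. Instead
    u^(-2) is the integral over s of s exp (- u s); Tonelli reduces the claim to the integral of c^2
    / (s^2 + c^2), an arctangent. *)
Lemma cauchy_integral :
  \int[mu]_(u in `]0, +oo[) ((1 - cos (c * u)) * u `^ (- 1 - 1)) = c * (pi / 2).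
Proof.
suff : (\int[mu]_(u in `]0%R, +oo[) ((1 - cos (c * u)) * u `^ (- 1 - 1))%:E = (c * (pi / 2))%:E)%E.
  by rewrite /Rintegral => ->.
pose f (u s : R) := (1 - cos (c * u)) * (s * expR (- (u * s))).
have m1 : measurable_fun setT (fun z : R * R => z.1) by exact: measurable_fst.
have m2 : measurable_fun setT (fun z : R * R => z.2) by exact: measurable_snd.
have mf : measurable_fun setT (fun z : R * R => f z.1 z.2).
  by rewrite /f; mfun.
have mB : measurable (`]0, +oo[%classic : set (measurableTypeR R)) by [].
have f0 u s : `]0, +oo[%classic u -> `]0, +oo[%classic s -> 0 <= f u s.
  rewrite /= !in_itv/= !andbT => u0 s0.
  by rewrite mulr_ge0 ?onem_cos_ge0// mulr_ge0 ?expR_ge0// ltW.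
have := @tonelli_in _ _ _ _ _ mu mu _ _ f mB mB mf f0.
have -> : (\int[mu]_(x in `]0%R, +oo[) \int[mu]_(y in `]0%R, +oo[) (f x y)%:E =
  \int[mu]_(u in `]0%R, +oo[) ((1 - cos (c * u)) * u `^ (- 1 - 1))%:E)%E.
  apply: eq_integral => u; rewrite inE/= in_itv/= andbT => u0.
  rewrite p2// EFinM -ints// -ge0_integralZl1 ?onem_cos_ge0//.
    by apply: measurable_funTS; mfun.
  by move=> s; rewrite /= in_itv/= andbT => s0; rewrite mulr_ge0 ?expR_ge0// ltW.
move=> ->; rewrite -intsu; apply: eq_integral => s; rewrite inE/= in_itv/= andbT => s0.
transitivity (\int[mu]_(u in `]0%R, +oo[) (s * ((1 - cos (c * u)) * expR (- (u * s))))%:E)%E.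
  by apply: eq_integral => u _; rewrite /f; congr EFin; ring.
rewrite ge0_integralZl1 ?(ltW s0)//.
- by rewrite intu// -EFinM; congr EFin; field; rewrite !gt_eqF// addr_gt0 ?exprn_gt0.
- by apply: measurable_funTS; mfun.
Qed.

End cauchy_constant.

Lemma cauchy_integrable (c : R) :
  mu.-integrable `]0, +oo[ (EFin \o (fun u => (1 - cos (c * u)) * u `^ (- 1 - 1))).
Proof.
have q1 : - 1 - 1 < -1 :> R by rewrite gtrDl oppr_lt0.
apply: (@dom0y_integrable _ _ 0 (- 1 - 1) (c ^+ 2 + 2) _ _ q1).
- by mfun.
- by rewrite ltrN10.
- move=> u /andP[u0 u1]; rewrite powRr0 mulr1 normrM [`|_ `^ _|]ger0_norm ?powR_ge0//.
  rewrite ger0_norm ?onem_cos_ge0//.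
  apply: (@le_trans _ _ ((c * u) ^+ 2 * u `^ (- 1 - 1))).
    by rewrite ler_wpM2r ?powR_ge0 ?onem_cos_le2.
  rewrite (_ : -1 - 1 = - 2%:R :> R); last by ring.
  rewrite powR_invn ?(ltW u0)// exprMn mulfK ?expf_neq0 ?gt_eqF//.
  by rewrite lerDl.
- move=> u u1; rewrite normrM [`|_ `^ _|]ger0_norm ?powR_ge0// ler_wpM2r ?powR_ge0//.
  rewrite ger0_norm ?onem_cos_ge0//; have := cos_geN1 (c * u); have := sqr_ge0 c; lra.
Qed.

Lemma cauchy_integral_norm (c : R) :
  \int[mu]_(u in `]0, +oo[) ((1 - cos (c * u)) * u `^ (- 1 - 1)) = `|c| * (pi / 2).
Proof.
have [c0|c0|->] := ltgtP c 0.
- rewrite ltr0_norm// -cauchy_integral ?oppr_gt0//.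
  by apply: eq_Rintegral => u _; rewrite mulNr cosN.
- by rewrite gtr0_norm// cauchy_integral.
- under eq_Rintegral do rewrite mul0r cos0 subrr mul0r.
  by rewrite Rintegral_cst// normr0 !mul0r.
Qed.

End levy_integrals.

(** * Trigonometric polynomials and the Fejer kernel *)

Section finite_sums.
Context d (T : measurableType d) (R : realType) (m : {measure set T -> \bar R}).

Lemma integrable_seq_sum (I : eqType) (D : set T) (s : seq I) (F : I -> T -> R) :
  measurable D -> {in s, forall i, m.-integrable D (EFin \o F i)} ->
  m.-integrable D (EFin \o (fun x => \sum_(i <- s) F i x)).
Proof.
move=> mD; elim: s => [|i s IH] H.
  under eq_fun do rewrite big_nil.
  exact: integrable0.
under eq_fun do rewrite big_cons.
apply: integrableD1 => //; first by apply: H; rewrite inE eqxx.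
by apply: IH => j js; apply: H; rewrite inE js orbT.
Qed.

Lemma Rintegral_seq_sum (I : eqType) (D : set T) (s : seq I) (F : I -> T -> R) :
  measurable D -> {in s, forall i, m.-integrable D (EFin \o F i)} ->
  \int[m]_(x in D) (\sum_(i <- s) F i x) = \sum_(i <- s) \int[m]_(x in D) F i x.
Proof.
move=> mD; elim: s => [|i s IH] H.
  under eq_Rintegral do rewrite big_nil.
  by rewrite Rintegral_cst// mul0r big_nil.
under eq_Rintegral do rewrite big_cons.
have H' : {in s, forall i, m.-integrable D (EFin \o F i)}.
  by move=> j js; apply: H; rewrite inE js orbT.
rewrite RintegralD//.
- by rewrite IH// big_cons.
- by apply: H; rewrite inE eqxx.
- exact: integrable_seq_sum.
Qed.

End finite_sums.

Section trigonometric_polynomials.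
Context {R : realType}.
Notation mu := (@lebesgue_measure R).

(* The term (c, (l, th)) stands for x |-> c * cos (l * x + th). *)
Definition tpoly := seq (R * (R * R)).
Implicit Types (p q : tpoly) (x y s l M : R).

Definition tpe p x := \sum_(t <- p) t.1 * cos (t.2.1 * x + t.2.2).

(** Frequencies are raised to the real power al later on; since cos is even, every wave can be
    written with a nonnegative one. *)
Definition tpos p := {in p, forall t, 0 <= t.2.1}.

Lemma tpos_cons t p : tpos (t :: p) -> 0 <= t.2.1 /\ tpos p.
Proof.
move=> H; split; first by apply: H; rewrite inE eqxx.
by move=> u up; apply: H; rewrite inE up orbT.
Qed.

Lemma tpe_measurable p : measurable_fun setT (tpe p).
Proof.
rewrite /tpe; elim: p => [|t p IH].
  by under eq_fun do rewrite big_nil; mfun.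
by under eq_fun do rewrite big_cons; mfun.
Qed.

Lemma tpe_bounded p : exists2 M, 0 <= M & forall x, `|tpe p x| <= M.
Proof.
exists (\sum_(t <- p) `|t.1|); first exact: sumr_ge0.
move=> x; apply: (le_trans (ler_norm_sum _ _ _)); apply: ler_sum => t _.
by rewrite normrM ler_piMr// cos_max.
Qed.

Lemma tpe_cat p q x : tpe (p ++ q) x = tpe p x + tpe q x.
Proof. by rewrite /tpe big_cat. Qed.

(** This is max (|s| - |l|, 0), because (|s + l| + |s - l|) / 2 = max (|s|, |l|). The form with
    absolute values is the one that integrals of 1 - cos produce. *)
Definition hat s l := (`|s + l| + `|s - l|) / 2 - `|l|.

Lemma hat_le s l : 0 <= l -> l <= s -> hat s l = s - l.
Proof.
move=> l0 ls; rewrite /hat !ger0_norm ?subr_ge0// ?addr_ge0//; last exact: le_trans ls.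
by field.
Qed.

Lemma hat_ge s l : 0 <= s -> s <= l -> hat s l = 0.
Proof.
move=> s0 sl; have l0 : 0 <= l by exact: le_trans sl.
rewrite /hat distrC !ger0_norm ?subr_ge0// ?addr_ge0//.
by field.
Qed.

Let mI : measurable (`]0, +oo[%classic : set (measurableTypeR R)).
Proof. by []. Qed.

Let phi c (y : R) := (1 - cos (c * y)) * y `^ (- 1 - 1).

Let iphi c : mu.-integrable `]0, +oo[ (EFin \o phi c).
Proof. exact: cauchy_integrable. Qed.

Let phi_ge0 c y : 0 <= phi c y.
Proof. by rewrite mulr_ge0 ?powR_ge0 ?onem_cos_ge0. Qed.

Let phiE c : \int[mu]_(u in `]0, +oo[) phi c u = `|c| * (pi / 2).
Proof. exact: cauchy_integral_norm. Qed.

Let mphi c : measurable_fun setT (phi c).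
Proof. by rewrite /phi; mfun. Qed.

Let phi_cosE s l y : phi s y * cos (l * y) =
  2^-1 * phi (s + l) y + 2^-1 * phi (s - l) y - phi l y.
Proof.
rewrite /phi.
have -> : (s + l) * y = s * y + l * y by ring.
have -> : (s - l) * y = s * y - l * y by ring.
by rewrite cosD cosB; field.
Qed.

Let iphi_cos s l : mu.-integrable `]0, +oo[ (EFin \o (fun y => phi s y * cos (l * y))).
Proof.
rewrite (_ : (fun y => _) = (fun y => 2^-1 * phi (s + l) y + 2^-1 * phi (s - l) y - phi l y)); last first.
  by apply/funext => y; exact: phi_cosE.
by apply: integrableB1 => //; apply: integrableD1 => //; exact: integrableZl1.
Qed.

(** The product-to-sum formula writes the integrand through [phi] at s + l, s - l and l, and each
    [phi c] integrates to |c| pi / 2. *)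
Lemma fejer_integral s l :
  \int[mu]_(y in `]0, +oo[) (phi s y * cos (l * y)) = hat s l * (pi / 2).
Proof.
under eq_Rintegral do rewrite phi_cosE.
have i1 := integrableZl1 2^-1 mI (iphi (s + l)).
have i2 := integrableZl1 2^-1 mI (iphi (s - l)).
rewrite RintegralB//; last exact: integrableD1.
by rewrite (RintegralD mI i1 i2) !(RintegralZl _ mI (iphi _)) !phiE /hat; field.
Qed.

Let pi20 : 0 < pi / 2 :> R.
Proof. by rewrite divr_gt0 ?pi_gt0. Qed.

Let phi_bound c M (W : R -> R) : measurable_fun setT W -> (forall y, `|W y| <= M * phi c y) ->
  `|\int[mu]_(y in `]0, +oo[) W y| <= M * `|c| * (pi / 2).
Proof.
move=> mW WM; rewrite -mulrA -phiE -RintegralZl//.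
by apply: Rintegral_le_norm => //; [exact: measurable_funTS|exact: integrableZl1].
Qed.

(* The Fejer kernel (1 - cos (s y)) / y^2 is positive. *)
Lemma fejer_bound p s M x : 0 <= s -> (forall x, `|tpe p x| <= M) ->
  `|\sum_(t <- p) t.1 * hat s t.2.1 * cos (t.2.1 * x + t.2.2)| <= s * M.
Proof.
move=> s0 pM.
pose W y := phi s y * ((tpe p (x + y) + tpe p (x - y)) / 2).
pose F (t : R * (R * R)) y := t.1 * cos (t.2.1 * x + t.2.2) * (phi s y * cos (t.2.1 * y)).
have WE y : W y = \sum_(t <- p) F t y.
  rewrite /W /tpe -big_split/= mulr_suml mulr_sumr; apply: eq_bigr => t _.
  rewrite /F !mulrDr mulrN -!addrA [_ + t.2.2]addrC [- _ + t.2.2]addrC !addrA.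
  by rewrite cosD cosB; field.
have iF t : mu.-integrable `]0, +oo[ (EFin \o F t) by exact: integrableZl1.
have IW : \int[mu]_(y in `]0, +oo[) W y =
    (\sum_(t <- p) t.1 * hat s t.2.1 * cos (t.2.1 * x + t.2.2)) * (pi / 2).
  under eq_Rintegral do rewrite WE.
  rewrite Rintegral_seq_sum// mulr_suml; apply: eq_bigr => t _.
  by rewrite RintegralZl// fejer_integral; ring.
have mW : measurable_fun setT W.
  have -> : W = (fun y => \sum_(t <- p) F t y) by exact/funext.
  by apply: measurable_sum => t; rewrite /F /phi; mfun.
have := @phi_bound s M W mW; rewrite IW normrM (gtr0_norm pi20) ler_pM2r// [s * M]mulrC.
rewrite (ger0_norm s0); apply => y; rewrite /W normrM ger0_norm// mulrC ler_wpM2r//.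
rewrite normrM [`|2^-1|]gtr0_norm ?invr_gt0// ler_pdivrMr//.
by apply: (le_trans (ler_normD _ _)); rewrite mulr_natr mulr2n lerD.
Qed.

(** Half the difference of the hats of height 2 s at s - l and s + l; both points lie in the linear
    range [0, 2 s], and the difference there is 2 l. *)
Let sin_integral s l : 0 <= l -> l <= s ->
  \int[mu]_(y in `]0, +oo[) (phi (2 * s) y * (sin (s * y) * sin (l * y))) = l * (pi / 2).
Proof.
move=> l0 ls; have s0 : 0 <= s by exact: le_trans ls.
transitivity (\int[mu]_(y in `]0, +oo[)
  (2^-1 * (phi (2 * s) y * cos ((s - l) * y)) - 2^-1 * (phi (2 * s) y * cos ((s + l) * y)))).
  apply: eq_Rintegral => y _.
  have -> : (s + l) * y = s * y + l * y by ring.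
  have -> : (s - l) * y = s * y - l * y by ring.
  by rewrite cosB cosD; field.
rewrite RintegralB//; [|exact: integrableZl1|exact: integrableZl1].
rewrite !RintegralZl// !fejer_integral hat_le ?subr_ge0//; last by lra.
rewrite hat_le ?addr_ge0//; last by lra.
by field.
Qed.

(* On [0, s], l is a difference of two translated hats of height 2 s, so the
   derivative is convolution with the integrable kernel sin (s y) (1 - cos (2 s y)) / y^2. *)
Lemma bernstein p s M : 0 <= s -> tpos p -> (forall x, `|tpe p x| <= M) ->
  {in p, forall t, t.1 = 0 \/ t.2.1 <= s} ->
  `|\sum_(t <- p) t.1 * t.2.1 * sin t.2.2| <= 2 * s * M.
Proof.
move=> s0 p0 pM ps.
(* The odd part of p consists of the waves - c sin th sin (l y), exactly those that contribute to
   the derivative at 0. *)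
pose W y := phi (2 * s) y * (sin (s * y) * ((tpe p y - tpe p (- y)) / 2)).
pose F (t : R * (R * R)) y :=
  - (t.1 * sin t.2.2) * (phi (2 * s) y * (sin (s * y) * sin (t.2.1 * y))).
have WE y : W y = \sum_(t <- p) F t y.
  rewrite /W /tpe -sumrB mulr_suml !mulr_sumr; apply: eq_bigr => t _.
  by rewrite /F mulrN !cosD cosN sinN; field.
have iF t : mu.-integrable `]0, +oo[ (EFin \o F t).
  apply: integrableZl1 => //; apply: (le_integrable1 _ _ (iphi (2 * s))) => //.
    by apply: measurable_funTS; rewrite /phi; mfun.
  move=> y _; rewrite normrM ger0_norm// ler_piMr// normrM mulr_ile1// ?sin_max//.
have IW : \int[mu]_(y in `]0, +oo[) W y =
    - (\sum_(t <- p) t.1 * t.2.1 * sin t.2.2) * (pi / 2).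
  under eq_Rintegral do rewrite WE.
  rewrite Rintegral_seq_sum// -sumrN mulr_suml !big_seq; apply: eq_bigr => t tp.
  have [t0|ts] := ps _ tp.
    rewrite /F t0; under eq_Rintegral do rewrite mul0r oppr0 mul0r.
    by rewrite Rintegral_cst// !mul0r oppr0 mul0r.
  rewrite RintegralZl//.
    by rewrite sin_integral ?p0//; ring.
  apply: (le_integrable1 _ _ (iphi (2 * s))) => //.
    by apply: measurable_funTS; rewrite /phi; mfun.
  move=> y _; rewrite normrM ger0_norm// ler_piMr// normrM mulr_ile1// ?sin_max//.
have mW : measurable_fun setT W.
  have -> : W = (fun y => \sum_(t <- p) F t y) by exact/funext.
  by apply: measurable_sum => t; rewrite /F /phi; mfun.
have M0 : 0 <= M by apply: le_trans (pM 0).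
have := @phi_bound (2 * s) M W mW; rewrite IW normrM normrN (gtr0_norm pi20) ler_pM2r//.
rewrite [2 * s * M]mulrC (ger0_norm (_ : 0 <= 2 * s)) ?mulr_ge0//; apply => y.
rewrite /W normrM ger0_norm// mulrC ler_wpM2r//.
rewrite normrM -[leRHS]mul1r ler_pM ?sin_max//.
rewrite normrM [`|2^-1|]gtr0_norm ?invr_gt0// ler_pdivrMr//.
by apply: (le_trans (ler_normB _ _)); rewrite mulr_natr mulr2n lerD.
Qed.

(** Convolution with the Fejer kernel. Waves of frequency above s keep a zero coefficient instead of
    being dropped, whence the alternative [t.1 = 0] in [bernstein]. *)
Definition that s p : tpoly := [seq (t.1 * hat s t.2.1, t.2) | t <- p].

Let that_ge p s M : 0 <= s -> (forall x, `|tpe p x| <= M) ->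
  forall x, `|tpe (that s p) x| <= s * M.
Proof.
by move=> s0 pM x; rewrite /tpe big_map; exact: fejer_bound.
Qed.

Let that_pos p s : tpos p -> tpos (that s p).
Proof. by move=> p0 t /mapP[u up ->]/=; exact: p0. Qed.

(** Up to sign this is the derivative at 0 of [that s p], whose frequencies are at most s and whose
    sup norm is at most s M. *)
Lemma hat_sin_bound p s M : 0 <= s -> tpos p -> (forall x, `|tpe p x| <= M) ->
  `|\sum_(t <- p) t.1 * t.2.1 * sin t.2.2 * hat s t.2.1| <= 2 * s ^+ 2 * M.
Proof.
move=> s0 p0 pM.
have := bernstein s0 (that_pos p0) (that_ge s0 pM).
rewrite big_map/= => H.
rewrite [leRHS](_ : _ = 2 * s * (s * M)); last by ring.
rewrite (eq_bigr (fun t => t.1 * hat s t.2.1 * t.2.1 * sin t.2.2)); last by move=> t _; ring.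
apply: H => t /mapP[u up ->]/=.
by have [us|/ltW us] := leP u.2.1 s; [right|left; rewrite hat_ge ?mulr0].
Qed.

(** The cosine sum is a conjugate derivative, to which [bernstein] does not apply. But l hat = s hat
    - hat^2 for every l >= 0, so applying the Fejer bound once and twice suffices. *)
Lemma hat_cos_bound p s M : 0 <= s -> tpos p -> (forall x, `|tpe p x| <= M) ->
  `|\sum_(t <- p) t.1 * t.2.1 * cos t.2.2 * hat s t.2.1| <= 2 * s ^+ 2 * M.
Proof.
move=> s0 p0 pM.
have H1 := fejer_bound 0 s0 pM; have H2 := fejer_bound 0 s0 (that_ge s0 pM).
rewrite big_map/= in H2.
rewrite [X in `|X|](_ : _ = s * \sum_(t <- p) t.1 * hat s t.2.1 * cos (t.2.1 * 0 + t.2.2)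
  - \sum_(t <- p) t.1 * hat s t.2.1 * hat s t.2.1 * cos (t.2.1 * 0 + t.2.2)).
  apply: (le_trans (ler_normB _ _)); rewrite normrM (ger0_norm s0).
  apply: (@le_trans _ _ (s * (s * M) + s * (s * M))); last by rewrite expr2; lra.
  by rewrite lerD// ler_wpM2l.
rewrite mulr_sumr -sumrB !big_seq; apply: eq_bigr => t tp.
have t0 := p0 _ tp; rewrite mulr0 add0r.
by have [ts|/ltW ts] := leP t.2.1 s; [rewrite hat_le//; ring|rewrite hat_ge//; ring].
Qed.

End trigonometric_polynomials.

(** * Profiles as superpositions of hats *)

Section hat_representation.
Context {R : realType}.
Notation mu := (@lebesgue_measure R).
Variables (w w1 w2 : R -> R) (K K' : R).
Hypothesis dw : forall s : R, 0 < s -> is_derive s (1 : R) w (w1 s).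
Hypothesis dw1 : forall s : R, 0 < s -> is_derive s (1 : R) w1 (w2 s).
Hypothesis cw2 : forall s : R, 0 < s -> {for s, continuous w2}.
Hypothesis w2K : forall s : R, 0 < s -> s ^+ 2 * `|w2 s| <= K / (1 + s ^+ 2).
Hypothesis wK' : forall s : R, 1 <= s -> `|w s| + s * `|w1 s| <= K' / s.

Let chat l : continuous (fun s : R => hat s l).
Proof.
move=> s; rewrite /hat; apply: cvgB; last exact: cvg_cst.
apply: cvgM; last exact: cvg_cst.
apply: cvgD; apply: cvg_norm; [apply: cvgD|apply: cvgB];
  by [exact: cvg_id|exact: cvg_cst].
Qed.

Let cw2hat e l (x : R) : 0 < e -> e <= x -> {for x, continuous (fun s => w2 s * hat s l)}.
Proof.
by move=> e0 ex; apply: cvgM; [apply: cw2; exact: lt_le_trans ex|exact: chat].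
Qed.

Let iw2hat e N l : 0 < e -> mu.-integrable `[e, N] (EFin \o (fun s => w2 s * hat s l)).
Proof.
move=> e0; apply: continuous_compact_integrable; first exact: segment_compact.
apply: continuous_in_subspaceT => x; rewrite inE/= in_itv/= => /andP[ex _].
exact: cw2hat ex.
Qed.

(** Taylor's formula at N with integral remainder: hat s l vanishes for s <= l and equals s - l
    beyond, and (s - l) w' - w is a primitive of w'' (s - l). The lower cutoff [e] costs nothing,
    since the hat is zero below l. *)
Let rep e N l : 0 < e -> e <= l -> l < N ->
  w l = \int[mu]_(s in `[e, N]) (w2 s * hat s l) + (w N - (N - l) * w1 N).
Proof.
move=> e0 el lN; have l0 : 0 < l by exact: lt_le_trans el.
have eN : e <= N by rewrite (le_trans el)// ltW.
have := @Rintegral_itvB R (fun s => w2 s * hat s l) (BLeft e) (BRight N) l (iw2hat _ _ e0).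
rewrite !bnd_simp => /(_ el (ltW lN)).
have -> : \int[mu]_(s in `[e, l]) (w2 s * hat s l) = 0.
  transitivity (\int[mu]_(s in `[e, l]) (fun=> 0 : R) s).
    apply: eq_Rintegral => s; rewrite inE/= in_itv/= => /andP[es sl].
    by rewrite hat_ge ?mulr0// (le_trans (ltW e0)).
  by rewrite Rintegral_cst// mul0r.
rewrite subr0 => ->; rewrite Rintegral_itv_obnd_cbnd; last first.
  have := @iw2hat l N l l0; apply: integrableS => //.
  by move=> x /=; rewrite !in_itv/= => /andP[/ltW -> ->].
have dF (x : R) : l <= x <= N ->
    is_derive x (1 : R) (fun s => (s - l) * w1 s - w s) (w2 x * (x - l)).
  move=> /andP[lx _]; have x0 : 0 < x by exact: lt_le_trans lx.
  notypeclasses refine (is_derive_eq1 _ _).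
    by der; first [exact: dw|exact: dw1].
  by cbv beta; ring.
have cF (x : R) : l <= x <= N -> {for x, continuous (fun s : R => w2 s * (s - l))}.
  move=> /andP[lx _]; have x0 : 0 < x by exact: lt_le_trans lx.
  apply: cvgM; first exact: cw2.
  by apply: cvgB; [exact: cvg_id|exact: cvg_cst].
have [e1 _] := ftc_itv lN dF cF.
have -> : \int[mu]_(s in `[l, N]) (w2 s * hat s l) = \int[mu]_(s in `[l, N]) (w2 s * (s - l)).
  apply: eq_Rintegral => s; rewrite inE/= in_itv/= => /andP[es sl].
  by rewrite hat_le// ltW.
by rewrite /Rintegral e1/=; ring.
Qed.

(** The factor s^2 of the hat bound offsets the singularity of w'' at 0: what remains is B K / (1 +
    s^2), with integral at most B K pi / 2. Frequency 0 must have coefficient 0, as the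
    representation holds only for l > 0. *)
Lemma hat_sum_bound (I : eqType) (p : seq I) (c lam : I -> R) (B : R) :
  0 <= B -> {in p, forall t, 0 <= lam t} -> {in p, forall t, lam t = 0 -> c t = 0} ->
  (forall s, 0 <= s -> `|\sum_(t <- p) c t * hat s (lam t)| <= s ^+ 2 * B) ->
  `|\sum_(t <- p) c t * w (lam t)| <= B * K * (pi / 2).
Proof.
move=> B0 l0 cl TB.
(* A finite sum has a smallest positive frequency; starting there keeps the integrals away from the
   singularity at 0. *)
have [e e0 ep] : exists2 e : R, 0 < e & {in p, forall t, 0 < lam t -> e <= lam t}.
  elim: p {l0 cl TB} => [|t p [e e0 ep]]; first by exists 1.
  have [t0|t0] := ltP 0 (lam t).
    exists (Num.min e (lam t)); first by rewrite lt_min e0.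
    move=> u; rewrite inE => /predU1P[->|up] u0; first by rewrite ge_min lexx orbT.
    by rewrite ge_min ep.
  exists e => // u; rewrite inE => /predU1P[->|up] u0; last exact: ep.
  by move: u0; rewrite ltNge t0.
have [N0 N00 Np] : exists2 N : R, 1 <= N & {in p, forall t, lam t < N}.
  elim: p {l0 cl TB ep} => [|t p [N N1 Np]]; first by exists 1.
  exists (N + `|lam t|); first by rewrite (le_trans N1)// lerDl.
  move=> u; rewrite inE => /predU1P[->|/Np up].
    by rewrite (le_lt_trans (ler_norm _))// ltrDr (lt_le_trans ltr01).
  by rewrite (lt_le_trans up)// lerDl.
pose S := \sum_(t <- p) `|c t|.
have S0 : 0 <= S by exact: sumr_ge0.
have K0 : 0 <= K.
  have := w2K ltr01; rewrite expr1n mul1r => h.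
  by have := le_trans (normr_ge0 _) h; rewrite pmulr_lge0// invr_gt0.
suff key N : N0 + e <= N -> `|\sum_(t <- p) c t * w (lam t)| <= B * K * (pi / 2) + S * (K' / N).
  apply/ler_addgt0Pr => d d0.
  (* Chosen so that the boundary terms at N, at most S K' / N in total, are below d. *)
  pose N := N0 + e + `|S * K'| / d.
  have NN : N0 + e <= N by rewrite lerDl divr_ge0 // ltW.
  have N1 : 0 < N by rewrite (lt_le_trans _ NN)// addr_gt0// (lt_le_trans ltr01).
  apply: (le_trans (key _ NN)); rewrite lerD2l mulrA ler_pdivrMr//.
  rewrite (le_trans (ler_norm _))// /N mulrDr mulrCA divff ?gt_eqF// mulr1 lerDr.
  by rewrite mulr_ge0 ?addr_ge0 ?(ltW e0) ?(ltW d0)// (le_trans ler01).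
move=> N0N.
have N1 : 1 <= N by rewrite (le_trans N00)// (le_trans _ N0N)// lerDl ltW.
have N_gt0 : 0 < N by exact: lt_le_trans N1.
have eN : e < N by rewrite (lt_le_trans _ N0N)// ltrDr (lt_le_trans ltr01).
have E : \sum_(t <- p) c t * w (lam t) =
   \int[mu]_(s in `[e, N]) (\sum_(t <- p) c t * (w2 s * hat s (lam t))) +
   \sum_(t <- p) c t * (w N - (N - lam t) * w1 N).
  rewrite Rintegral_seq_sum//; last by move=> t _; apply: integrableZl1 => //; exact: iw2hat.
  rewrite -big_split/= !big_seq; apply: eq_bigr => t tp.
  rewrite RintegralZl//; last exact: iw2hat.
  have [t0|t0] := eqVneq (lam t) 0; first by rewrite (cl _ tp t0) !mul0r addr0.
  have lt0 : 0 < lam t by rewrite lt0r t0 l0.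
  rewrite [in LHS](@rep e N (lam t))//; first by rewrite mulrDr.
    exact: ep.
  by rewrite (lt_le_trans (Np _ tp))// (le_trans _ N0N)// lerDl ltW.
rewrite E; apply: (le_trans (ler_normD _ _)); apply: lerD.
  have dA (x : R) : e <= x <= N -> is_derive x (1 : R) (fun s => B * K * atan s) (B * K * (1 + x ^+ 2)^-1).
    by move=> _; der_eq; ring.
  have cA (x : R) : e <= x <= N -> {for x, continuous (fun x : R => B * K * (1 + x ^+ 2)^-1)}.
    by move=> _; der_cont; rewrite gt_eqF// ltr_pwDl// sqr_ge0.
  have [eA iA] := ftc_itv eN dA cA.
  apply: (@le_trans _ _ (\int[mu]_(s in `[e, N]) (B * K * (1 + s ^+ 2)^-1))).
    apply: Rintegral_le_norm => //.
      apply: measurable_sum => t; apply: measurable_funM1; first by mfun.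
      by have /measurable_int/measurable_EFinP := @iw2hat e N (lam t) e0.
    move=> s /=; rewrite in_itv/= => /andP[es sN].
    have s0 : 0 < s by exact: lt_le_trans es.
    rewrite (eq_bigr (fun t => w2 s * (c t * hat s (lam t)))); last by move=> t _; rewrite mulrCA.
    rewrite -mulr_sumr normrM.
    apply: (@le_trans _ _ (`|w2 s| * (s ^+ 2 * B))).
      by rewrite ler_wpM2l// TB// ltW.
    rewrite mulrA mulrC -mulrA ler_wpM2l// mulrC; exact: w2K.
  rewrite /Rintegral eA/= -mulrBr ler_wpM2l ?mulr_ge0//.
  have := @atan_ltpi2 R N; have : 0 <= atan e by rewrite -atan0 le_atan// ltW.
  by lra.
apply: (le_trans (ler_norm_sum _ _ _)); rewrite /S mulr_suml !big_seq.
apply: ler_sum => t tp; rewrite normrM ler_wpM2l//.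
apply: (le_trans (ler_normB _ _)); apply: (le_trans _ (wK' N1)).
rewrite lerD2l normrM ler_wpM2r// ler_norml; apply/andP; split.
  have := l0 _ tp; have := Np _ tp; have : N0 <= N by rewrite (le_trans _ N0N)// lerDl ltW.
  lra.
by rewrite gerBl l0.
Qed.

End hat_representation.

(** * The smoothing constant of the stable profile *)

Section smoothing.
Context {R : realType}.

Lemma powR_expRN_bounded (r : R) : 0 <= r ->
  exists2 C : R, 0 < C & forall y : R, 0 <= y -> y `^ r * expR (- y) <= C.
Proof.
move=> r0; pose n := Num.truncn r.
exists (1 + n.+1`!%:R); first by rewrite ltr_pwDl.
move=> y y0; rewrite expRN ler_pdivrMr ?expR_gt0//.
have [y1|y1] := leP y 1.
  apply: (@le_trans _ _ 1); first by rewrite powR_le1// y0.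
  by rewrite mulr_ege1 ?lerDl// -expR0 ler_expR.
apply: (@le_trans _ _ (y ^+ n.+1)).
  by rewrite -powR_mulrn// ler_powR ?(ltW y1)// ltW// truncnS_gt.
have := expR_ge1Dxn n y0 => h.
rewrite mulrDl mul1r (@le_trans _ _ (n.+1`!%:R * expR y))//; last by rewrite lerDr expR_ge0.
rewrite mulrC -ler_pdivrMr ?ltr0n ?fact_gt0//; apply: le_trans h.
by rewrite lerDr.
Qed.

Lemma powR_expRN_bounded2 (r1 r2 : R) : 0 <= r1 -> 0 <= r2 ->
  exists2 C : R, 0 < C & forall y : R, 0 <= y ->
    y `^ r1 * expR (- y) <= C /\ y `^ r2 * expR (- y) <= C.
Proof.
move=> /powR_expRN_bounded[C1 C10 h1] /powR_expRN_bounded[C2 C20 h2].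
exists (C1 + C2); first by rewrite addr_gt0.
by move=> y y0; rewrite (le_trans (h1 _ y0)) ?(le_trans (h2 _ y0))// ?lerDl ?lerDr ltW.
Qed.

Variables (al k0 : R).
Hypothesis al01 : 0 < al <= 1.
Hypothesis k00 : 0 <= k0.

Let al0 : 0 < al. Proof. by case/andP: al01. Qed.
Let al1 : al <= 1. Proof. by case/andP: al01. Qed.

Section profile.
Variables (k eta : R).
Hypothesis kk0 : `|k| <= k0.

Let C (s : R) := cos (k * s `^ al + eta).
Let S (s : R) := sin (k * s `^ al + eta).
(** The phase [eta] covers both parts of the profile: 0 gives cos (k s^al), and - pi / 2 gives sin
    (k s^al). *)
Let w (s : R) := expR (- s `^ al) * C s.
Let w1 (s : R) := - (al * s `^ (al - 1)) * (expR (- s `^ al) * (C s + k * S s)).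
Let w2 (s : R) := expR (- s `^ al) *
  (al * (1 - al) * s `^ (al - 1 - 1) * (C s + k * S s)
   + al ^+ 2 * (s `^ (al - 1)) ^+ 2 * (C s + 2 * k * S s - k ^+ 2 * C s)).

Let dw (s : R) : 0 < s -> is_derive s (1 : R) w (w1 s).
Proof. by move=> s0; rewrite /w /w1 /C /S; der_eq => //; ring. Qed.

Let dw1 (s : R) : 0 < s -> is_derive s (1 : R) w1 (w2 s).
Proof. by move=> s0; rewrite /w1 /w2 /C /S; der_eq => //; ring. Qed.

Let cw2 (s : R) : 0 < s -> {for s, continuous w2}.
Proof. by move=> s0; rewrite /w2 /C /S; der_cont. Qed.

Let CkS s : `|C s + k * S s| <= (1 + k0) ^+ 2.
Proof.
have h1 : `|C s| <= 1 by exact: cos_max.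
have h2 : `|k * S s| <= k0 by rewrite normrM (le_trans (ler_piMr _ (sin_max _)))//.
apply: (le_trans (ler_normD _ _)); apply: (@le_trans _ _ (1 + k0)); first exact: lerD.
by rewrite expr2 ler_peMr ?addr_ge0// lerDl.
Qed.

Let CkS2 s : `|C s + 2 * k * S s - k ^+ 2 * C s| <= (1 + k0) ^+ 2.
Proof.
have h1 : `|C s| <= 1 by exact: cos_max.
have h2 : `|2 * k * S s| <= 2 * k0.
  rewrite -mulrA normrM (gtr0_norm (_ : 0 < 2))// ler_wpM2l//.
  by rewrite normrM (le_trans (ler_piMr _ (sin_max _))).
have h3 : `|k ^+ 2 * C s| <= k0 ^+ 2.
  rewrite normrM (le_trans (ler_piMr _ (cos_max _)))// normrX.
  by rewrite ler_sqr ?nnegrE.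
apply: (le_trans (ler_normB _ _)); apply: (@le_trans _ _ (1 + 2 * k0 + k0 ^+ 2)).
  by apply: lerD => //; apply: (le_trans (ler_normD _ _)); apply: lerD.
by rewrite (_ : 1 + 2 * k0 + k0 ^+ 2 = (1 + k0) ^+ 2)//; ring.
Qed.

(** In the variable y = s^al the expression s^2 w'' loses all explicit powers of s; the
    trigonometric brackets are bounded by 1 + k0 and 1 + 2 k0 + k0^2, hence by (1 + k0)^2. *)
Let w2_bound s : 0 < s -> s ^+ 2 * `|w2 s| <=
  (1 + k0) ^+ 2 * (expR (- s `^ al) * (s `^ al + (s `^ al) ^+ 2)).
Proof.
move=> s0; rewrite /w2; set E := expR _; have E0 : 0 <= E by exact: expR_ge0.
have e1 : s ^+ 2 * s `^ (al - 1 - 1) = s `^ al.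
  by rewrite -powR_mulrn ?(ltW s0)// -powRDp//; congr (_ `^ _); ring.
have e2 : s ^+ 2 * (s `^ (al - 1)) ^+ 2 = (s `^ al) ^+ 2.
  rewrite -exprMn; congr (_ ^+ 2).
  by rewrite -{1}[s]powRr1 ?(ltW s0)// -powRDp//; congr (_ `^ _); ring.
rewrite normrM (ger0_norm E0) mulrCA [leRHS]mulrCA ler_wpM2l//.
have s2 : 0 <= s ^+ 2 by rewrite sqr_ge0.
rewrite -(ger0_norm s2) -normrM mulrDr.
have -> : s ^+ 2 * (al * (1 - al) * s `^ (al - 1 - 1) * (C s + k * S s)) =
  s `^ al * (al * (1 - al)) * (C s + k * S s) by rewrite -e1; ring.
have -> : s ^+ 2 * (al ^+ 2 * (s `^ (al - 1)) ^+ 2 * (C s + 2 * k * S s - k ^+ 2 * C s)) =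
  (s `^ al) ^+ 2 * al ^+ 2 * (C s + 2 * k * S s - k ^+ 2 * C s) by rewrite -e2; ring.
set y := s `^ al; have y0 : 0 <= y by exact: powR_ge0.
apply: (le_trans (ler_normD _ _)); rewrite [leRHS]mulrDr.
have a1 : 0 <= al * (1 - al) <= 1.
  by apply/andP; split; [rewrite mulr_ge0 ?subr_ge0 ?(ltW al0)|have := al0; have := al1; nra].
have a2 : 0 <= al ^+ 2 <= 1 by rewrite sqr_ge0 expr_le1// ltW.
case/andP: a1 => a10 a11; case/andP: a2 => a20 a21.
apply: lerD; rewrite normrM [leRHS]mulrC.
  by apply: ler_pM => //; rewrite (ger0_norm (mulr_ge0 y0 a10)) ler_piMr.
by apply: ler_pM => //; rewrite (ger0_norm (mulr_ge0 (sqr_ge0 y) a20)) ler_piMr ?sqr_ge0.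
Qed.

Let w_bound s : 1 <= s -> `|w s| + s * `|w1 s| <=
  (1 + k0) ^+ 2 * (expR (- s `^ al) * (1 + s `^ al)).
Proof.
move=> s1; have s0 : 0 < s by exact: lt_le_trans s1.
rewrite /w /w1; set E := expR _; have E0 : 0 <= E by exact: expR_ge0.
have e1 : s * s `^ (al - 1) = s `^ al.
  by rewrite -{1}[s]powRr1 ?(ltW s0)// -powRDp//; congr (_ `^ _); ring.
rewrite [E * (1 + _)]mulrDr mulr1 [leRHS]mulrDr; apply: lerD.
  rewrite normrM (ger0_norm E0) [leRHS]mulrC ler_wpM2l// (le_trans (cos_max _))//.
  by rewrite -[leLHS](expr1n _ 2) ler_sqr ?nnegrE// ?lerDl// addr_ge0.
have -> : s * `|- (al * s `^ (al - 1)) * (E * (C s + k * S s))| =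
    E * (al * s `^ al * `|C s + k * S s|).
  by rewrite !normrM normrN !normrM (gtr0_norm al0) (ger0_norm (powR_ge0 _ _)) (ger0_norm E0) -e1; ring.
rewrite (_ : (1 + k0) ^+ 2 * (E * s `^ al) = E * (s `^ al * (1 + k0) ^+ 2)); last by ring.
by rewrite ler_wpM2l// ler_pM ?mulr_ge0 ?powR_ge0 ?(ltW al0)// ler_piMl ?powR_ge0.
Qed.

Variables (K K' : R).
Hypothesis KE : forall y : R, 0 <= y ->
  (1 + y `^ (2 / al)) * (1 + k0) ^+ 2 * (expR (- y) * (y + y ^+ 2)) <= K.
Hypothesis KE' : forall y : R, 0 <= y ->
  y `^ (1 / al) * (1 + k0) ^+ 2 * (expR (- y) * (1 + y)) <= K'.

Let powal (r s : R) : 0 < s -> (s `^ al) `^ (r / al) = s `^ r.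
Proof. by move=> s0; rewrite -powRrM mulrC divfK ?gt_eqF. Qed.

Lemma profile_sum_bound (I : eqType) (p : seq I) (c lam : I -> R) (B : R) :
  0 <= B -> {in p, forall t, 0 <= lam t} -> {in p, forall t, lam t = 0 -> c t = 0} ->
  (forall s, 0 <= s -> `|\sum_(t <- p) c t * hat s (lam t)| <= s ^+ 2 * B) ->
  `|\sum_(t <- p) c t * (expR (- (lam t) `^ al) * cos (k * (lam t) `^ al + eta))| <= B * K * (pi / 2).
Proof.
apply: (@hat_sum_bound R w w1 w2 K K' dw dw1 cw2) => s.
  move=> s0; rewrite ler_pdivlMr ?ltr_pwDl ?sqr_ge0//.
  apply: le_trans (KE (powR_ge0 s al)); rewrite powal// powR_mulrn ?(ltW s0)//.
  by rewrite mulrC -mulrA ler_wpM2l ?addr_ge0 ?sqr_ge0// w2_bound.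
move=> s1; have s0 : 0 < s by exact: lt_le_trans s1.
rewrite ler_pdivlMr//; apply: le_trans (KE' (powR_ge0 s al)); rewrite powal// powRr1 ?(ltW s0)//.
by rewrite mulrC -mulrA ler_wpM2l ?(ltW s0)// w_bound.
Qed.

End profile.

(** The addition formula for sin splits the sum into one with coefficients l sin th and one with l
    cos th, matched by [hat_sin_bound] and [hat_cos_bound]. The factor l makes the coefficient
    vanish at frequency 0. [C] depends on al and k0 only, not on k. *)
Lemma smoothing_constant : exists2 C : R, 0 < C &
  forall (k : R) (p : tpoly) (M : R), `|k| <= k0 -> tpos p -> (forall x, `|tpe p x| <= M) ->
  `|\sum_(t <- p) t.1 * t.2.1 * (expR (- t.2.1 `^ al) * sin (t.2.2 + k * t.2.1 `^ al))| <= C * M.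
Proof.
have r1 : 0 <= 2 / al by rewrite divr_ge0// ltW.
have r2 : 0 <= 1 / al by rewrite divr_ge0// ltW.
have [C1 C10 h1] := powR_expRN_bounded2 ler01 (ler0n R 2).
have [C2 C20 h2] := powR_expRN_bounded2 (addr_ge0 r1 ler01) (addr_ge0 r1 (ler0n R 2)).
have [C3 C30 h3] := powR_expRN_bounded2 r2 (addr_ge0 r2 ler01).
(* [K] collects the four products of 1 + y^(2 / al) with y + y^2, and [K'] the two of y^(1 / al)
   with 1 + y. At y = s^al these powers are s^2 and s, the weights needed for the hat
   representation. *)
pose K := (1 + k0) ^+ 2 * (C1 + C1 + C2 + C2); pose K' := (1 + k0) ^+ 2 * (C3 + C3).
have yD (y r s : R) : 0 <= y -> 0 < s -> 0 <= r -> y `^ (r + s) = y `^ r * y `^ s.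
  move=> y0 s0 r0; rewrite powRD//; apply/implyP => /eqP h; exfalso.
  by have := addr_ge0 r0 (ltW s0); have := ltr_pwDr s0 r0; rewrite h ltxx.
have KE y : 0 <= y -> (1 + y `^ (2 / al)) * (1 + k0) ^+ 2 * (expR (- y) * (y + y ^+ 2)) <= K.
  move=> y0; have [a1 a2] := h1 _ y0; have [a3 a4] := h2 _ y0.
  rewrite yD// powRr1// in a3; rewrite yD// powR_mulrn// in a4.
  rewrite powRr1// in a1; rewrite powR_mulrn// in a2.
  rewrite (_ : _ * _ * _ = (1 + k0) ^+ 2 * (y * expR (- y) + y ^+ 2 * expR (- y) +
    y `^ (2 / al) * y * expR (- y) + y `^ (2 / al) * y ^+ 2 * expR (- y))); last by ring.
  by rewrite ler_wpM2l ?sqr_ge0//; rlra.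
have KE' y : 0 <= y -> y `^ (1 / al) * (1 + k0) ^+ 2 * (expR (- y) * (1 + y)) <= K'.
  move=> y0; have [a1 a2] := h3 _ y0; rewrite yD// powRr1// in a2.
  rewrite (_ : _ * _ * _ = (1 + k0) ^+ 2 * (y `^ (1 / al) * expR (- y) +
    y `^ (1 / al) * y * expR (- y))); last by ring.
  by rewrite ler_wpM2l ?sqr_ge0//; rlra.
(* One factor 2 counts the two phases, the other is the 2 in the hat bounds 2 s^2 M. *)
exists (2 * (2 * K * (pi / 2))).
  have k1 : 0 < 1 + k0 by rewrite ltr_pwDl.
  have K0 : 0 < K by rewrite /K mulr_gt0 ?exprn_gt0// !addr_gt0.
  by clearbody K; rewrite mulr_gt0// mulr_gt0 ?divr_gt0 ?pi_gt0// mulr_gt0.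
move=> k p M kk p0 pM.
have M0 : 0 <= M by apply: le_trans (pM 0).
have B0 : 0 <= 2 * M by rewrite mulr_ge0.
have := @profile_sum_bound k 0 kk K K' KE KE' _ p (fun t => t.1 * t.2.1 * sin t.2.2)
  (fun t => t.2.1) (2 * M) B0 p0.
have := @profile_sum_bound k (- (pi / 2)) kk K K' KE KE' _ p (fun t => t.1 * t.2.1 * cos t.2.2)
  (fun t => t.2.1) (2 * M) B0 p0.
move=> /(_ _ _) H2 /(_ _ _) H1.
have {}H1 := H1 _ _; have {}H2 := H2 _ _.
rewrite [X in `|X|](_ : _ =
  \sum_(t <- p) t.1 * t.2.1 * sin t.2.2 * (expR (- t.2.1 `^ al) * cos (k * t.2.1 `^ al + 0)) +
  \sum_(t <- p) t.1 * t.2.1 * cos t.2.2 * (expR (- t.2.1 `^ al) * cos (k * t.2.1 `^ al - pi / 2))).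
  apply: (le_trans (ler_normD _ _)).
  rewrite (_ : _ * _ * M = 2 * M * K * (pi / 2) + 2 * M * K * (pi / 2)); last by ring.
  apply: lerD.
    apply: H1; first by move=> t _ ->; rewrite mulr0 mul0r.
    by move=> s s0; have := hat_sin_bound s0 p0 pM; rewrite (_ : 2 * s ^+ 2 * M = s ^+ 2 * (2 * M))//; ring.
  apply: H2; first by move=> t _ ->; rewrite mulr0 mul0r.
  by move=> s s0; have := hat_cos_bound s0 p0 pM; rewrite (_ : 2 * s ^+ 2 * M = s ^+ 2 * (2 * M))//; ring.
rewrite -big_split/=; apply: eq_bigr => t _.
by rewrite addr0 cosBpihalf sinD; ring.
Qed.

End smoothing.

(** * The semigroup on trigonometric polynomials *)

Section trigonometric_operations.
Context {R : realType}.
Implicit Types (p : @tpoly R) (x y r M : R).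

(** The derivative: - sin is cos shifted by pi / 2, so it is again a list of cosine waves with the
    same frequencies. *)
Definition dlist p : tpoly := [seq (t.1 * t.2.1, (t.2.1, t.2.2 + pi / 2)) | t <- p].

Definition affine r y p : tpoly := [seq (t.1, (r * t.2.1, t.2.2 + t.2.1 * y)) | t <- p].

Definition tneg p : tpoly := [seq (- t.1, t.2) | t <- p].

Lemma tpos_dlist p : tpos p -> tpos (dlist p).
Proof. by move=> p0 t /mapP[u up ->]/=; exact: p0. Qed.

Lemma tpos_affine r y p : 0 <= r -> tpos p -> tpos (affine r y p).
Proof. by move=> r0 p0 t /mapP[u up ->]/=; rewrite mulr_ge0// p0. Qed.

Lemma tpos_tneg p : tpos p -> tpos (tneg p).
Proof. by move=> p0 t /mapP[u up ->]/=; exact: p0. Qed.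

Lemma tpos_cat p q : tpos p -> tpos q -> tpos (p ++ q).
Proof. by move=> p0 q0 t; rewrite mem_cat => /orP[/p0|/q0]. Qed.

Lemma tpe_affine r y p x : tpe (affine r y p) x = tpe p (r * x + y).
Proof. by rewrite /tpe big_map; apply: eq_bigr => t _ /=; congr (_ * cos _); ring. Qed.

Lemma tpe_tneg p x : tpe (tneg p) x = - tpe p x.
Proof. by rewrite /tpe big_map -sumrN; apply: eq_bigr => t _ /=; ring. Qed.

Lemma tpe_cons t p x : tpe (t :: p) x = t.1 * cos (t.2.1 * x + t.2.2) + tpe p x.
Proof. by rewrite /tpe big_cons. Qed.

Lemma is_derive_tpe p x : is_derive x (1 : R) (tpe p) (tpe (dlist p) x).
Proof.
elim: p => [|t p IH].
  notypeclasses refine (@is_derive_ext _ _ (fun=> 0) _ _ _ _).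
    by move=> y; rewrite /tpe big_nil.
  by notypeclasses refine (is_derive_eq1 _ _); [der|rewrite /tpe big_nil].
notypeclasses refine (@is_derive_ext _ _ _ _ _ (tpe_cons t p) _).
notypeclasses refine (is_derive_eq1 _ _); first by der; exact: IH.
by rewrite tpe_cons/= addrA cosDpihalf; ring.
Qed.

End trigonometric_operations.

Section semigroup.
Context {R : realType}.
Notation mu := (@lebesgue_measure R).
Variables (al ka : R).
Hypothesis al0 : 0 < al.
Implicit Types (p : @tpoly R) (x y rho M : R).

(* [E (tpe p Z)] for [Z] stable with skewness parameter [ka = dl * tan (pi al / 2)]. *)
Definition stable_mean p :=
  \sum_(t <- p) t.1 * (expR (- t.2.1 `^ al) * cos (t.2.2 + ka * t.2.1 `^ al)).

(* [E (cos (l (rho^(1/al) x + (1 - rho)^(1/al) Z) + th))] *)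
Definition wave l th rho x := expR (- ((1 - rho) * l `^ al)) *
  cos (l * rho `^ al^-1 * x + th + ka * ((1 - rho) * l `^ al)).

Definition semigroup p rho x := \sum_(t <- p) t.1 * wave t.2.1 t.2.2 rho x.

Lemma semigroup_cons t p rho x :
  semigroup (t :: p) rho x = t.1 * wave t.2.1 t.2.2 rho x + semigroup p rho x.
Proof. by rewrite /semigroup big_cons. Qed.

Let powK (rho l : R) : 0 < rho < 1 -> 0 <= l -> ((1 - rho) `^ al^-1 * l) `^ al = (1 - rho) * l `^ al.
Proof.
move=> /andP[r0 r1] l0; rewrite powRM ?powR_ge0// -powRrM mulVf ?gt_eqF// powRr1//.
by rewrite subr_ge0 ltW.
Qed.

(** As a mean of p composed with an affine map, the semigroup inherits every bound known for
    [stable_mean]. *)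
Lemma semigroupE p rho x : tpos p -> 0 < rho < 1 ->
  semigroup p rho x = stable_mean (affine ((1 - rho) `^ al^-1) (rho `^ al^-1 * x) p).
Proof.
move=> p0 r01; rewrite /semigroup /stable_mean big_map !big_seq; apply: eq_bigr => t tp/=.
by rewrite powK ?p0// /wave; congr (_ * (_ * cos _)); ring.
Qed.

Lemma is_derive_wave l th rho x :
  is_derive x (1 : R) (wave l th rho) (rho `^ al^-1 * (l * wave l (th + pi / 2) rho x)).
Proof.
rewrite /wave; der_eq; rewrite (_ : _ + (th + pi / 2) + _ = l * rho `^ al^-1 * x + th +
  ka * ((1 - rho) * l `^ al) + pi / 2); last by ring.
by rewrite cosDpihalf; ring.
Qed.

Lemma is_derive_semigroup p rho x :
  is_derive x (1 : R) (semigroup p rho) (rho `^ al^-1 * semigroup (dlist p) rho x).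
Proof.
elim: p => [|t p IH].
  notypeclasses refine (@is_derive_ext _ _ (fun=> 0) _ _ _ _).
    by move=> y; rewrite /semigroup big_nil.
  by notypeclasses refine (is_derive_eq1 _ _); [der|rewrite /semigroup big_nil mulr0].
notypeclasses refine (@is_derive_ext _ _ _ _ _ (semigroup_cons t p rho) _).
notypeclasses refine (is_derive_eq1 _ _).
  exact: (is_deriveD1 (is_deriveM1 (is_derive_cst1 _ _) (is_derive_wave _ _ _ _)) IH).
by cbv beta; rewrite semigroup_cons/=; ring.
Qed.

Lemma stable_mean_cat p q : stable_mean (p ++ q) = stable_mean p + stable_mean q.
Proof. by rewrite /stable_mean big_cat. Qed.

Lemma stable_mean_tneg p : stable_mean (tneg p) = - stable_mean p.
Proof. by rewrite /stable_mean big_map -sumrN; apply: eq_bigr => t _ /=; rewrite mulNr. Qed.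

Variable CS : R.
Hypothesis mean_bound : forall p M, tpos p -> (forall x, `|tpe p x| <= M) ->
  `|stable_mean p| <= M.
Hypothesis smoothing : forall p M, tpos p -> (forall x, `|tpe p x| <= M) ->
  `|\sum_(t <- p) t.1 * t.2.1 * (expR (- t.2.1 `^ al) * sin (t.2.2 + ka * t.2.1 `^ al))|
     <= CS * M.

Lemma semigroup_bound p M rho x : tpos p -> (forall x, `|tpe p x| <= M) -> 0 < rho < 1 ->
  `|semigroup p rho x| <= M.
Proof.
move=> p0 pM r01; rewrite semigroupE//; apply: mean_bound.
  by apply: tpos_affine => //; exact: powR_ge0.
by move=> z; rewrite tpe_affine.
Qed.

(** The difference is the mean of one polynomial, the difference of two translates of p at distance
    rho^(1/al) |x - y|. *)
Lemma semigroup_modulus p (w : R -> R) rho x y : tpos p ->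
  (forall x y, `|tpe p x - tpe p y| <= w `|x - y|) -> 0 < rho < 1 ->
  `|semigroup p rho x - semigroup p rho y| <= w (rho `^ al^-1 * `|x - y|).
Proof.
move=> p0 pw r01; rewrite !semigroupE// -stable_mean_tneg -stable_mean_cat.
have r0 := powR_ge0 (1 - rho) al^-1.
apply: mean_bound; first by apply: tpos_cat; [|apply: tpos_tneg]; exact: tpos_affine.
move=> z; rewrite tpe_cat tpe_tneg !tpe_affine; apply: (le_trans (pw _ _)).
rewrite opprD addrACA subrr add0r -mulrBr normrM ger0_norm ?powR_ge0//.
Qed.

(** Smoothing applied to p with frequencies scaled by (1 - rho)^(1/al); undoing the scale in the
    factor l yields the power - 1/al. Only the sup norm of p enters, not that of p'. *)
Lemma semigroup_dlist_bound p M rho x : tpos p -> (forall x, `|tpe p x| <= M) -> 0 < rho < 1 ->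
  `|semigroup (dlist p) rho x| <= CS * M * (1 - rho) `^ (- al^-1).
Proof.
move=> p0 pM r01; have /andP[_ r1] := r01.
have s0 : 0 < (1 - rho) `^ al^-1 by rewrite powR_gt0// subr_gt0.
have pM' z : `|tpe (affine ((1 - rho) `^ al^-1) (rho `^ al^-1 * x) p) z| <= M.
  by rewrite tpe_affine.
have := smoothing (tpos_affine (ltW s0) p0) pM'.
rewrite big_map/= powRN ler_pdivlMr//; apply: le_trans.
rewrite -[X in _ * X](ger0_norm (ltW s0)) -normrM -normrN le_eqVlt; apply/orP; left; apply/eqP.
congr (`| _ |); rewrite /semigroup big_map mulr_suml -sumrN !big_seq; apply: eq_bigr => t tp/=.
rewrite powK ?p0// /wave (_ : _ + (t.2.2 + pi / 2) + _ = t.2.2 + t.2.1 * (rho `^ al^-1 * x) +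
  ka * ((1 - rho) * t.2.1 `^ al) + pi / 2); last by ring.
by rewrite cosDpihalf; ring.
Qed.

Lemma semigroup_smoothing p M rho x y : tpos p -> (forall x, `|tpe p x| <= M) -> 0 < rho < 1 ->
  `|semigroup p rho x - semigroup p rho y| <= CS * M * (1 - rho) `^ (- al^-1) * `|x - y|.
Proof.
move=> p0 pM r01; apply: is_derive_lipschitz => [z|z]; first exact: is_derive_semigroup.
rewrite normrM ger0_norm ?powR_ge0// -[leRHS]mul1r ler_pM ?powR_ge0//; last first.
  exact: semigroup_dlist_bound.
by case/andP: r01 => a b; rewrite powR_le1 ?(ltW a) ?(ltW b)// invr_ge0 ltW.
Qed.

End semigroup.

(** * The solution f_p and its derivative *)

Section quadratic_remainder.
Context {R : realType}.

(** For an integral of waves the Taylor remainder is bounded under the integral sign, so a quadratic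
    bound gives differentiability directly. *)
Lemma is_derive_quadratic (F : R -> R) (x a C : R) :
  (forall y, `|F y - F x - (y - x) * a| <= C * (y - x) ^+ 2) -> is_derive x (1 : R) F a.
Proof.
move=> H.
have L : (fun h : R => h^-1 *: ((F \o shift x) (h *: (1 : R)) - F x)) @ 0^' --> a.
  apply/cvgrPdist_le => e e0.
  have C1 : 0 < `|C| + 1 by rewrite ltr_pwDr.
  near=> h.
  have h0 : h != 0 by near: h; exact: nbhs_dnbhs_neq.
  have := H (h + x); rewrite addrK /= => {}H.
  rewrite [X in _ - h^-1 *: (F X - _)](_ : _ = h + x); last by rewrite /shift/= scaler1.
  rewrite -(ler_pM2l (_ : 0 < `|h|)) ?normr_gt0// -normrM.
  rewrite (_ : h * _ = - (F (h + x) - F x - h * a)); last first.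
    by rewrite /GRing.scale/=; field.
  rewrite normrN; apply: (le_trans H).
  rewrite -real_normK ?num_real// expr2 mulrCA ler_wpM2l//.
  apply: (@le_trans _ _ ((`|C| + 1) * `|h|)).
    by rewrite ler_wpM2r//; have := ler_norm C; lra.
  rewrite -ler_pdivlMl// mulrC.
  near: h; apply: nbhs_dnbhs; exists (e / (`|C| + 1)) => /=; first by rewrite divr_gt0.
  by move=> z /=; rewrite sub0r normrN => /ltW.
have D : derivable F x 1 by apply/cvg_ex; exists a.
by apply: DeriveDef => //; apply/cvg_lim.
Unshelve. all: by end_near. Qed.

Lemma is_derive_taylor (F dF : R -> R) C x y : 0 <= C ->
  (forall z, is_derive z (1 : R) F (dF z)) ->
  (forall z, `|z - x| <= `|y - x| -> `|dF z - dF x| <= C) ->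
  `|F y - F x - (y - x) * dF x| <= C * `|y - x|.
Proof.
move=> C0 dFF Hl.
have [z xz ->] : exists2 z, `|z - x| <= `|y - x| & F y - F x = dF z * (y - x).
  have cF z : {for z, continuous F} by exact: is_derive1_cont (dFF z).
  have [xy|yx] := leP x y.
    have [z zi e] := MVT_segment xy (fun z _ => dFF z) (continuous_subspaceT cF).
    exists z => //; move: zi; rewrite in_itv/= => /andP[a b].
    by rewrite !ger0_norm ?subr_ge0//; lra.
  have [z zi e] := MVT_segment (ltW yx) (fun z _ => dFF z) (continuous_subspaceT cF).
  exists z; last by rewrite -opprB e; ring.
  move: zi; rewrite in_itv/= => /andP[a b].
  by rewrite !ler0_norm ?subr_le0 ?(ltW yx)//; lra.
rewrite (_ : _ - _ = (dF z - dF x) * (y - x)); last by ring.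
by rewrite normrM ler_wpM2r// Hl.
Qed.

Lemma cos_taylor (x y : R) : `|cos y - cos x - (y - x) * (- sin x)| <= (y - x) ^+ 2.
Proof.
rewrite -real_normK ?num_real// expr2.
apply: (@is_derive_taylor cos (fun z => - sin z)) => //.
move=> z zy; rewrite opprK addrC distrC; apply: le_trans zy.
exact: sin_lip.
Qed.

End quadratic_remainder.

Section stein_solution.
Context {R : realType}.
Notation mu := (@lebesgue_measure R).
Variables (al ka : R).
Hypotheses (al0 : 0 < al) (al1 : al <= 1).
Implicit Types (p : @tpoly R) (x y l th rho M : R).
Let al0i : 0 < al^-1. Proof. by rewrite invr_gt0. Qed.
Let al1i : 1 <= al^-1. Proof. by rewrite invf_ge1. Qed.
Notation wav := (wave al ka).
Notation sgp := (semigroup al ka).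

(** The assumption al <= 1 enters here: the contraction rho^(1/al) compensates the singular weight
    rho^(-1). *)
Lemma powR_inv_le rho : 0 < rho < 1 -> rho `^ (-1) * rho `^ al^-1 <= 1.
Proof.
move=> /andP[r0 r1]; rewrite -powRDp// powR_le1 ?(ltW r0) ?(ltW r1)//.
by rewrite addrC subr_ge0.
Qed.

Lemma expR_wave_le1 l rho : 0 <= l -> 0 < rho < 1 -> expR (- ((1 - rho) * l `^ al)) <= 1.
Proof.
move=> l0 /andP[r0 r1]; rewrite expR_le1 oppr_le0 mulr_ge0 ?powR_ge0//.
by rewrite subr_ge0 ltW.
Qed.

Lemma wave_le1 l th rho x : 0 <= l -> 0 < rho < 1 -> `|wav l th rho x| <= 1.
Proof.
move=> l0 r01; rewrite normrM ger0_norm ?expR_ge0// -[leRHS]mul1r.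
by rewrite ler_pM ?expR_ge0 ?expR_wave_le1 ?cos_max.
Qed.

Lemma wave_lipschitz l th rho x y : 0 <= l -> 0 < rho < 1 ->
  `|wav l th rho x - wav l th rho y| <= rho `^ al^-1 * (l * `|x - y|).
Proof.
move=> l0 r01; rewrite mulrA; apply: (is_derive_lipschitz (fun z => is_derive_wave al ka l th rho z)) => z.
by rewrite normrM ger0_norm ?powR_ge0// ler_wpM2l ?powR_ge0// normrM ger0_norm// ler_piMr// wave_le1.
Qed.

Lemma wave_measurable d (T : measurableType d) (D : set T) l th (f g : T -> R) :
  measurable_fun D f -> measurable_fun D g ->
  measurable_fun D (fun w => wav l th (f w) (g w)).
Proof. by move=> mf mg; rewrite /wave; mfun. Qed.

Let Dint l th x y rho := rho `^ (-1) * (wav l th rho x - wav l th rho y).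

Lemma Dint_le l th x y rho : 0 <= l -> 0 < rho < 1 ->
  `|Dint l th x y rho| <= l * `|x - y| * rho `^ 0.
Proof.
move=> l0 r01; rewrite powRr0 mulr1 normrM ger0_norm ?powR_ge0//.
apply: (@le_trans _ _ (rho `^ (-1) * rho `^ al^-1 * (l * `|x - y|))).
  by rewrite -mulrA ler_wpM2l ?powR_ge0// wave_lipschitz.
by rewrite ler_piMl ?mulr_ge0// powR_inv_le.
Qed.

Let Dint_measurable l th x y : measurable_fun setT (Dint l th x y).
Proof. by rewrite /Dint; mfun; exact: wave_measurable. Qed.

Lemma Dint_integrable l th x y : 0 <= l ->
  mu.-integrable `]0, 1[ (EFin \o Dint l th x y).
Proof.
move=> l0; apply: (@dom01_integrable _ _ 0 (l * `|x - y|)) => //.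
by move=> rho r01; exact: Dint_le.
Qed.

Definition stein_wave l th x := - \int[mu]_(rho in `]0, 1[) Dint l th x 0 rho.

Lemma stein_waveB l th x y : 0 <= l ->
  stein_wave l th x - stein_wave l th y = - \int[mu]_(rho in `]0, 1[) Dint l th x y rho.
Proof.
move=> l0; rewrite /stein_wave -opprD -RintegralB//; [|exact: Dint_integrable..].
by congr (- _); apply: eq_Rintegral => rho _; rewrite /Dint; ring.
Qed.

Let dint l th x rho := rho `^ (al^-1 - 1) * (l * wav l (th + pi / 2) rho x).

Lemma dint_integrable l th x : 0 <= l -> mu.-integrable `]0, 1[ (EFin \o dint l th x).
Proof.
move=> l0; apply: (@dom01_integrable _ _ 0 l) => //.
  by rewrite /dint; mfun; exact: wave_measurable.
move=> rho r01; have /andP[r0 r1] := r01.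
rewrite powRr0 mulr1 normrM ger0_norm ?powR_ge0// -[leRHS]mul1r ler_pM ?powR_ge0//.
  by rewrite powR_le1 ?(ltW r0) ?(ltW r1)// subr_ge0.
by rewrite normrM ger0_norm// ler_piMr// wave_le1.
Qed.

Lemma is_derive_stein_wave l th x : 0 <= l ->
  is_derive x (1 : R) (stein_wave l th) (- \int[mu]_(rho in `]0, 1[) dint l th x rho).
Proof.
move=> l0; apply: (@is_derive_quadratic _ _ _ _ (l ^+ 2)) => y.
rewrite stein_waveB// mulrN -opprD normrN -RintegralZl//; last exact: dint_integrable.
rewrite -RintegralB//; last 2 first.
- exact: Dint_integrable.
- by apply: integrableZl1 => //; exact: dint_integrable.
have mf : measurable_fun setT (fun rho => Dint l th y x rho - (y - x) * dint l th x rho).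
  by rewrite /Dint /dint; mfun; exact: wave_measurable.
have N1 : -1 < 0 :> R by rewrite oppr_lt0.
have := @dom01_le _ _ 0 (l ^+ 2 * (y - x) ^+ 2) mf N1.
rewrite add0r invr1 mulr1; apply=> rho r01; have /andP[r0 r1] := r01.
rewrite powRr0 mulr1 /Dint /dint (addrC al^-1) powRDp// (_ : _ - _ = rho `^ (-1) *
  (expR (- ((1 - rho) * l `^ al)) *
   (cos (l * rho `^ al^-1 * y + th + ka * ((1 - rho) * l `^ al)) -
    cos (l * rho `^ al^-1 * x + th + ka * ((1 - rho) * l `^ al)) -
    ((l * rho `^ al^-1 * y + th + ka * ((1 - rho) * l `^ al)) -
     (l * rho `^ al^-1 * x + th + ka * ((1 - rho) * l `^ al))) *
    (- sin (l * rho `^ al^-1 * x + th + ka * ((1 - rho) * l `^ al)))))); last first.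
  rewrite /wave (_ : _ + (th + pi / 2) + _ = l * rho `^ al^-1 * x + th +
    ka * ((1 - rho) * l `^ al) + pi / 2); last by ring.
  by rewrite cosDpihalf; ring.
rewrite normrM ger0_norm ?powR_ge0//.
apply: (@le_trans _ _ (rho `^ (-1) * (l * rho `^ al^-1 * (y - x)) ^+ 2)).
  rewrite ler_wpM2l ?powR_ge0// normrM -[leRHS]mul1r ler_pM//.
    by rewrite ger0_norm ?expR_ge0// expR_wave_le1.
  apply: (le_trans (cos_taylor _ _)); rewrite le_eqVlt; apply/orP; left; apply/eqP; ring.
rewrite (_ : _ * _ = l ^+ 2 * (y - x) ^+ 2 * (rho `^ (-1) * rho `^ al^-1 * rho `^ al^-1));
  last by ring.
have h : rho `^ (-1) * rho `^ al^-1 * rho `^ al^-1 <= 1.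
  rewrite -[leRHS]mulr1 ler_pM ?mulr_ge0 ?powR_ge0//; first exact: powR_inv_le.
  by rewrite powR_le1 ?(ltW r0) ?(ltW r1) ?(ltW al0i).
by rewrite ler_piMr// mulr_ge0 ?sqr_ge0.
Qed.

Definition stein p x := \sum_(t <- p) t.1 * stein_wave t.2.1 t.2.2 x.

(** The derivative of f_p: the weight rho^(1/al - 1) is rho^(-1) times the chain rule factor
    rho^(1/al). *)
Definition dstein p x :=
  - \int[mu]_(rho in `]0, 1[) (rho `^ (al^-1 - 1) * sgp (dlist p) rho x).

Lemma semigroup_measurable d (T : measurableType d) (D : set T) p (f g : T -> R) :
  measurable_fun D f -> measurable_fun D g ->
  measurable_fun D (fun w => sgp p (f w) (g w)).
Proof.
move=> mf mg; rewrite /semigroup; elim: p => [|t p IH].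
  by under eq_fun do rewrite big_nil; mfun.
by under eq_fun do rewrite big_cons; mfun => //; exact: wave_measurable.
Qed.

Lemma steinB p x y : tpos p -> stein p x - stein p y =
  - \int[mu]_(rho in `]0, 1[) (rho `^ (-1) * (sgp p rho x - sgp p rho y)).
Proof.
move=> p0; rewrite /stein -sumrB.
under eq_Rintegral => rho _ do rewrite -sumrB mulr_sumr.
rewrite Rintegral_seq_sum//; last first.
  move=> t tp; rewrite (_ : _ \o _ = EFin \o (fun rho => t.1 * Dint t.2.1 t.2.2 x y rho)).
    by apply: integrableZl1 => //; exact: Dint_integrable (p0 _ tp).
  by apply/funext => rho /=; rewrite /Dint; congr EFin; ring.
rewrite -sumrN !big_seq; apply: eq_bigr => t tp.
rewrite -mulrBr stein_waveB ?p0// mulrN; congr (- _).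
rewrite -RintegralZl//; last exact: Dint_integrable (p0 _ tp).
by apply: eq_Rintegral => rho _; rewrite /Dint; ring.
Qed.

Lemma dsteinE p x : tpos p -> dstein p x =
  - \sum_(t <- p) t.1 * \int[mu]_(rho in `]0, 1[) dint t.2.1 t.2.2 x rho.
Proof.
move=> p0; rewrite /dstein; congr (- _).
under eq_Rintegral => rho _ do rewrite /semigroup big_map mulr_sumr.
rewrite Rintegral_seq_sum//=; last first.
  move=> t tp; rewrite (_ : _ \o _ = EFin \o (fun rho => t.1 * dint t.2.1 t.2.2 x rho)).
    by apply: integrableZl1 => //; exact: dint_integrable (p0 _ tp).
  by apply/funext => rho /=; rewrite /dint; congr EFin; ring.
rewrite !big_seq; apply: eq_bigr => t tp.
rewrite -RintegralZl//; last exact: dint_integrable (p0 _ tp).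
by apply: eq_Rintegral => rho _; rewrite /dint; ring.
Qed.

Lemma is_derive_stein p x : tpos p -> is_derive x (1 : R) (stein p) (dstein p x).
Proof.
move=> p0; rewrite dsteinE//; elim: p p0 => [|t p IH] p0.
  notypeclasses refine (@is_derive_ext _ _ (fun=> 0) _ _ _ _).
    by move=> y; rewrite /stein big_nil.
  by notypeclasses refine (is_derive_eq1 _ _); [der|rewrite big_nil oppr0].
have [t0 {}p0] := tpos_cons p0.
notypeclasses refine (@is_derive_ext _ _ (fun y => t.1 * stein_wave t.2.1 t.2.2 y + stein p y) _ _ _ _).
  by move=> y; rewrite /stein big_cons.
notypeclasses refine (is_derive_eq1 _ _).
  exact: (is_deriveD1 (is_deriveM1 (is_derive_cst1 _ _) (is_derive_stein_wave _ _ t0)) (IH p0)).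
by cbv beta; rewrite big_cons; ring.
Qed.

End stein_solution.

Lemma eq_RintegralZl d (T : measurableType d) (R : realType) (m : {measure set T -> \bar R})
    (D : set T) (k : R) (f g : T -> R) : measurable D -> m.-integrable D (EFin \o g) ->
  (forall x, D x -> f x = k * g x) -> \int[m]_(x in D) f x = k * \int[m]_(x in D) g x.
Proof.
move=> mD ig fg; rewrite -RintegralZl//; apply: eq_Rintegral => x.
by rewrite inE => /fg.
Qed.

(** * The Stein equation *)

Section stein_equation.
Context {R : realType}.
Notation mu := (@lebesgue_measure R).

(** Both generators with the negative jumps folded onto the positive half-line. For cp = cm the
    compensator of the case al = 1 cancels in this form, so both cases share one proof. *)
Definition half_generator (al cp cm : R) (f : R -> R) (x : R) : R :=
  \int[mu]_(u in `]0, +oo[)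
    ((cp * (f (x + u) - f x) + cm * (f (x - u) - f x)) * u `^ (- 1 - al)).

Variables (al ka cp cm q K : R).
Hypotheses (al0 : 0 < al) (al1 : al <= 1) (alq : al < q).
Let alhq : al / 2 <= q. Proof. by move: al0 alq => h1 h2; lra. Qed.
Implicit Types (p : @tpoly R) (x y l th rho M : R).
Notation wav := (wave al ka).
(** The jump increment of a cosine. The hypotheses on it are what the two cases have in common: its
    integral, and a decay s^q at 0 with q > al, namely q = 1 for al < 1 and q = 2 for al = 1. *)
Let Dc X s := cp * (cos (X + s) - cos X) + cm * (cos (X - s) - cos X).
Hypothesis DcE : forall X k, 0 <= k ->
  \int[mu]_(u in `]0, +oo[) (Dc X (k * u) * u `^ (- 1 - al)) =
    - (k `^ al * (cos X + ka * sin X)).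
Hypothesis DcI : forall X k, 0 <= k ->
  mu.-integrable `]0, +oo[ (EFin \o (fun u => Dc X (k * u) * u `^ (- 1 - al))).
Hypothesis Dc_le : forall X s, 0 <= s -> `|Dc X s| <= K * s `^ q.
Hypothesis Dc_le1 : forall X s, `|Dc X s| <= K.
Let al0i : 0 < al^-1. Proof. by rewrite invr_gt0. Qed.
Let K0 : 0 <= K. Proof. exact: le_trans (Dc_le1 0 0). Qed.

Section one_wave.
Variables (l th x : R).
Hypothesis l0 : 0 <= l.

Let X rho := l * rho `^ al^-1 * x + th + ka * ((1 - rho) * l `^ al).
Let e rho := expR (- ((1 - rho) * l `^ al)).
Let k rho := l * rho `^ al^-1.
Let Dw rho u := cp * (wav l th rho (x + u) - wav l th rho x)
  + cm * (wav l th rho (x - u) - wav l th rho x).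
Let Phi rho u := rho `^ (-1) * Dw rho u * u `^ (- 1 - al).

Let DwE rho u : Dw rho u = e rho * Dc (X rho) (k rho * u).
Proof.
rewrite /Dw /Dc /wave -/(e rho) -/(X rho).
rewrite (_ : l * rho `^ al^-1 * (x + u) + th + ka * ((1 - rho) * l `^ al) = X rho + k rho * u);
  last by rewrite /X /k; ring.
rewrite (_ : l * rho `^ al^-1 * (x - u) + th + ka * ((1 - rho) * l `^ al) = X rho - k rho * u);
  last by rewrite /X /k; ring.
ring.
Qed.

Let k0 rho : 0 <= k rho. Proof. by rewrite mulr_ge0 ?powR_ge0. Qed.

(** Fubini is applied with a product majorant A(rho) B(u), although the integrand sees rho and u
    only through rho^(1/al) u in its increment. A bound by the r-th power of this quantity separates
    the variables, with rho^(-1 + r/al) <= rho^(-1/2) as soon as r >= al / 2. *)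
Let A rho := rho `^ (- 2^-1).
Let B u := K * (l `^ q + l `^ (al / 2)) * (4 * (peak (q - al) u + peak (al / 2) u)).

Let iA : mu.-integrable `]0, 1[ (EFin \o A).
Proof.
have h : -1 < - 2^-1 :> R by lra.
by have [] := powR_integral01 h.
Qed.

Let iB : mu.-integrable `]0, +oo[ (EFin \o B).
Proof.
have q0 : 0 < q - al by rewrite subr_gt0.
have a0 : 0 < al / 2 by rewrite divr_gt0.
have [_ i1] := peak_integral q0; have [_ i2] := peak_integral a0.
apply: integrableZl1 => //; apply: integrableZl1 => //; exact: integrableD1.
Qed.

Let Dc_half z s : 0 <= s -> `|Dc z s| <= K * s `^ (al / 2).
Proof.
move=> s0; have [s1|/ltW s1] := leP s 1; last first.
  by rewrite (le_trans (Dc_le1 _ _))// ler_peMr// powR_ge1// divr_ge0// ltW.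
rewrite (le_trans (Dc_le _ s0))// ler_wpM2l//.
have [->|sn0] := eqVneq s 0.
  rewrite !powR0//; first by rewrite mulf_neq0 ?gt_eqF// invr_gt0.
  by rewrite gt_eqF// (lt_trans al0).
have sp : 0 < s by rewrite lt_neqAle eq_sym sn0.
rewrite (_ : q = al / 2 + (q - al / 2)); last by ring.
rewrite powRDp// ler_piMr ?powR_ge0// powR_le1 ?s0//.
by rewrite subr_ge0.
Qed.

Let kM (r rho u : R) : 0 < rho -> 0 < u -> (k rho * u) `^ r = l `^ r * rho `^ (r / al) * u `^ r.
Proof.
by move=> r0 u0; rewrite powRM ?(ltW u0)// powRM ?powR_ge0// -powRrM (mulrC al^-1).
Qed.

Let e1 rho : 0 < rho < 1 -> 0 <= e rho <= 1.
Proof. by move=> r01; rewrite expR_ge0 expR_wave_le1. Qed.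

Let Phi_le rho u : `]0, 1[%classic rho -> `]0, +oo[%classic u -> `|Phi rho u| <= A rho * B u.
Proof.
rewrite /= !in_itv/= andbT => r01 u0; have /andP[r0 r1] := r01.
have r01' : 0 <= rho <= 1 by rewrite !ltW.
have pk1 : 0 <= peak (q - al) u by exact: peak_ge0.
have pk2 : 0 <= peak (al / 2) u by exact: peak_ge0.
have /andP[e0 ee1] := e1 r01.
rewrite /Phi DwE !normrM !(ger0_norm (powR_ge0 _ _)) (ger0_norm e0).
(* The exponent depends on u: r = q for u <= 1 gives integrability at 0, r = al / 2 for u > 1 gives
   it at infinity. *)
suff [r [[ra rp]]] : exists r, [/\ al / 2 <= r, l `^ r <= l `^ q + l `^ (al / 2) ,
    `|Dc (X rho) (k rho * u)| <= K * (k rho * u) `^ r &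
    u `^ r * u `^ (- 1 - al) <= 4 * (peak (q - al) u + peak (al / 2) u)].
  move=> h1 h2.
  have {}h1 : e rho * `|Dc (X rho) (k rho * u)| <= K * (k rho * u) `^ r.
    by rewrite (le_trans _ h1)// ler_piMl.
  apply: (@le_trans _ _ (rho `^ (-1) * (K * (k rho * u) `^ r) * u `^ (- 1 - al))).
    by rewrite ler_wpM2r ?powR_ge0// ler_wpM2l ?powR_ge0.
  rewrite kM// (_ : _ * _ * _ = rho `^ (-1) * rho `^ (r / al) * (K * l `^ r * (u `^ r * u `^ (- 1 - al))));
    last by ring.
  rewrite /A /B ler_pM ?mulr_ge0 ?powR_ge0//; last first.
    by rewrite ler_pM ?mulr_ge0 ?powR_ge0// ler_wpM2l.
  rewrite -powRDp// (_ : -1 + r / al = - 2^-1 + (r / al - 2^-1)); last by lra.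
  rewrite powRDp// ler_piMr ?powR_ge0// powR_le1//.
  by rewrite subr_ge0 ler_pdivlMr// mulrC.
have [u1|/ltW u1] := leP u 1.
  exists q; split => //.
  - by rewrite lerDl powR_ge0.
  - by apply: Dc_le; rewrite mulr_ge0// ltW.
  - rewrite -powRDp// (_ : q - al = q + (- 1 - al) + 1); last by ring.
    apply: (@le_trans _ _ (4 * peak (q + (-1 - al) + 1) u)); last by rewrite ler_wpM2l// lerDl.
    by apply: le_peak0; [move: alq => h; lra|rewrite u0].
exists (al / 2); split => //.
- by rewrite lerDr powR_ge0.
- by apply: Dc_half; rewrite mulr_ge0// ltW.
- rewrite -powRDp//.
  apply: (@le_trans _ _ (4 * peak (- (al / 2 + (-1 - al)) - 1) u)).
    by apply: le_peaky => //; move: al0 => h; lra.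
  rewrite (_ : - _ - 1 = al / 2); last by lra.
  by rewrite ler_wpM2l// lerDr.
Qed.

Let mPhi : measurable_fun setT (fun z : R * R => Phi z.1 z.2).
Proof.
have m1 := @measurable_fst _ _ R R; have m2 := @measurable_snd _ _ R R.
rewrite /Phi /Dw; mfun => //; apply: wave_measurable => //; mfun => //.
Qed.

Let mD : measurable (`]0, 1[%classic : set (measurableTypeR R)). Proof. by []. Qed.
Let mE : measurable (`]0, +oo[%classic : set (measurableTypeR R)). Proof. by []. Qed.

Let Phi_inner u : `]0, +oo[%classic u -> \int[mu]_(rho in `]0, 1[) Phi rho u =
  - ((cp * (stein_wave al ka l th (x + u) - stein_wave al ka l th x) +
     cm * (stein_wave al ka l th (x - u) - stein_wave al ka l th x)) * u `^ (- 1 - al)).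
Proof.
move=> _; rewrite !stein_waveB//.
have i1 := Dint_integrable ka al0 al1 th (x + u) x l0.
have i2 := Dint_integrable ka al0 al1 th (x - u) x l0.
rewrite (_ : - _ = u `^ (- 1 - al) * (cp * \int[mu]_(rho in `]0, 1[)
      (rho `^ (-1) * (wav l th rho (x + u) - wav l th rho x)) +
    cm * \int[mu]_(rho in `]0, 1[)
      (rho `^ (-1) * (wav l th rho (x - u) - wav l th rho x)))); last by ring.
rewrite -!RintegralZl// -RintegralD//; [|exact: integrableZl1..].
rewrite -RintegralZl//; last by apply: integrableD1 => //; exact: integrableZl1.
by apply: eq_Rintegral => rho _; rewrite /Phi /Dw; ring.
Qed.

Let Phi_integrable : mu.-integrable `]0, +oo[
  (EFin \o (fun u => \int[mu]_(rho in `]0, 1[) Phi rho u)).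
Proof.
have mPhi' : measurable_fun setT (fun z : R * R => Phi z.2 z.1).
  have := measurableT_comp mPhi (@measurable_swap _ _ R R); exact.
have Phi_le' u rho : `]0, +oo[%classic u -> `]0, 1[%classic rho -> `|Phi rho u| <= B u * A rho.
  by move=> u0 r0; rewrite mulrC; exact: Phi_le.
exact: (@fubini_in_integrable R _ _ _ _ mu mu _ _ (fun u rho => Phi rho u) mE mD mPhi' _ _ iB iA Phi_le').
Qed.

Lemma half_generator_wave_integrable : mu.-integrable `]0, +oo[ (EFin \o (fun u =>
  (cp * (stein_wave al ka l th (x + u) - stein_wave al ka l th x) +
     cm * (stein_wave al ka l th (x - u) - stein_wave al ka l th x)) * u `^ (- 1 - al))).
Proof.
have := Phi_integrable.
move=> /(@integrableZl1 _ _ _ _ _ (-1) _ mE).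
apply: eq_integrable => // u; rewrite inE => u0 /=.
by rewrite Phi_inner// mulN1r opprK.
Qed.

Let k_pow rho : 0 < rho -> k rho `^ al = rho * l `^ al.
Proof.
move=> r0; rewrite /k powRM ?powR_ge0// -powRrM mulVf ?gt_eqF// powRr1 ?(ltW r0)//.
by rewrite mulrC.
Qed.

(** The generator scales the frequency [k rho] by its al-th power rho l^al, and this rho cancels the
    weight rho^(-1). *)
Let Phi_outer rho : 0 < rho -> \int[mu]_(u in `]0, +oo[) Phi rho u =
  - (e rho * (l `^ al * (cos (X rho) + ka * sin (X rho)))).
Proof.
move=> r0; have I := DcE (X rho) (k0 rho).
have EZ : forall u, `]0, +oo[%classic u ->
    Phi rho u = rho `^ (-1) * e rho * (Dc (X rho) (k rho * u) * u `^ (-1 - al)).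
  by move=> u _; rewrite /Phi DwE; ring.
rewrite (eq_RintegralZl (m := mu) mE (DcI (X rho) (k0 rho)) EZ) I k_pow//.
rewrite powR_inv1 ?(ltW r0)//.
move: (cos (X rho)) (sin (X rho)) (e rho) (l `^ al) => C S E L.
have rn : rho != 0 by rewrite gt_eqF.
by field.
Qed.

Lemma half_generator_wave : half_generator al cp cm (stein_wave al ka l th) x =
  \int[mu]_(rho in `]0, 1[) (e rho * (l `^ al * (cos (X rho) + ka * sin (X rho)))).
Proof.
have F := @fubini_in R _ _ _ _ mu mu _ _ Phi mD mE mPhi _ _ iA iB Phi_le.
have iF := @fubini_in_integrable R _ _ _ _ mu mu _ _ Phi mD mE mPhi _ _ iA iB Phi_le.
have -> : half_generator al cp cm (stein_wave al ka l th) x =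
    -1 * \int[mu]_(u in `]0, +oo[) \int[mu]_(rho in `]0, 1[) Phi rho u.
  apply: (eq_RintegralZl mE Phi_integrable) => u u0.
  by rewrite (Phi_inner u0); ring.
rewrite -F; symmetry; apply: (eq_RintegralZl mD iF) => rho.
rewrite /= in_itv/= => /andP[r0 r1]; symmetry.
exact: (etrans (congr1 (fun z => -1 * z) (Phi_outer r0)) (etrans (mulN1r _) (opprK _))).
Qed.

(** The rho-derivative of V(rho, x): the first term comes from the factor 1 - rho in damping and
    phase and is the generator integrand, the second comes from rho^(1/al) x and is the drift. *)
Let dwave rho := e rho * (l `^ al * (cos (X rho) + ka * sin (X rho)))
  - al^-1 * x * (rho `^ (al^-1 - 1) * (l * (e rho * sin (X rho)))).

Let is_derive_wave_rho rho : 0 < rho ->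
  is_derive rho (1 : R) (fun r => wav l th r x) (dwave rho).
Proof.
move=> r0; rewrite /wave; der_eq => //.
by rewrite /dwave /e /X; move: (expR _) (cos _) (sin _) (rho `^ (_ - 1)) => E C S T; ring.
Qed.

Let dwave_cont rho : 0 < rho -> {for rho, continuous dwave}.
Proof. by move=> r0; rewrite /dwave /e /X; der_cont. Qed.

Let sin_int_integrable : mu.-integrable `]0, 1[
  (EFin \o (fun rho => rho `^ (al^-1 - 1) * (l * (e rho * sin (X rho))))).
Proof.
have := dint_integrable ka al0 al1 th x l0 => /(integrableZl1 (-1) mD).
apply: eq_integrable => // rho _ /=; rewrite /wave.
rewrite (_ : _ + (th + pi / 2) + _ = X rho + pi / 2); last by rewrite /X; ring.
by rewrite cosDpihalf /e; congr EFin; ring.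
Qed.

Let gen_int_integrable : mu.-integrable `]0, 1[
  (EFin \o (fun rho => e rho * (l `^ al * (cos (X rho) + ka * sin (X rho))))).
Proof.
apply: (@dom01_integrable _ _ 0 (l `^ al * (1 + `|ka|))) => //.
  by rewrite /e /X; mfun.
move=> rho r01; rewrite powRr0 mulr1 normrM (ger0_norm (expR_ge0 _)).
rewrite -[leRHS]mul1r ler_pM ?expR_ge0//; first by have /andP[] := e1 r01.
rewrite normrM ger0_norm ?powR_ge0// ler_wpM2l ?powR_ge0//.
by rewrite (le_trans (ler_normD _ _))// lerD ?cos_max// normrM ler_piMr// sin_max.
Qed.

(** The left side is the integral of d/drho V(rho, x) over (0, 1), so it equals V(1, x) - V(0, x):
    the wave itself minus its stable mean. *)
Lemma stein_wave_equation :
  half_generator al cp cm (stein_wave al ka l th) x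
    - al^-1 * (x * - \int[mu]_(rho in `]0, 1[)
        (rho `^ (al^-1 - 1) * (l * wav l (th + pi / 2) rho x))) =
  cos (l * x + th) - expR (- l `^ al) * cos (th + ka * l `^ al).
Proof.
rewrite half_generator_wave.
rewrite (_ : al^-1 * _ = al^-1 * x *
    \int[mu]_(rho in `]0, 1[) (rho `^ (al^-1 - 1) * (l * (e rho * sin (X rho))))); last first.
  rewrite -mulrA; congr (_ * (_ * _)); rewrite -[LHS]mulN1r; symmetry.
  apply: (eq_RintegralZl mD (dint_integrable ka al0 al1 th x l0)) => rho _; rewrite /wave.
  rewrite (_ : _ + (th + pi / 2) + _ = X rho + pi / 2); last by rewrite /X; ring.
  by rewrite cosDpihalf /e; ring.
rewrite -(eq_RintegralZl mD sin_int_integrable (fun _ _ => erefl)) -RintegralB//; last first.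
  exact: integrableZl1.
have F1 : wav l th rho x @[rho --> 1^'-] --> cos (l * x + th).
  rewrite (_ : cos _ = wav l th 1 x).
    apply: cvg_at_left_filter; have := is_derive1_cont (is_derive_wave_rho ltr01).
    exact.
  by rewrite /wave subrr mul0r oppr0 expR0 mul1r powR1 mulr1 mulr0 addr0.
have F0 : wav l th rho x @[rho --> 0^'+] --> expR (- l `^ al) * cos (th + ka * l `^ al).
  have s0 : rho `^ al^-1 @[rho --> 0^'+] --> (0 : R).
    apply: (@cvg0_powR_bound _ _ _ 1 al^-1) => // rho _.
    by rewrite subr0 ger0_norm ?powR_ge0// mul1r.
  have i0 : rho @[rho --> 0^'+] --> (0 : R) by exact: cvg_at_right_filter.
  rewrite (_ : expR _ * _ = expR (- ((1 - 0) * l `^ al)) *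
    cos (l * 0 * x + th + ka * ((1 - 0) * l `^ al))); last first.
    by rewrite subr0 mul1r mulr0 mul0r add0r.
  have c1 : (1 - rho) * l `^ al @[rho --> 0^'+] --> (1 - 0) * l `^ al.
    by apply: cvgMl; apply: cvgB => //; exact: cvg_cst.
  apply: cvgM.
    by apply: continuous_cvg; [exact: continuous_expR|exact: cvgN].
  apply: continuous_cvg; first exact: continuous_cos.
  apply: cvgD; last exact: cvgMr.
  by apply: cvgD; [apply: cvgMl; exact: cvgMr|exact: cvg_cst].
have dF rho : 0 < rho < 1 -> is_derive rho (1 : R) (fun r => wav l th r x) (dwave rho).
  by move=> /andP[r0 _]; exact: is_derive_wave_rho.
have cF rho : 0 < rho < 1 -> {for rho, continuous dwave}.
  by move=> /andP[r0 _]; exact: dwave_cont.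
have ifn : mu.-integrable `]0, 1[ (EFin \o dwave).
  by apply: integrableB1 => //; exact: integrableZl1.
exact: (ftc_itv01 dF cF F0 F1 ifn).
Qed.

End one_wave.

Lemma stein_equation p x : tpos p ->
  half_generator al cp cm (stein al ka p) x - al^-1 * (x * dstein al ka p x) =
    tpe p x - stable_mean al ka p.
Proof.
move=> p0; rewrite dsteinE// mulrN.
rewrite /half_generator (_ : (fun u => _) = (fun u => \sum_(t <- p)
    t.1 * ((cp * (stein_wave al ka t.2.1 t.2.2 (x + u) - stein_wave al ka t.2.1 t.2.2 x) +
     cm * (stein_wave al ka t.2.1 t.2.2 (x - u) - stein_wave al ka t.2.1 t.2.2 x))
     * u `^ (- 1 - al)))); last first.
  apply/funext => u; rewrite /stein -!sumrB !mulr_sumr -big_split/= mulr_suml.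
  by apply: eq_bigr => t _; ring.
have I : {in p, forall t, mu.-integrable `]0, +oo[ (EFin \o (fun u => t.1 *
    ((cp * (stein_wave al ka t.2.1 t.2.2 (x + u) - stein_wave al ka t.2.1 t.2.2 x) +
     cm * (stein_wave al ka t.2.1 t.2.2 (x - u) - stein_wave al ka t.2.1 t.2.2 x))
     * u `^ (- 1 - al))))}.
  by move=> t tp; apply: integrableZl1 => //; exact: half_generator_wave_integrable (p0 _ tp).
rewrite Rintegral_seq_sum// /tpe /stable_mean -sumrB.
rewrite (_ : al^-1 * - (x * _) = \sum_(t <- p) - (al^-1 * x * (t.1 * \int[mu]_(rho in `]0, 1[)
  (rho `^ (al^-1 - 1) * (t.2.1 * wav t.2.1 (t.2.2 + pi / 2) rho x))))); last first.
  by rewrite sumrN -mulr_sumr; ring.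
rewrite -sumrB !big_seq; apply: eq_bigr => t tp.
have := stein_wave_equation t.2.2 x (p0 _ tp); rewrite -mulrBr => <-.
rewrite RintegralZl//; last exact: half_generator_wave_integrable (p0 _ tp).
by rewrite /half_generator; ring.
Qed.

End stein_equation.

(** * Estimates of f_p and of its derivative *)

Section kernel_integrals.
Context {R : realType}.
Notation mu := (@lebesgue_measure R).

(* [(1 + s / tau) `^ (- q)] is comparable to [min 1 (s / tau) `^ (- q)] and has an explicit primitive. *)
Lemma le_min_kernel (A M q s tau : R) : 0 < q -> 0 < s -> 0 < tau -> 0 <= M ->
  A <= M -> A <= M * (s / tau) `^ (- q) -> A <= M * 2 `^ q * (1 + s / tau) `^ (- q).
Proof.
move=> q0 s0 t0 M0 A1 A2; have st0 : 0 < s / tau by rewrite divr_gt0.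
have mono (a b : R) : 0 < a -> a <= b -> b `^ (- q) <= a `^ (- q).
  move=> a0 ab; have b0 := lt_le_trans a0 ab.
  by rewrite !powRN lef_pV2 ?posrE ?powR_gt0// ge0_ler_powR ?nnegrE ?(ltW q0) ?(ltW a0) ?(ltW b0).
have p2 : 2 `^ q * 2 `^ (- q) = 1 :> R by rewrite -powRDp// subrr powRr0.
have [st1|/ltW st1] := leP (s / tau) 1.
  apply: (le_trans A1); rewrite -[leLHS]mulr1 -[X in _ * X <= _]p2 -mulrA ler_wpM2l// ler_wpM2l ?powR_ge0//.
  by apply: mono; [rewrite addr_gt0|rewrite -[leRHS]/(1 + 1) lerD2l].
apply: (le_trans A2); rewrite -mulrA ler_wpM2l//.
apply: (@le_trans _ _ (2 `^ q * (2 * (s / tau)) `^ (- q))).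
  by rewrite (powRM (- q) (ler0n R 2) (ltW st0)) mulrA p2 mul1r.
rewrite ler_wpM2l ?powR_ge0//; apply: mono; first by rewrite addr_gt0.
by rewrite mulr_natl mulr2n lerD2r.
Qed.

Section kernel.
Variable tau : R.
Hypothesis tau0 : 0 < tau.
Let k0 (rho : R) : rho <= 1 -> 0 < 1 + (1 - rho) / tau.
Proof. by move=> r1; rewrite ltr_pwDl// divr_ge0 ?subr_ge0// ltW. Qed.

Lemma kernel_integral_aux (f F : R -> R) :
  (forall rho : R, 0 <= rho <= 1 -> is_derive rho (1 : R) F (f rho)) ->
  (forall rho : R, 0 <= rho <= 1 -> {for rho, continuous f}) ->
  (forall rho : R, 0 <= rho <= 1 -> 0 <= f rho) ->
  \int[mu]_(rho in `]0, 1[) f rho = F 1 - F 0 /\ mu.-integrable `]0, 1[ (EFin \o f).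
Proof.
move=> dF cF f0.
have le01 (r : R) : 0 < r < 1 -> 0 <= r <= 1 by move=> /andP[a b]; rewrite !ltW.
have F1 : F rho @[rho --> 1^'-] --> F 1.
  by apply: cvg_at_left_filter; apply: is_derive1_cont (dF 1 _); rewrite lexx ler01.
have F0 : F rho @[rho --> 0^'+] --> F 0.
  by apply: cvg_at_right_filter; apply: is_derive1_cont (dF 0 _); rewrite lexx ler01.
have [h1 h2] := ge0_ftc_itv01 (fun r h => dF r (le01 r h)) (fun r h => cF r (le01 r h)) F0 F1
  (fun r h => f0 r (le01 r h)).
by split => //; rewrite /Rintegral h1.
Qed.

Lemma kernel_integral q : 1 < q ->
  \int[mu]_(rho in `]0, 1[) (1 + (1 - rho) / tau) `^ (- q) <= tau / (q - 1) /\
  mu.-integrable `]0, 1[ (EFin \o (fun rho => (1 + (1 - rho) / tau) `^ (- q))).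
Proof.
move=> q1; have q10 : 0 < q - 1 by rewrite subr_gt0.
have [| |rho _|-> h] := @kernel_integral_aux (fun rho => (1 + (1 - rho) / tau) `^ (- q))
  (fun rho => (tau / (q - 1)) * (1 + (1 - rho) / tau) `^ (1 - q)).
- move=> rho /andP[_ r1]; der_eq; first exact: k0.
  rewrite (_ : 1 - q - 1 = - q); last by ring.
  by move: (_ `^ (- q)) => P; field; rewrite !gt_eqF.
- by move=> rho /andP[_ r1]; der_cont; exact: k0.
- exact: powR_ge0.
split=> //; rewrite subrr mul0r addr0 powR1 mulr1.
by rewrite gerBl mulr_ge0 ?powR_ge0// divr_ge0 ?(ltW tau0) ?(ltW q10).
Qed.

(** The borderline exponent: the primitive is a logarithm, and ln (1 + tau) <= tau <= 1 simplifies
    it. *)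
Lemma kernel_integral1 : tau <= 1 ->
  \int[mu]_(rho in `]0, 1[) (1 + (1 - rho) / tau) `^ (- 1) <= tau * (1 - ln tau) /\
  mu.-integrable `]0, 1[ (EFin \o (fun rho => (1 + (1 - rho) / tau) `^ (- 1))).
Proof.
move=> t1.
have [| |rho _|-> h] := @kernel_integral_aux (fun rho => (1 + (1 - rho) / tau) `^ (- 1))
  (fun rho => - (tau * ln (1 + (1 - rho) / tau))).
- move=> rho /andP[_ r1]; der_eq; first exact: k0.
  rewrite powR_inv1 ?(ltW (k0 r1))//; have := k0 r1; move: (1 + _) => P P0.
  by field; rewrite !gt_eqF.
- by move=> rho /andP[_ r1]; der_cont; exact: k0.
- exact: powR_ge0.
split=> //; rewrite (_ : _ - _ = tau * ln (1 + 1 / tau)); last first.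
  by rewrite subrr mul0r addr0 ln1 subr0; ring.
rewrite ler_wpM2l ?(ltW tau0)//.
rewrite (_ : 1 + 1 / tau = (1 + tau) / tau); last by field; rewrite gt_eqF.
rewrite ln_div ?posrE ?addr_gt0// lerD2r.
by apply: (le_trans (le_ln1Dx _)) => //; rewrite (lt_trans _ tau0)// oppr_lt0.
Qed.

End kernel.
End kernel_integrals.

Section stein_estimates.
Context {R : realType}.
Notation mu := (@lebesgue_measure R).
Variables (al ka CS : R).
Hypotheses (al0 : 0 < al) (al1 : al <= 1) (CS0 : 0 < CS).
Hypothesis mean_bound : forall p M, tpos p -> (forall x, `|tpe p x| <= M) ->
  `|stable_mean al ka p| <= M.
Hypothesis smoothing : forall p M, tpos p -> (forall x, `|tpe p x| <= M) ->
  `|\sum_(t <- p) t.1 * t.2.1 * (expR (- t.2.1 `^ al) * sin (t.2.2 + ka * t.2.1 `^ al))|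
     <= CS * M.
Let al0i : 0 < al^-1. Proof. by rewrite invr_gt0. Qed.
Let al1i : 1 <= al^-1. Proof. by rewrite invf_ge1. Qed.
Notation sgp := (semigroup al ka).
Variable p : @tpoly R.
Hypothesis p0 : tpos p.
Implicit Types x y r rho : R.

(** The s-Hoelder modulus is contracted by rho^(s/al), and al / s is the integral of rho^(s/al - 1).
    Taking s = beta and s = 1 gives both parts of estimate a. *)
Lemma stein_holder s : 0 < s -> (forall x y, `|tpe p x - tpe p y| <= 3 * `|x - y| `^ s) ->
  forall x y, `|stein al ka p x - stein al ka p y| <= 3 * (al / s) * `|x - y| `^ s.
Proof.
move=> s0 ps x y; rewrite steinB// normrN.
have mf : measurable_fun setT (fun rho => rho `^ (-1) * (sgp p rho x - sgp p rho y)).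
  by mfun; exact: semigroup_measurable.
have sa0 : 0 < s / al by rewrite divr_gt0.
have h1 : -1 < s / al - 1 by rewrite ltrBDr addrC subrr.
rewrite (_ : _ * (al / s) * _ = 3 * `|x - y| `^ s * (s / al - 1 + 1)^-1); last first.
  by rewrite subrK invf_div; ring.
apply: dom01_le => // rho r01; have /andP[r0 r1] := r01.
rewrite normrM ger0_norm ?powR_ge0// (addrC (s / al)) powRDp// mulrCA ler_wpM2l ?powR_ge0//.
have := semigroup_modulus (w := fun r => 3 * r `^ s) al0 mean_bound x y p0 ps r01.
rewrite powRM ?powR_ge0// -powRrM (mulrC al^-1) => /le_trans; apply.
by rewrite le_eqVlt; apply/orP; left; apply/eqP; ring.
Qed.

Hypothesis pL : forall x y, `|tpe p x - tpe p y| <= 3 * `|x - y|.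

Lemma stein_lipschitz x y : `|stein al ka p x - stein al ka p y| <= 3 * al * `|x - y|.
Proof.
have := @stein_holder 1 ltr01 _ x y; rewrite powRr1// divr1; apply.
by move=> a b; rewrite powRr1.
Qed.

(** A derivative is bounded by the Lipschitz constant; no estimate of the integral defining [dstein]
    is needed. *)
Lemma dstein_bound x : `|dstein al ka p x| <= 3 * al.
Proof. exact: lipschitz_is_derive_le (is_derive_stein ka al0 al1 x p0) stein_lipschitz. Qed.

Lemma tpe_dlist_bound x : `|tpe (dlist p) x| <= 3.
Proof. exact: lipschitz_is_derive_le (is_derive_tpe p x) pL. Qed.

Let gint x rho := rho `^ (al^-1 - 1) * sgp (dlist p) rho x.

Let gint_measurable x : measurable_fun setT (gint x).
Proof. by rewrite /gint; mfun; exact: semigroup_measurable. Qed.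

Lemma gint_integrable x : mu.-integrable `]0, 1[ (EFin \o gint x).
Proof.
apply: (@dom01_integrable _ _ (al^-1 - 1) 3) => //; first by move: al0i => h; lra.
move=> rho r01; rewrite normrM ger0_norm ?powR_ge0// mulrC ler_wpM2r ?powR_ge0//.
exact: (semigroup_bound al0 mean_bound _ (tpos_dlist p0) tpe_dlist_bound r01).
Qed.

Lemma dstein_diff_le (g : R -> R) x y : mu.-integrable `]0, 1[ (EFin \o g) ->
  (forall rho, 0 < rho < 1 -> `|sgp (dlist p) rho x - sgp (dlist p) rho y| <= g rho) ->
  `|dstein al ka p x - dstein al ka p y| <= \int[mu]_(rho in `]0, 1[) g rho.
Proof.
move=> ig le_g; rewrite /dstein -opprD -RintegralB//; [|exact: gint_integrable..].
rewrite normrN; apply: Rintegral_le_norm => //.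
  have := measurable_funD1 (gint_measurable x) (measurable_funN1 (gint_measurable y)).
  exact: measurable_funTS.
move=> rho; rewrite /= in_itv/= => r01; have /andP[r0 r1] := r01.
rewrite /gint -mulrBr normrM ger0_norm ?powR_ge0//; apply: le_trans (le_g _ r01).
by rewrite ler_piMl// powR_le1 ?(ltW r0) ?(ltW r1)// subr_ge0.
Qed.

(** Two bounds are merged: 3 + 3 from the sup norm of p', and smoothing of p', which with tau = |x -
    y|^al reads 3 CS ((1 - rho) / tau)^(- 1/al). *)
Lemma semigroup_dlist_diff rho x y : 0 < rho < 1 -> x != y ->
  `|sgp (dlist p) rho x - sgp (dlist p) rho y| <=
  (6 + 3 * CS) * 2 `^ al^-1 * (1 + (1 - rho) / `|x - y| `^ al) `^ (- al^-1).
Proof.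
move=> r01 xy; have /andP[r0 r1] := r01.
have r_gt0 : 0 < `|x - y| by rewrite normr_gt0 subr_eq0.
have CS3 : 0 < 3 * CS by rewrite mulr_gt0.
have M0 : 0 <= 6 + 3 * CS by lra.
apply: le_min_kernel => //; [by rewrite subr_gt0|by rewrite powR_gt0|..].
  have b z := semigroup_bound al0 mean_bound z (tpos_dlist p0) tpe_dlist_bound r01.
  rewrite (le_trans (ler_normB _ _))//; have := b x; have := b y; lra.
have := semigroup_smoothing al0 smoothing x y (tpos_dlist p0) tpe_dlist_bound r01.
move=> /le_trans; apply.
rewrite powRM ?subr_ge0 ?(ltW r1) ?invr_ge0 ?powR_ge0//.
have -> : (`|x - y| `^ al)^-1 `^ (- al^-1) = `|x - y|.
  by rewrite -powRN -powRrM mulrNN mulfV ?gt_eqF// powRr1.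
rewrite mulrA ler_wpM2r// ler_wpM2r ?powR_ge0//; lra.
Qed.

(** For al < 1 the kernel exponent 1/al exceeds 1, so its integral is linear in tau = |x - y|^al. *)
Lemma dstein_holder x y : al < 1 -> `|dstein al ka p x - dstein al ka p y| <=
  (6 + 3 * CS) * 2 `^ al^-1 / (al^-1 - 1) * `|x - y| `^ al.
Proof.
move=> a1; have [->|xy] := eqVneq x y.
  by rewrite !subrr normr0 powR0 ?gt_eqF// mulr0.
have r_gt0 : 0 < `|x - y| `^ al by rewrite powR_gt0// normr_gt0 subr_eq0.
have ai1 : 1 < al^-1 by rewrite invf_gt1.
have [I ig] := kernel_integral r_gt0 ai1.
have M0 : 0 <= (6 + 3 * CS) * 2 `^ al^-1.
  by rewrite mulr_ge0 ?powR_ge0//; move: CS0 => h; lra.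
apply: (le_trans (dstein_diff_le (integrableZl1 _ _ ig) (fun rho r01 => semigroup_dlist_diff r01 xy))) => //.
by rewrite RintegralZl// -[leRHS]mulrA ler_wpM2l// (le_trans I)// mulrC.
Qed.

(** For al = 1 the kernel exponent is exactly 1, and the integral produces the logarithm. *)
Lemma dstein_loglip x y : al = 1 -> x != y -> `|x - y| <= 1 ->
  `|dstein al ka p x - dstein al ka p y| <= (6 + 3 * CS) * 2 * (`|x - y| * (1 - ln `|x - y|)).
Proof.
move=> a1 xy xy1.
have r_gt0 : 0 < `|x - y| by rewrite normr_gt0 subr_eq0.
have [I ig] := kernel_integral1 r_gt0 xy1.
have M0 : 0 <= (6 + 3 * CS) * 2 by rewrite mulr_ge0//; move: CS0 => h; lra.
have le_k rho : 0 < rho < 1 -> `|sgp (dlist p) rho x - sgp (dlist p) rho y| <=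
    (6 + 3 * CS) * 2 * (1 + (1 - rho) / `|x - y|) `^ (- 1).
  by move=> r01; have := semigroup_dlist_diff r01 xy; rewrite a1 invr1 !powRr1.
apply: (le_trans (dstein_diff_le (integrableZl1 _ _ ig) le_k)) => //.
by rewrite RintegralZl// ler_wpM2l.
Qed.

End stein_estimates.

(** * The Zygmund estimate for al = 1 *)

Section second_difference.
Context {R : realType}.

Lemma second_difference_le (g dg d2g : R -> R) (B x u : R) : 0 <= u ->
  (forall z, is_derive z (1 : R) g (dg z)) -> (forall z, is_derive z (1 : R) dg (d2g z)) ->
  (forall z, `|d2g z| <= B) -> `|g (x + u) + g (x - u) - 2 * g x| <= B * u ^+ 2.
Proof.
move=> u0 dgE d2gE d2B.
have shift z : is_derive z (1 : R) (fun t => g (t + u)) (dg (z + u)).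
  notypeclasses refine (is_derive_eq1 _ _).
    notypeclasses refine (@is_derive_comp1 _ _ _ _ _ _ (dgE _) _); der.
  by ring.
have dpsi z : is_derive z (1 : R) (fun t => g (t + u) - g t) (dg (z + u) - dg z).
  exact: (is_deriveD1 (shift z) (is_deriveN1 (dgE z))).
have := is_derive_lipschitz dpsi (C := B * u) _ x (x - u).
rewrite (_ : x - (x - u) = u); last by ring.
rewrite (_ : x - u + u = x); last by ring.
rewrite (_ : g (x + u) - g x - _ = g (x + u) + g (x - u) - 2 * g x); last by ring.
rewrite (ger0_norm u0) -mulrA -expr2; apply=> z.
have := is_derive_lipschitz d2gE d2B (z + u) z.
by rewrite (_ : z + u - z = u) ?(ger0_norm u0)//; ring.
Qed.

End second_difference.

Section zygmund.
Context {R : realType}.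
Notation mu := (@lebesgue_measure R).
Variable CS : R.
Hypothesis CS0 : 0 < CS.
Hypothesis mean_bound : forall (p : @tpoly R) (M : R), tpos p -> (forall x : R, `|tpe p x| <= M) ->
  `|stable_mean (1 : R) 0 p| <= M.
Hypothesis smoothing : forall (p : @tpoly R) (M : R), tpos p -> (forall x : R, `|tpe p x| <= M) ->
  `|\sum_(t <- p) t.1 * t.2.1 * (expR (- t.2.1 `^ 1) * sin (t.2.2 + 0 * t.2.1 `^ 1))|
     <= CS * M.
Notation sgp := (semigroup (1 : R) 0).
Implicit Types (p : @tpoly R) (x y u rho : R).

(* [e^(-(1-rho)l)] is split into two factors [e^(-(1-rho)l/2)], each paying for one derivative. *)
Lemma semigroup_dlist2_bound p M rho x : tpos p -> (forall x, `|tpe p x| <= M) -> 0 < rho < 1 ->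
  `|sgp (dlist (dlist p)) rho x| <= 4 * CS ^+ 2 * M * (1 - rho) `^ (- 2).
Proof.
move=> p0 pM r01; have /andP[r0 r1] := r01.
(* 1 - rh is half of 1 - rho, so damping with parameter [rh] can be applied twice. *)
pose rh := (1 + rho) / 2.
have rh01 : 0 < rh < 1 by rewrite /rh; apply/andP; split; lra.
have rhn0 : rh != 0 by rewrite gt_eqF//; case/andP: rh01.
have rhE : 1 - rh = (1 - rho) / 2 by rewrite /rh; lra.
have s0 : 0 < (1 - rho) / 2 by lra.
(* p damped once. Its derivative is V_(p') at [rh] up to a dilation of x, hence already bounded by
   the sup norm of p; a second smoothing acts on this derivative. *)
pose h : tpoly := [seq (t.1 * expR (- ((1 - rh) * t.2.1)), t.2) | t <- p].
have h0 : tpos h by move=> t /mapP[t' tp ->]/=; exact: p0.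
have hE y : tpe (dlist h) y = sgp (dlist p) rh (y / rh).
  rewrite /tpe /semigroup /h !big_map !big_seq; apply: eq_bigr => t tp/=; rewrite /wave.
  rewrite invr1 !powRr1 ?(p0 _ tp) ?(ltW (proj1 (andP rh01)))// mul0r addr0.
  rewrite (_ : t.2.1 * rh * (y / rh) = t.2.1 * y); last by field.
  by ring.
have hM y : `|tpe (dlist h) y| <= CS * M * (1 - rh)^-1.
  rewrite hE; have := semigroup_dlist_bound ltr01 smoothing (y / rh) p0 pM rh01.
  by rewrite invr1 powR_inv1// rhE ltW.
have := semigroup_dlist_bound ltr01 smoothing (rho / rh * x) (tpos_dlist h0) hM rh01.
rewrite [X in `|X|](_ : _ = sgp (dlist (dlist p)) rho x); last first.
  rewrite /semigroup /h !big_map !big_seq; apply: eq_bigr => t tp/=; rewrite /wave.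
  rewrite invr1 !powRr1 ?(p0 _ tp) ?(ltW r0) ?(ltW (proj1 (andP rh01)))// !mul0r !addr0.
  rewrite (_ : t.2.1 * rh * (rho / rh * x) = t.2.1 * rho * x); last by field.
  rewrite (_ : (1 - rho) * t.2.1 = (1 - rh) * t.2.1 + (1 - rh) * t.2.1); last by rewrite rhE; field.
  by rewrite opprD expRD; ring.
move=> /le_trans; apply; rewrite le_eqVlt; apply/orP; left; apply/eqP.
rewrite invr1 powR_inv1 rhE ?(ltW s0)// powRN powR_mulrn ?subr_ge0 ?(ltW r1)//.
by field; rewrite subr_eq0 gt_eqF.
Qed.

(** Second differences of V_(p') are bounded by 12 (four values of size 3) and by 12 CS^2 (u / (1 -
    rho))^2 (two further derivatives). The kernel exponent is 2 instead of 1, so the integral is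
    linear in u, without logarithm. *)
Lemma dstein_zygmund p x u : tpos p -> (forall x y, `|tpe p x - tpe p y| <= 3 * `|x - y|) ->
  0 < u ->
  `|dstein 1 0 p (x + u) + dstein 1 0 p (x - u) - 2 * dstein 1 0 p x|
    <= (12 + 12 * CS ^+ 2) * 4 * u.
Proof.
move=> p0 pL u0.
have dpM := tpe_dlist_bound pL.
have CS20 : 0 <= 12 * CS ^+ 2 by rewrite mulr_ge0// sqr_ge0.
have M0 : 0 <= 12 + 12 * CS ^+ 2 by lra.
have [I ig] := kernel_integral u0 (ltr1n R 2).
pose gi z rho := rho `^ ((1 : R)^-1 - 1) * sgp (dlist p) rho z.
have ii z : mu.-integrable `]0, 1[ (EFin \o gi z).
  exact: (@gint_integrable R 1 0 ltr01 mean_bound p p0 pL z).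
have dE : dstein 1 0 p (x + u) + dstein 1 0 p (x - u) - 2 * dstein 1 0 p x =
    - \int[mu]_(rho in `]0, 1[) (gi (x + u) rho + gi (x - u) rho - 2 * gi x rho).
  rewrite RintegralB//; last 2 first.
  - by apply: integrableD1.
  - by apply: integrableZl1.
  rewrite RintegralD// RintegralZl// /dstein -/(gi (x + u)) /gi; ring.
rewrite dE normrN.
have := @Rintegral_le_norm _ _ _ mu `]0, 1[
  (fun rho => gi (x + u) rho + gi (x - u) rho - 2 * gi x rho)
  (fun rho => (12 + 12 * CS ^+ 2) * 4 * (1 + (1 - rho) / u) `^ (- 2)).
move=> /(_ _ _ _ _)/le_trans; apply => //.
- have mg z : measurable_fun setT (gi z) by rewrite /gi; mfun; exact: semigroup_measurable.
  have m2 : measurable_fun setT (fun rho => 2 * gi x rho).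
    by apply: measurable_funM1; [exact: measurable_cst|exact: mg].
  have := measurable_funD1 (measurable_funD1 (mg (x + u)) (mg (x - u))) (measurable_funN1 m2).
  exact: measurable_funTS.
- exact: integrableZl1.
- move=> rho; rewrite /= in_itv/= => r01; have /andP[r0 r1] := r01.
  rewrite /gi invr1 subrr powRr0 !mul1r (_ : 4 = 2 `^ 2); last by rewrite powR_mulrn// -natrX.
  apply: le_min_kernel => //; first by rewrite subr_gt0.
    have b z := semigroup_bound ltr01 mean_bound z (tpos_dlist p0) dpM r01.
    have := b (x + u); have := b (x - u); have := b x; rewrite !ler_norml.
    by move=> /andP[? ?] /andP[? ?] /andP[? ?]; apply/andP; split; lra.
  have B z : `|rho `^ 1^-1 * (rho `^ 1^-1 * sgp (dlist (dlist (dlist p))) rho z)| <=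
      4 * CS ^+ 2 * 3 * (1 - rho) `^ (- 2).
    have rr : 0 <= rho `^ 1^-1 <= 1 by rewrite powR_ge0 invr1 powRr1 ?(ltW r0) ?(ltW r1).
    have /andP[rr0 rr1] := rr.
    rewrite !normrM !(ger0_norm rr0).
    apply: le_trans (semigroup_dlist2_bound z (tpos_dlist p0) dpM r01).
    by rewrite mulrA ler_piMl// -[leRHS]mulr1 ler_pM.
  have d2 z : is_derive z (1 : R) (fun z => rho `^ 1^-1 * sgp (dlist (dlist p)) rho z)
      (rho `^ 1^-1 * (rho `^ 1^-1 * sgp (dlist (dlist (dlist p))) rho z)).
    notypeclasses refine (is_derive_eq1 _ _).
      exact: (is_deriveM1 (is_derive_cst1 _ _) (is_derive_semigroup _ _ _ _ _)).
    by cbv beta; ring.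
  have := second_difference_le x (ltW u0) (is_derive_semigroup 1 0 (dlist p) rho) d2 B.
  move=> /le_trans; apply.
  rewrite powRM ?subr_ge0 ?(ltW r1) ?invr_ge0 ?(ltW u0)//.
  rewrite (_ : u^-1 `^ (- 2) = u ^+ 2); last first.
    by rewrite powRN powR_mulrn ?invr_ge0 ?(ltW u0)// exprVn invrK.
  rewrite (_ : _ * u ^+ 2 = 12 * CS ^+ 2 * ((1 - rho) `^ (- 2) * u ^+ 2)); last by ring.
  by apply: ler_wpM2r; [rewrite mulr_ge0 ?powR_ge0 ?sqr_ge0|rewrite lerDr].
- rewrite RintegralZl//; apply: ler_wpM2l; first by rewrite mulr_ge0.
  by move: I; rewrite (_ : (2 : R) - 1 = 1) ?divr1//; ring.
Qed.

End zygmund.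

(** * Bounds on the generator for al < 1 *)

Section half_generator_stable.
Context {R : realType}.
Notation mu := (@lebesgue_measure R).
Variables (al b cp cm D H : R) (f df : R -> R).
Hypotheses (al01 : 0 < al < 1) (b0a : 0 < b < al).
Hypothesis fdf : forall x, is_derive x (1 : R) f (df x).
Hypothesis f_lip : forall x y, `|f x - f y| <= D * `|x - y|.
Hypothesis f_holder : forall x y, `|f x - f y| <= D * `|x - y| `^ b.
Hypothesis df_holder : forall x y, `|df x - df y| <= H * `|x - y| `^ al.
Implicit Types x y u : R.

Let al0 : 0 < al. Proof. by case/andP: al01. Qed.
Let al1 : al < 1. Proof. by case/andP: al01. Qed.
Let D0 : 0 <= D.
Proof. by have := f_lip 1 0; rewrite subr0 normr1 mulr1; apply: le_trans. Qed.
Let H0 : 0 <= H.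
Proof. by have := df_holder 1 0; rewrite subr0 normr1 powR1 mulr1; apply: le_trans. Qed.
Let cf : continuous f. Proof. by move=> x; exact: is_derive1_cont (fdf x). Qed.
Let m := `|cp| + `|cm|.
Let m0 : 0 <= m. Proof. by rewrite addr_ge0. Qed.

Let gen x u := (cp * (f (x + u) - f x) + cm * (f (x - u) - f x)) * u `^ (- 1 - al).

Let gen_measurable x : measurable_fun setT (gen x).
Proof.
rewrite /gen; mfun; apply: measurable_fun_cont => //; mfun.
Qed.

Let combine (a c e : R) : `|a| <= e -> `|c| <= e -> `|cp * a + cm * c| <= m * e.
Proof.
move=> ae ce; rewrite (le_trans (ler_normD _ _))// !normrM /m mulrDl.
by rewrite lerD// ler_wpM2l.
Qed.

Let combineM (a c e q u : R) : `|a| <= e * u `^ q -> `|c| <= e * u `^ q -> 0 < u ->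
  `|(cp * a + cm * c) * u `^ (- 1 - al)| <= m * e * u `^ (q + (- 1 - al)).
Proof.
move=> ae ce u0; rewrite normrM (ger0_norm (powR_ge0 _ _)) powRDp// mulrA.
by rewrite ler_wpM2r ?powR_ge0// -mulrA combine.
Qed.

Let subx x u : `|x + u - x| = `|u|. Proof. by rewrite addrC addKr. Qed.
Let subNx x u : `|x - u - x| = `|u|. Proof. by rewrite addrC addKr normrN. Qed.

Let gen0 x u : 0 < u <= 1 -> `|gen x u| <= m * D * u `^ (- al).
Proof.
move=> /andP[u0 _]; rewrite (_ : - al = 1 + (- 1 - al)); last by ring.
have B z : `|z - x| = `|u| -> `|f z - f x| <= D * u `^ 1.
  by move=> h; have := f_lip z x; rewrite h (gtr0_norm u0) powRr1// ltW.
by apply: combineM => //; apply: B.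
Qed.

Let gen1 x u : 1 <= u -> `|gen x u| <= m * D * u `^ (b - 1 - al).
Proof.
move=> u1; have u0 : 0 < u by exact: lt_le_trans u1.
rewrite (_ : b - 1 - al = b + (- 1 - al)); last by ring.
have B z : `|z - x| = `|u| -> `|f z - f x| <= D * u `^ b.
  by move=> h; have := f_holder z x; rewrite h (gtr0_norm u0).
by apply: combineM => //; apply: B.
Qed.

Let e1 : -1 < - al. Proof. by rewrite ltrN2. Qed.
Let e2 : b - 1 - al < -1.
Proof. by case/andP: b0a => _ h; lra. Qed.

Let gen_integrable x : mu.-integrable `]0, +oo[ (EFin \o gen x).
Proof. exact: (dom0y_integrable (gen_measurable x) e1 e2 (@gen0 x) (@gen1 x)). Qed.

(** The value of [dom0y_le] for the exponents - al (Lipschitz bound, u <= 1) and b - 1 - al (Hoelder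
    bound, u >= 1). *)
Definition half_generator_bound : R := m * D * (4 * ((1 - al)^-1 + (al - b)^-1)).

Lemma half_generator_le x : `|half_generator al cp cm f x| <= half_generator_bound.
Proof.
have := dom0y_le (gen_measurable x) e1 e2 (@gen0 x) (@gen1 x).
rewrite (_ : - al + 1 = 1 - al); last by ring.
by rewrite (_ : - _ - 1 = al - b)//; ring.
Qed.

Section holder.
Variable g : R.
Hypothesis g01 : 0 < g < 1.
Let g0 : 0 < g. Proof. by case/andP: g01. Qed.
Let g1 : g < 1. Proof. by case/andP: g01. Qed.
(** A gain of u^eta is needed, since the plain bound u^al u^(- 1 - al) = 1/u is not integrable at 0.
    It is paid for by the exponent of r = |x - y|: eta <= 1 - al permits the interpolation, and eta
    <= 1 - g leaves at least r^g. *)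
Let eta := (1 - g) * (1 - al).
Let eta0 : 0 < eta. Proof. by rewrite mulr_gt0 ?subr_gt0. Qed.
Let eta_al : eta <= 1 - al.
Proof. by rewrite ler_piMl ?subr_ge0 ?(ltW al1)// lerBlDr lerDl ltW. Qed.
Let eta_g : eta <= 1 - g.
Proof. by rewrite ler_piMr ?subr_ge0 ?(ltW g1)// lerBlDr lerDl ltW. Qed.

Let diff1 x y v : `|f (x + v) - f x - (f (y + v) - f y)| <= H * `|v| `^ al * `|x - y|.
Proof.
have dpsi z : is_derive z (1 : R) (fun t => f (t + v) - f t) (df (z + v) - df z).
  notypeclasses refine (is_derive_eq1 _ _).
    notypeclasses refine (is_deriveD1 _ (is_deriveN1 (fdf z))).
    by notypeclasses refine (@is_derive_comp1 _ _ _ _ _ _ (fdf _) _); der.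
  by cbv beta; ring.
have := is_derive_lipschitz dpsi _ x y; apply=> z.
by have := df_holder (z + v) z; rewrite subx.
Qed.

Let diff2 x y v : `|f (x + v) - f x - (f (y + v) - f y)| <= H * `|x - y| `^ al * `|v|.
Proof.
have dphi z : is_derive z (1 : R) (fun t => f (x + t) - f (y + t)) (df (x + z) - df (y + z)).
  notypeclasses refine (is_derive_eq1 _ _).
    notypeclasses refine (is_deriveD1 _ (is_deriveN1 _)).
      by notypeclasses refine (@is_derive_comp1 _ _ _ _ _ _ (fdf _) _); der.
    by notypeclasses refine (@is_derive_comp1 _ _ _ _ _ _ (fdf _) _); der.
  by cbv beta; ring.
have := is_derive_lipschitz dphi (C := H * `|x - y| `^ al) _ v 0.
rewrite subr0 !addr0 (_ : _ - _ - (f x - f y) = f (x + v) - f x - (f (y + v) - f y)); last by ring.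
apply=> z; have := df_holder (x + z) (y + z).
by rewrite (_ : x + z - (y + z) = x - y)//; ring.
Qed.

Let diff3 x y v : `|f (x + v) - f x - (f (y + v) - f y)| <= 2 * D * `|x - y|.
Proof.
rewrite (_ : _ - _ = (f (x + v) - f (y + v)) - (f x - f y)); last by ring.
rewrite (le_trans (ler_normB _ _))//.
have h1 := f_lip (x + v) (y + v); have h2 := f_lip x y.
move: h1; rewrite (_ : x + v - (y + v) = x - y); [lra|ring].
Qed.

Let r_pow r : 0 < r <= 1 -> r `^ (1 - eta) <= r `^ g.
Proof.
move=> /andP[r0 r1]; rewrite (_ : 1 - eta = g + (1 - eta - g)); last by ring.
rewrite powRDp// ler_piMr ?powR_ge0// powR_le1 ?(ltW r0)//.
by move: eta_g => h; lra.
Qed.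

(** The double difference of f is at most H r^al u and at most H u^al r; the smaller of the two is
    below H r^(1 - eta) u^(al + eta), the first for u <= r and the second for u >= r. *)
Let diff0 x y u v : 0 < `|x - y| <= 1 -> 0 < u -> `|v| = u ->
  `|f (x + v) - f x - (f (y + v) - f y)| <= H * `|x - y| `^ g * u `^ (al + eta).
Proof.
move=> r01 u0 vu; set r := `|x - y| in r01 *; have /andP[r0 r1] := r01.
apply: (@le_trans _ _ (H * r `^ (1 - eta) * u `^ (al + eta))); last first.
  by rewrite ler_wpM2r ?powR_ge0// ler_wpM2l// r_pow.
have lepow (c a1 a2 : R) : 0 <= c -> 0 < a1 -> a1 <= a2 -> a1 `^ c <= a2 `^ c.
  by move=> c0 a10 a12; rewrite ge0_ler_powR// nnegrE ltW// (lt_le_trans a10).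
have [ur|/ltW ru] := leP u r.
  apply: (le_trans (diff2 x y v)); rewrite -/r vu -!mulrA ler_wpM2l//.
  rewrite (_ : 1 - eta = al + (1 - eta - al)); last by ring.
  rewrite powRDp// -mulrA ler_wpM2l ?powR_ge0//.
  rewrite -{1}(@powRr1 _ u) ?(ltW u0)// [in u `^ 1](_ : 1 = (1 - eta - al) + (al + eta)); last by ring.
  rewrite (@powRDp _ u (1 - eta - al) (al + eta) u0) ler_wpM2r ?powR_ge0// lepow//.
  by move: eta_al => h; lra.
apply: (le_trans (diff1 x y v)); rewrite -/r vu -!mulrA ler_wpM2l//.
rewrite (@powRDp _ u al eta u0) [leRHS]mulrCA ler_wpM2l ?powR_ge0//.
rewrite -{1}(@powRr1 _ r) ?(ltW r0)// [in r `^ 1](_ : 1 = (1 - eta) + eta); last by ring.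
by rewrite (@powRDp _ r (1 - eta) eta r0) ler_wpM2l ?powR_ge0// lepow// ltW.
Qed.

Definition half_generator_holder_const : R :=
  2 * half_generator_bound + m * (H + 2 * D) * (4 * (eta^-1 + al^-1)).

Lemma half_generator_holder x y :
  `|half_generator al cp cm f x - half_generator al cp cm f y|
    <= half_generator_holder_const * `|x - y| `^ g.
Proof.
rewrite /half_generator_holder_const mulrDl.
have B0 : 0 <= half_generator_bound by apply: le_trans (half_generator_le 0).
have E0 : 0 <= m * (H + 2 * D) * (4 * (eta^-1 + al^-1)).
  rewrite mulr_ge0//; first by rewrite mulr_ge0// addr_ge0// mulr_ge0.
  by rewrite mulr_ge0// addr_ge0// invr_ge0 ltW.
have [->|xy] := eqVneq x y.
  by rewrite !subrr normr0 powR0 ?gt_eqF// !mulr0 addr0.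
have r0 : 0 < `|x - y| by rewrite normr_gt0 subr_eq0.
(* At distance at least 1 the sup bound at each point suffices, because r^g >= 1. *)
have [r1|/ltW r1] := leP `|x - y| 1; last first.
  rewrite (le_trans (ler_normB _ _))// (@le_trans _ _ (2 * half_generator_bound))//.
    by have := half_generator_le x; have := half_generator_le y; lra.
  apply: (@le_trans _ _ (2 * half_generator_bound * `|x - y| `^ g)).
    by apply: ler_peMr; [rewrite mulr_ge0|apply: powR_ge1 => //; rewrite ltW].
  by rewrite lerDl; apply: mulr_ge0 => //; exact: powR_ge0.
apply: (@le_trans _ _ (m * (H + 2 * D) * (4 * (eta^-1 + al^-1)) * `|x - y| `^ g)); last first.
  by rewrite lerDr; apply: mulr_ge0; [rewrite mulr_ge0|exact: powR_ge0].
rewrite /half_generator -RintegralB//; [|exact: gen_integrable..].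
have m1 : measurable_fun setT (fun u => gen x u - gen y u).
  exact: measurable_funD1 (gen_measurable x) (measurable_funN1 (gen_measurable y)).
have p1 : -1 < eta - 1 by move: eta0 => h; lra.
have p2 : - 1 - al < -1 by move: al0 => h; lra.
have genB u : gen x u - gen y u = (cp * (f (x + u) - f x - (f (y + u) - f y)) +
    cm * (f (x - u) - f x - (f (y - u) - f y))) * u `^ (- 1 - al).
  by rewrite /gen; ring.
have HD1 : 0 <= H + 2 * D by rewrite addr_ge0// mulr_ge0.
have := dom0y_le (C := m * ((H + 2 * D) * `|x - y| `^ g)) m1 p1 p2.
rewrite (_ : eta - 1 + 1 = eta); last by ring.
rewrite (_ : - (-1 - al) - 1 = al); last by ring.
rewrite (_ : m * (_ * _) * _ = m * (H + 2 * D) * (4 * (eta^-1 + al^-1)) * `|x - y| `^ g); last by ring.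
apply=> [u /andP[u0 _]|u u1]; rewrite genB.
  rewrite (_ : eta - 1 = al + eta + (- 1 - al)); last by ring.
  have B v : `|v| = u -> `|f (x + v) - f x - (f (y + v) - f y)| <=
      (H + 2 * D) * `|x - y| `^ g * u `^ (al + eta).
    move=> vu; rewrite (le_trans (diff0 _ u0 vu)) ?r0// ler_wpM2r ?powR_ge0//.
    by rewrite ler_wpM2r ?powR_ge0// lerDl mulr_ge0.
  by apply: combineM => //; apply: B; rewrite ?normrN gtr0_norm.
have u0 : 0 < u by exact: lt_le_trans u1.
have B v : `|f (x + v) - f x - (f (y + v) - f y)| <= (H + 2 * D) * `|x - y| `^ g * u `^ 0.
  rewrite (le_trans (diff3 x y v))// powRr0 mulr1.
  rewrite ler_pM ?mulr_ge0// ?lerDr//.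
  rewrite -{1}(@powRr1 _ `|x - y|)// (_ : 1 = g + (1 - g)); last by ring.
  by rewrite powRDp// ler_piMr ?powR_ge0// powR_le1 ?(ltW r0)// subr_ge0 ltW.
by have := combineM (B u) (B (- u)) u0; rewrite add0r.
Qed.

End holder.
End half_generator_stable.

(** * Bounds on the generator for al = 1 *)

Section half_generator_cauchy.
Context {R : realType}.
Notation mu := (@lebesgue_measure R).

Lemma scaled_peak_integral (p r : R) : 0 < p -> 0 < r ->
  \int[mu]_(u in `]0, +oo[) peak p (u / r) = r / p /\
  mu.-integrable `]0, +oo[ (EFin \o (fun u => peak p (u / r))).
Proof.
move=> p0 r0; have pos x : 0 < 1 + x `^ p by rewrite ltr_pwDl// powR_ge0.
have rp0 : 0 < r / p by rewrite divr_gt0.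
have dF (x : R) : 0 < x ->
    is_derive x (1 : R) (fun x => - (r / p) * (1 + (x / r) `^ p)^-1) (peak p (x / r)).
  move=> x0; der_eq; rewrite ?gt_eqF ?divr_gt0//.
  rewrite /peak; move: (_ `^ (p - 1)) (_ `^ p) (pos (x / r)) => P Q Q0.
  by field; rewrite !gt_eqF.
have cF (x : R) : 0 < x -> {for x, continuous (fun x : R => peak p (x / r))}.
  by move=> x0; rewrite /peak; der_cont; rewrite ?divr_gt0// expf_neq0 ?gt_eqF.
have F0 : (- (r / p) * (1 + (x / r) `^ p)^-1) @[x --> 0^'+] --> - (r / p).
  apply: (@cvg0_powR_bound _ _ _ (r / p * r^-1 `^ p) p p0) => x /andP[x0 x1].
  rewrite -mulrA -powRM ?invr_ge0 ?(ltW r0) ?(ltW x0)// (mulrC r^-1).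
  rewrite (_ : _ - _ = r / p * ((x / r) `^ p / (1 + (x / r) `^ p))); last first.
    by have := pos (x / r); move: (_ `^ p) => Q Q0; field; rewrite !gt_eqF.
  rewrite ger0_norm ?mulr_ge0 ?invr_ge0 ?powR_ge0 ?(ltW p0) ?(ltW r0) ?(ltW (pos _))//.
  rewrite ler_wpM2l ?(ltW rp0)// ler_piMr ?powR_ge0//.
  by rewrite invf_le1// lerDl powR_ge0.
have F1 : (- (r / p) * (1 + (x / r) `^ p)^-1) @[x --> +oo] --> (0 : R).
  apply: (@cvgy_powR_bound _ _ _ (r / p * r `^ p) p p0) => x x1.
  have x0 : 0 < x by exact: lt_le_trans x1.
  have rx : 0 < (x / r) `^ p by rewrite powR_gt0 ?divr_gt0.
  rewrite subr0 normrM normrN (gtr0_norm rp0) ger0_norm ?invr_ge0 ?(ltW (pos _))//.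
  rewrite -mulrA ler_wpM2l ?(ltW rp0)//.
  have rE : r^-1 `^ p = (r `^ p)^-1.
    by rewrite -(@powR_inv1 _ r (ltW r0)) -powRrM mulN1r powRN.
  have -> : r `^ p * x `^ (- p) = ((x / r) `^ p)^-1.
    by rewrite powRM ?invr_ge0 ?(ltW r0) ?(ltW x0)// rE invfM invrK powRN mulrC.
  by rewrite lef_pV2 ?posrE// lerDr.
have [h1 h2] := ge0_ftc_itv0y dF cF F0 F1 (fun x _ => peak_ge0 _ _).
by split => //; rewrite /Rintegral h1/= sub0r opprK.
Qed.

(** Partial fractions: ln ((u + r) / (u + 2)) is a primitive, so the integral is ln (2 / r), and ln
    2 <= 1. The kernel is comparable to 1/u between r and 1 and to 1/u^2 beyond. *)
Lemma log_kernel_integral (r : R) : 0 < r -> r <= 1 ->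
  \int[mu]_(u in `]0, +oo[) ((2 - r) * ((u + r)^-1 * (u + 2)^-1)) <= 1 - ln r /\
  mu.-integrable `]0, +oo[ (EFin \o (fun u => (2 - r) * ((u + r)^-1 * (u + 2)^-1))).
Proof.
move=> r0 r1.
have pr (x : R) : 0 <= x -> 0 < x + r by move=> x0; rewrite ltr_wpDl.
have p2 (x : R) : 0 <= x -> 0 < x + 2 by move=> x0; rewrite ltr_wpDl.
pose F (x : R) := ln (x + r) - ln (x + 2).
have dF (x : R) : 0 <= x -> is_derive x (1 : R) F ((2 - r) * ((x + r)^-1 * (x + 2)^-1)).
  move=> x0; rewrite /F; der_eq; [exact: pr|exact: p2|].
  by field; rewrite !gt_eqF ?pr ?p2.
have cF (x : R) : 0 < x -> {for x, continuous (fun u : R => (2 - r) * ((u + r)^-1 * (u + 2)^-1))}.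
  by move=> /ltW x0; der_cont; rewrite gt_eqF ?pr ?p2.
have F0 : F x @[x --> 0^'+] --> F 0.
  by apply: cvg_at_right_filter; exact: is_derive1_cont (dF 0 (lexx _)).
have F1 : F x @[x --> +oo] --> (0 : R).
  apply: (@cvgy_powR_bound _ _ _ 2 1 ltr01) => x x1.
  have x0 : 0 < x by exact: lt_le_trans x1.
  rewrite subr0 /F ler0_norm; last first.
    by rewrite subr_le0 ler_ln ?posrE ?pr ?p2 ?(ltW x0)//; lra.
  rewrite opprB -ln_div ?posrE ?pr ?p2 ?(ltW x0)//.
  rewrite (_ : _ / _ = 1 + (2 - r) / (x + r)); last by field; rewrite gt_eqF ?pr ?(ltW x0).
  apply: (le_trans (le_ln1Dx _)).
    by apply: (@lt_le_trans _ _ 0); rewrite ?oppr_lt0// divr_ge0 ?(ltW (pr _ _)) ?(ltW x0)//; lra.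
  rewrite powR_inv1 ?(ltW x0)// ler_pM ?invr_ge0 ?(ltW (pr _ _)) ?(ltW x0)//; try lra.
  by rewrite lef_pV2 ?posrE ?pr ?(ltW x0)//; lra.
have k0 (x : R) : 0 < x -> 0 <= (2 - r) * ((x + r)^-1 * (x + 2)^-1).
  move=> /ltW x0; rewrite !mulr_ge0 ?invr_ge0 ?(ltW (pr _ _)) ?(ltW (p2 _ _))//; lra.
have [h1 h2] := ge0_ftc_itv0y (fun x x0 => dF x (ltW x0)) cF F0 F1 k0.
split => //; rewrite /Rintegral h1/= sub0r /F !add0r opprB lerD2r.
by have := @le_ln1Dx R 1; rewrite -[1 + 1]/2; apply; lra.
Qed.

(** ln y <= y - 1 at y = z^(-1/2); it trades a logarithm for a power that is still integrable at
    0. *)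
Lemma neg_ln_le (z : R) : 0 < z -> - ln z <= 2 * z `^ (- 2^-1) - 2.
Proof.
move=> z0; have y0 : 0 < z `^ (- 2^-1) by rewrite powR_gt0.
have : ln (z `^ (- 2^-1)) <= z `^ (- 2^-1) - 1.
  have := @le_ln1Dx R (z `^ (- 2^-1) - 1); rewrite (addrC 1) subrK; apply.
  by move: y0; lra.
by rewrite ln_powR; lra.
Qed.

Variables (b c D L Z : R) (f df : R -> R).
Hypothesis b01 : 0 < b < 1.
Hypothesis fdf : forall x, is_derive x (1 : R) f (df x).
Hypothesis f_lip : forall x y, `|f x - f y| <= D * `|x - y|.
Hypothesis f_holder : forall x y, `|f x - f y| <= D * `|x - y| `^ b.
Hypothesis L0 : 0 <= L.
Hypothesis df_loglip : forall x y, x != y -> `|x - y| <= 1 ->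
  `|df x - df y| <= L * (`|x - y| * (1 - ln `|x - y|)).
Hypothesis Z0 : 0 <= Z.
Hypothesis df_zygmund : forall x u, 0 < u -> `|df (x + u) + df (x - u) - 2 * df x| <= Z * u.
Implicit Types x y u r : R.

Let D0 : 0 <= D.
Proof. by have := f_lip 1 0; rewrite subr0 normr1 mulr1; apply: le_trans. Qed.
Let cf : continuous f. Proof. by move=> x; exact: is_derive1_cont (fdf x). Qed.

Let S x u := f (x + u) + f (x - u) - 2 * f x.
Let gen x u := (c * (f (x + u) - f x) + c * (f (x - u) - f x)) * u `^ (- 1 - 1).

Let genE x u : gen x u = c * S x u * u `^ (- 1 - 1).
Proof. by rewrite /gen /S; ring. Qed.

Let gen_measurable x : measurable_fun setT (gen x).
Proof. by rewrite /gen; mfun; apply: measurable_fun_cont => //; mfun. Qed.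

Let dfshift x v z : is_derive z (1 : R) (fun t => f (t + v)) (df (z + v)).
Proof.
notypeclasses refine (is_derive_eq1 _ _).
  by notypeclasses refine (@is_derive_comp1 _ _ _ _ _ _ (fdf _) _); der.
by cbv beta; ring.
Qed.

Let S_loglip x u : 0 < u <= 1 -> `|S x u| <= L * u ^+ 2 * (1 - ln u).
Proof.
move=> /andP[u0 u1].
have dpsi z : is_derive z (1 : R) (fun t => f (t + u) - f t) (df (z + u) - df z).
  exact: (is_deriveD1 (dfshift x u z) (is_deriveN1 (fdf z))).
have := is_derive_lipschitz dpsi (C := L * (u * (1 - ln u))) _ x (x - u).
rewrite (_ : x - (x - u) = u); last by ring.
rewrite (_ : x - u + u = x); last by ring.
rewrite (_ : f (x + u) - f x - _ = S x u); last by rewrite /S; ring.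
rewrite (gtr0_norm u0) (_ : L * (u * (1 - ln u)) * u = L * u ^+ 2 * (1 - ln u)); last by ring.
apply=> z; have := @df_loglip (z + u) z.
rewrite (_ : z + u - z = u); last by ring.
by rewrite (gtr0_norm u0); apply=> //; rewrite -subr_eq0 (_ : _ - _ = u) ?gt_eqF//; ring.
Qed.

(** The derivative of [S x u] in x is the second difference of f', for which the Zygmund bound
    carries no logarithm. *)
Let S_zygmund x y u : 0 < u -> `|S x u - S y u| <= Z * u * `|x - y|.
Proof.
move=> u0; have dS z : is_derive z (1 : R) (fun t => S t u) (df (z + u) + df (z - u) - 2 * df z).
  rewrite /S; notypeclasses refine (is_derive_eq1 _ _).
    exact: (is_deriveD1 (is_deriveD1 (dfshift x u z) (dfshift x (- u) z))
      (is_deriveN1 (is_deriveM1 (is_derive_cst1 _ _) (fdf z)))).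
  by cbv beta; ring.
by apply: (is_derive_lipschitz dS) => z; exact: df_zygmund.
Qed.

Let S_lip x y u : `|S x u - S y u| <= 4 * D * `|x - y|.
Proof.
have h1 := f_lip (x + u) (y + u); have h2 := f_lip (x - u) (y - u); have h3 := f_lip x y.
move: h1; rewrite (_ : x + u - (y + u) = x - y); last by ring.
move: h2; rewrite (_ : x - u - (y - u) = x - y); last by ring.
move: h3; set r := D * `|x - y|; rewrite !ler_norml /S => /andP[? ?] /andP[? ?] /andP[? ?].
rewrite (_ : 4 * D * _ = 4 * r); last by rewrite /r; ring.
by apply/andP; split; lra.
Qed.

Let u2 u : 0 < u -> u `^ (- 1 - 1) = (u ^+ 2)^-1.
Proof.
move=> u0; rewrite (_ : -1 - 1 = - 2); last by ring.
by rewrite powRN powR_mulrn// ltW.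
Qed.

Let gen0 x u : 0 < u <= 1 -> `|gen x u| <= `|c| * (2 * L + 2 * D) * u `^ (- 2^-1).
Proof.
move=> u01; have /andP[u0 u1] := u01; rewrite genE normrM (ger0_norm (powR_ge0 _ _)) normrM.
rewrite -!mulrA ler_wpM2l// u2// ler_pdivrMr ?exprn_gt0//.
apply: (le_trans (S_loglip x u01)).
have h := neg_ln_le u0.
have Lu : 0 <= L * u ^+ 2 by rewrite mulr_ge0// sqr_ge0.
have Du : 0 <= D * u ^+ 2 by rewrite mulr_ge0// sqr_ge0.
have p0 := powR_ge0 u (- 2^-1).
rewrite (_ : (2 * L + 2 * D) * _ * _ = L * u ^+ 2 * (2 * u `^ (- 2^-1)) +
  2 * (D * u ^+ 2) * u `^ (- 2^-1)); last by ring.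
rewrite -[leLHS]addr0; apply: lerD; last by rewrite mulr_ge0// mulr_ge0.
by apply: ler_wpM2l => //; lra.
Qed.

Let gen1 x u : 1 <= u -> `|gen x u| <= `|c| * (2 * L + 2 * D) * u `^ (b - 2).
Proof.
move=> u1; have u0 : 0 < u by exact: lt_le_trans u1.
rewrite genE normrM (ger0_norm (powR_ge0 _ _)) normrM.
rewrite (_ : b - 2 = b + (- 1 - 1)); last by ring.
rewrite powRDp// !mulrA ler_wpM2r ?powR_ge0// -!mulrA ler_wpM2l//.
have h1 := f_holder (x + u) x; have h2 := f_holder (x - u) x.
move: h1; rewrite (_ : x + u - x = u) ?(gtr0_norm u0); last by ring.
move: h2; rewrite (_ : x - u - x = - u) ?normrN ?(gtr0_norm u0); last by ring.
have h3 : 0 <= L * u `^ b by rewrite mulr_ge0// powR_ge0.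
move: h3; rewrite mulrDl -!mulrA; set Lb := L * _; set Db := D * _.
rewrite !ler_norml /S => h3 /andP[? ?] /andP[? ?]; apply/andP; split; lra.
Qed.

Let e1 : -1 < - 2^-1 :> R. Proof. lra. Qed.
Let e2 : b - 2 < -1. Proof. by case/andP: b01 => _ h; lra. Qed.

Let gen_integrable x : mu.-integrable `]0, +oo[ (EFin \o gen x).
Proof. exact: (dom0y_integrable (gen_measurable x) e1 e2 (@gen0 x) (@gen1 x)). Qed.

Definition half_cauchy_bound : R := `|c| * (2 * L + 2 * D) * (4 * (2 + (1 - b)^-1)).

Lemma half_cauchy_le x : `|half_generator 1 c c f x| <= half_cauchy_bound.
Proof.
have := dom0y_le (gen_measurable x) e1 e2 (@gen0 x) (@gen1 x).
rewrite (_ : (- 2^-1 + 1)^-1 = 2); last by field.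
by rewrite (_ : - _ - 1 = 1 - b)//; ring.
Qed.

Definition half_cauchy_loglip_const : R := `|c| * (32 * L + 6 * Z + 24 * D).

(** Three ranges of u with r = |x - y|. For u <= r both second differences are estimated by L u^2 (1
    - ln u). For r < u <= 1 the Zygmund bound gives Z r / u, whose integral is one logarithm; the
    log-Lipschitz bound would leave (1 - ln u) / u and a squared logarithm. For u > 1 the Lipschitz
    bound gives 4 D r / u^2. *)
Lemma half_cauchy_loglip x y : x != y -> `|x - y| <= 1 ->
  `|half_generator 1 c c f x - half_generator 1 c c f y|
    <= half_cauchy_loglip_const * (`|x - y| * (1 - ln `|x - y|)).
Proof.
move=> xy r1; have r0 : 0 < `|x - y| by rewrite normr_gt0 subr_eq0.
rewrite /half_generator -RintegralB//; [|exact: gen_integrable..].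
have m1 : measurable_fun setT (fun u => gen x u - gen y u).
  exact: measurable_funD1 (gen_measurable x) (measurable_funN1 (gen_measurable y)).
set r := `|x - y| in r0 r1 *.
have lr : 1 <= 1 - ln r by rewrite lerBrDr -lerBrDl subrr ln_le0.
have h20 : 0 < 2^-1 :> R by rewrite invr_gt0.
have [I1 i1] := scaled_peak_integral h20 r0.
have [I2 i2] := log_kernel_integral r0 r1.
(* The first summand pays for u <= r, where 1 - ln u <= 2 (1 - ln r) (u / r)^(-1/2); the second,
   with kernel constant 6 = 2 * 3, pays for both other ranges. *)
pose E u := `|c| * (16 * L * (1 - ln r)) * peak 2^-1 (u / r) +
  `|c| * ((6 * Z + 24 * D) * r) * ((2 - r) * ((u + r)^-1 * (u + 2)^-1)).
have iE : mu.-integrable `]0, +oo[ (EFin \o E).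
  by apply: integrableD1 => //; exact: integrableZl1.
apply: (@le_trans _ _ (\int[mu]_(u in `]0, +oo[) E u)); last first.
  have mE : measurable (`]0, +oo[%classic : set (measurableTypeR R)) by [].
  rewrite RintegralD//; do ?[exact: integrableZl1].
  rewrite (eq_RintegralZl (m := mu) mE i1 (fun _ _ => erefl)).
  rewrite (eq_RintegralZl (m := mu) mE i2 (fun _ _ => erefl)).
  rewrite I1 invrK /half_cauchy_loglip_const.
  rewrite (_ : `|c| * (32 * L + 6 * Z + 24 * D) * (r * (1 - ln r)) =
    `|c| * (16 * L * (1 - ln r)) * (r * 2) + `|c| * ((6 * Z + 24 * D) * r) * (1 - ln r)); last by ring.
  rewrite lerD2l ler_wpM2l// mulr_ge0// mulr_ge0 ?(ltW r0)//.
  by rewrite addr_ge0// mulr_ge0.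
apply: Rintegral_le_norm => //; first exact: measurable_funTS.
move=> u; rewrite /= in_itv/= andbT => u0.
rewrite -/(gen x u) -/(gen y u) !genE -mulrBl -mulrBr normrM (ger0_norm (powR_ge0 _ _)) normrM u2// /E.
rewrite -[leLHS]mulrA -2![`|c| * _ * _]mulrA -mulrDr; apply: ler_wpM2l => //.
have pk := peak_ge0 2^-1 (u / r).
have A0 : 0 <= 16 * L * (1 - ln r) * peak 2^-1 (u / r).
  have lr0 : 0 <= 1 - ln r := le_trans ler01 lr.
  by apply: mulr_ge0 => //; rewrite !mulr_ge0.
have q1 : 0 < (u + r)^-1 by rewrite invr_gt0 addr_gt0.
have q2 : 0 < (u + 2)^-1 by rewrite invr_gt0 addr_gt0.
have qq : 0 <= (u + r)^-1 * (u + 2)^-1 by rewrite mulr_ge0 ?(ltW q1) ?(ltW q2).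
have B0 : 0 <= (6 * Z + 24 * D) * r * ((2 - r) * ((u + r)^-1 * (u + 2)^-1)).
  have r20 : 0 <= 2 - r by lra.
  by rewrite !mulr_ge0 ?(ltW r0) ?(ltW q1) ?(ltW q2)// addr_ge0// mulr_ge0.
have qle : (u + r)^-1 * (u + 2)^-1 <= (2 - r) * ((u + r)^-1 * (u + 2)^-1).
  by rewrite ler_peMl//; lra.
have [ur|ru] := leP u r.
  rewrite -[leLHS]addr0; apply: lerD => //.
  have u1 : u <= 1 by rewrite (le_trans ur).
  have u01 : 0 < u <= 1 by rewrite u0.
  have z1 : u / r <= 1 by rewrite ler_pdivrMr// mul1r.
  have z0 : 0 < u / r by rewrite divr_gt0.
  have pz := @le_peak0 R (- 2^-1) (u / r) e1.
  rewrite (_ : - 2^-1 + 1 = 2^-1 :> R) in pz; last by lra.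
  have {}pz := pz _; rewrite z0 z1 in pz; have {}pz := pz isT.
  rewrite ler_pdivrMr ?exprn_gt0//.
  rewrite (le_trans (ler_normB _ _))//.
  have hx := S_loglip x u01; have hy := S_loglip y u01.
  apply: (@le_trans _ _ (2 * (L * u ^+ 2 * (1 - ln u)))); first by lra.
  rewrite (_ : 16 * L * (1 - ln r) * _ * _ = 2 * (L * u ^+ 2 * ((1 - ln r) * (8 * peak 2^-1 (u / r))))); last by ring.
  apply: ler_wpM2l => //; apply: ler_wpM2l; first by rewrite mulr_ge0 ?sqr_ge0.
  have nl := neg_ln_le z0.
  have zz : 1 <= (u / r) `^ (- 2^-1).
    by rewrite powRN invf_ge1 ?powR_gt0// powR_le1 ?(ltW z0).
  move: nl; rewrite ln_div ?posrE// opprB => nl.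
  apply: (@le_trans _ _ ((1 - ln r) * (2 * (u / r) `^ (- 2^-1)))); last first.
    by apply: ler_wpM2l; lra.
  move: zz nl lr; set z := _ `^ _; set l := ln r; set l' := ln u => zz nl lr.
  nra.
have u2r : 0 < u ^+ 2 by rewrite exprn_gt0.
have K1 : u^-1 <= 2 * (u + r)^-1.
  by rewrite -[2]invrK -invfM lef_pV2 ?posrE ?mulr_gt0 ?addr_gt0//; lra.
rewrite -[leLHS]add0r; apply: lerD => //.
have [u1|/ltW u1] := leP u 1.
  apply: (@le_trans _ _ (Z * r * u^-1)).
    rewrite (_ : Z * r * u^-1 = Z * u * r / u ^+ 2); last by field; rewrite gt_eqF.
    by rewrite ler_pM2r ?invr_gt0// S_zygmund.
  have K2 : 1 <= 3 * (u + 2)^-1 by rewrite ler_pdivlMr ?addr_gt0//; lra.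
  have K3 : u^-1 <= 6 * ((u + r)^-1 * (u + 2)^-1).
    apply: (le_trans K1); rewrite (_ : 6 * _ = 2 * (u + r)^-1 * (3 * (u + 2)^-1)); last by ring.
    by rewrite ler_peMr// mulr_ge0// ltW.
  apply: (@le_trans _ _ (Z * r * (6 * ((u + r)^-1 * (u + 2)^-1)))).
    by rewrite ler_wpM2l// mulr_ge0// ltW.
  rewrite (_ : Z * r * _ = (6 * Z * r) * ((u + r)^-1 * (u + 2)^-1)); last by ring.
  apply: ler_pM => //; first by rewrite !mulr_ge0// ltW.
  by rewrite ler_wpM2r ?(ltW r0)// lerDl mulr_ge0.
apply: (@le_trans _ _ (4 * D * r / u ^+ 2)); first by rewrite ler_pM2r ?invr_gt0.
have K2 : u^-1 <= 3 * (u + 2)^-1.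
  by rewrite -[3]invrK -invfM lef_pV2 ?posrE ?mulr_gt0 ?addr_gt0//; lra.
have K3 : (u ^+ 2)^-1 <= 6 * ((u + r)^-1 * (u + 2)^-1).
  rewrite expr2 invfM (_ : 6 * _ = 2 * (u + r)^-1 * (3 * (u + 2)^-1)); last by ring.
  by apply: ler_pM => //; rewrite invr_ge0 ltW.
apply: (@le_trans _ _ (4 * D * r * (6 * ((u + r)^-1 * (u + 2)^-1)))).
  by rewrite ler_wpM2l// !mulr_ge0// ltW.
rewrite (_ : 4 * D * r * _ = (24 * D * r) * ((u + r)^-1 * (u + 2)^-1)); last by ring.
apply: ler_pM => //; first by rewrite !mulr_ge0// ltW.
by rewrite ler_wpM2r ?(ltW r0)// lerDr mulr_ge0.
Qed.

End half_generator_cauchy.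

(** * From the generators on the line to the half-line form *)

Section reflection.
Context {R : realType}.
Notation mu := (@lebesgue_measure R).
Implicit Types (g h : R -> R) (x u : R).

Let preimageN : (-%R : measurableTypeR R -> measurableTypeR R) @^-1` `]-oo, 0%R[ = `]0%R, +oo[%classic.
Proof. by apply/seteqP; split => x /=; rewrite !in_itv/= andbT oppr_lt0. Qed.

Lemma Rintegral_opp g : measurable_fun setT g -> mu.-integrable `]0, +oo[ (EFin \o g) ->
  mu.-integrable `]-oo, 0[ (EFin \o (fun u => g (- u))) /\
  \int[mu]_(u in `]-oo, 0[) g (- u) = \int[mu]_(u in `]0, +oo[) g u.
Proof.
move=> mg ig; pose phi : measurableTypeR R -> measurableTypeR R := -%R.
have mphi : measurable_fun [set: measurableTypeR R] phi by exact: oppr_measurable.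
have mgN : measurable_fun [set: measurableTypeR R] (EFin \o (fun u => g (- u))).
  by apply/measurable_EFinP; apply: measurableT_comp => //; exact: oppr_measurable.
have mD : measurable (`]-oo, 0[%classic : set (measurableTypeR R)) by [].
have igN : mu.-integrable (phi @^-1` `]-oo, 0[) ((EFin \o (fun u => g (- u))) \o phi).
  by rewrite preimageN; apply: eq_integrable ig => // u _ /=; rewrite opprK.
have E (f : measurableTypeR R -> \bar R) :
    (\int[pushforward mu phi]_(y in `]-oo, 0%R[) f y = \int[mu]_(y in `]-oo, 0%R[) f y)%E.
  by apply: eq_measure_integral => A mA _; exact: lebesgue_measureN.
split.
  have /integrableP[i1 i2] := integrable_pushforward mphi mgN igN mD.
  by apply/integrableP; split => //; rewrite -E.
rewrite /Rintegral -E (integral_pushforward mphi mgN igN mD) preimageN.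
by congr fine; apply: eq_integral => u _ /=; rewrite opprK.
Qed.

Variables (a dl : R).
Let cp := levy_const a * ((1 + dl) / 2).
Let cm := levy_const a * ((1 - dl) / 2).

Lemma levy_integral h : measurable_fun setT h ->
  mu.-integrable `]0, +oo[ (EFin \o (fun u => h u * u `^ (- 1 - a))) ->
  mu.-integrable `]0, +oo[ (EFin \o (fun u => h (- u) * u `^ (- 1 - a))) ->
  \int[mu]_u (h u * levy_density a dl u) =
  \int[mu]_(u in `]0, +oo[) ((cp * h u + cm * h (- u)) * u `^ (- 1 - a)).
Proof.
move=> mh i1 i2.
have mhN : measurable_fun setT (fun u => h (- u) * u `^ (- 1 - a)).
  by mfun; apply: measurableT_comp => //; exact: oppr_measurable.
have [i3 e3] := Rintegral_opp mhN i2.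
have mP : measurable (`]0, +oo[%classic : set (measurableTypeR R)) by [].
have mN : measurable (`]-oo, 0[%classic : set (measurableTypeR R)) by [].
pose P u := cp * (h u * u `^ (- 1 - a)).
pose N u := cm * (h (- - u) * (- u) `^ (- 1 - a)).
have iP : mu.-integrable `]0, +oo[ (EFin \o P) by exact: integrableZl1.
have iN : mu.-integrable `]-oo, 0[ (EFin \o N) by exact: integrableZl1.
(* [point] is the default value of a patched function outside its set; here it has to be 0 for the
   two pieces to add up. *)
have pt0 : point = 0 :> R by [].
transitivity (\int[mu]_u ((P \_ `]0, +oo[) u + (N \_ `]-oo, 0[) u)).
  apply: eq_Rintegral => u _; rewrite !patchE /levy_density !indicE /P /N opprK pt0.
  rewrite !mem_setE !in_itv/= andbT; have [u0|u0|->] := ltgtP u 0.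
  - rewrite ltr0_norm//= mulr0 mulr1 !add0r /cm.
    by move: (h u) ((- u) `^ _) => H A; ring.
  - rewrite /= mulr0 mulr1 !addr0 /cp.
    by move: (h u) (u `^ _) => H A; ring.
  - by rewrite /= mulr0n !mulr0 !addr0 !mulr0.
rewrite RintegralD//; last 2 first.
- by move/(integrable_mkcond _ mP) : iP; apply: eq_integrable => // u _; rewrite /= !patchE; case: ifP.
- by move/(integrable_mkcond _ mN) : iN; apply: eq_integrable => // u _; rewrite /= !patchE; case: ifP.
rewrite -!Rintegral_mkcond (eq_RintegralZl mN i3 (fun _ _ => erefl)) e3.
rewrite -(eq_RintegralZl mP i2 (fun _ _ => erefl)) -RintegralD//; last exact: integrableZl1.
by apply: eq_Rintegral => u _; rewrite /P; ring.
Qed.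

End reflection.

Section generators.
Context {R : realType}.
Notation mu := (@lebesgue_measure R).
Implicit Types (f df : R -> R) (x u : R).

Lemma stable_generatorE (a dl b D : R) f x : 0 < a < 1 -> b < a -> continuous f ->
  (forall x y, `|f x - f y| <= D * `|x - y|) ->
  (forall x y, `|f x - f y| <= D * `|x - y| `^ b) ->
  stable_generator a dl f x = half_generator a
    (levy_const a * ((1 + dl) / 2)) (levy_const a * ((1 - dl) / 2)) f x.
Proof.
move=> /andP[a0 a1] ba cf f1 fb.
have mf : measurable_fun setT (fun u => f (x + u) - f x).
  by mfun; apply: measurable_fun_cont => //; mfun.
have I (s : R) : `|s| = 1 ->
    mu.-integrable `]0, +oo[ (EFin \o (fun u => (f (x + s * u) - f x) * u `^ (- 1 - a))).
  move=> s1; have e1 : -1 < - a by rewrite ltrN2.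
  have e2 : b - 1 - a < -1 by lra.
  apply: (@dom0y_integrable _ _ (- a) (b - 1 - a) D) => //.
  - by mfun; apply: measurable_fun_cont => //; mfun.
  - move=> u /andP[u0 _]; rewrite [in leRHS](_ : - a = 1 + (- 1 - a)); last by ring.
    rewrite (@powRDp _ u 1 (- 1 - a) u0) powRr1 ?(ltW u0)// normrM (ger0_norm (powR_ge0 _ _)) mulrA.
    rewrite ler_wpM2r ?powR_ge0//; have := f1 (x + s * u) x.
    by rewrite (_ : x + s * u - x = s * u) ?normrM ?s1 ?mul1r ?(gtr0_norm u0)//; ring.
  - move=> u u1; have u0 : 0 < u by exact: lt_le_trans u1.
    rewrite [in leRHS](_ : b - 1 - a = b + (- 1 - a)); last by ring.
    rewrite (@powRDp _ u b (- 1 - a) u0) normrM (ger0_norm (powR_ge0 _ _)) mulrA.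
    rewrite ler_wpM2r ?powR_ge0//; have := fb (x + s * u) x.
    by rewrite (_ : x + s * u - x = s * u) ?normrM ?s1 ?mul1r ?(gtr0_norm u0)//; ring.
rewrite /stable_generator levy_integral//.
  by have := I 1 (normr1 _); apply: eq_integrable => // u _ /=; rewrite mul1r.
by have := I (-1) (normrN1 _); apply: eq_integrable => // u _ /=; rewrite mulN1r.
Qed.

(** The compensator is odd in u and cancels once u and - u are folded with the equal weights (2 /
    pi) / 2. Before folding, each half must be integrable by itself, which is where the modulus of
    f' is used. *)
Lemma cauchy_generatorE (b D L : R) f df x : 0 < b < 1 ->
  (forall x, is_derive x (1 : R) f (df x)) ->
  (forall x y, `|f x - f y| <= D * `|x - y| `^ b) -> 0 <= D -> 0 <= L ->
  (forall x y, x != y -> `|x - y| <= 1 ->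
    `|df x - df y| <= L * (`|x - y| * (1 - ln `|x - y|))) ->
  cauchy_generator f x = half_generator 1 (pi^-1) (pi^-1) f x.
Proof.
move=> /andP[b0 b1] fdf fb D0 L0 dfL.
have cf : continuous f by move=> y; exact: is_derive1_cont (fdf y).
pose h u := f (x + u) - f x - u * derive1 f x * \1_[set v : R | `|v| <= 1] u.
have mI : measurable [set v : R | `|v| <= 1].
  rewrite (_ : [set v | _] = `[-1, 1]%classic)//.
  by apply/seteqP; split => v /=; rewrite in_itv/= ler_norml.
have mh : measurable_fun setT h.
  rewrite /h; mfun; first by apply: measurable_fun_cont => //; mfun.
  exact: measurable_indic.
(* The exponent 1/2 is convenient rather than sharp: the compensated increment is then of order
   u^(3/2), and u^(-1/2) is integrable at 0. *)
have hdf y z : `|y - z| <= 1 -> `|df y - df z| <= 2 * L * `|y - z| `^ 2^-1.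
  move=> yz1; have [->|yz] := eqVneq y z.
    by rewrite !subrr normr0 mulr_ge0 ?powR_ge0// mulr_ge0.
  have r0 : 0 < `|y - z| by rewrite normr_gt0 subr_eq0.
  apply: (le_trans (dfL y z yz yz1)); rewrite [2 * L]mulrC -mulrA ler_wpM2l//.
  have nl := neg_ln_le r0; set r := `|y - z| in nl r0 *.
  rewrite (_ : 2^-1 = 1 + (- 2^-1)); last by lra.
  rewrite powRDp// powRr1 ?(ltW r0)// mulrCA ler_wpM2l ?(ltW r0)//; lra.
have h_le1 v : `|v| <= 1 -> h v = f (x + v) - f x - v * df x.
  by move=> v1; rewrite /h indicE mem_set// mulr1 (is_derive1_val (fdf x)).
have h_gt1 v : 1 < `|v| -> h v = f (x + v) - f x.
  by move=> v1; rewrite /h indicE memNset ?mulr0 ?subr0//= leNgt v1.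
have I (s : R) : `|s| = 1 ->
    mu.-integrable `]0, +oo[ (EFin \o (fun u => h (s * u) * u `^ (- 1 - 1))).
  move=> s1; have e1 : -1 < - 2^-1 :> R by lra.
  have e2 : b - 2 < -1 by lra.
  have nE u : 0 < u -> `|s * u| = u by move=> u0; rewrite normrM s1 mul1r gtr0_norm.
  apply: (@dom0y_integrable _ _ (- 2^-1) (b - 2) (2 * L + D + `|df x|)) => //.
  - apply: measurable_funM1; last by mfun.
    have ms : measurable_fun setT (fun u : R => s * u) by mfun.
    exact: (measurableT_comp mh ms).
  - move=> u /andP[u0 u1].
    rewrite normrM (ger0_norm (powR_ge0 _ _)) (_ : - 2^-1 = 2^-1 + 1 + (- 1 - 1)); last by lra.
    rewrite (@powRDp _ u (2^-1 + 1) (- 1 - 1) u0) mulrA ler_wpM2r ?powR_ge0//.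
    rewrite h_le1 ?nE//.
    apply: (@le_trans _ _ (2 * L * u `^ (2^-1 + 1))); last first.
      by rewrite ler_wpM2r ?powR_ge0//; have := normr_ge0 (df x); lra.
    rewrite (@powRDp _ u 2^-1 1 u0) powRr1 ?(ltW u0)// mulrA.
    have := @is_derive_taylor _ f df (2 * L * u `^ 2^-1) x (x + s * u).
    rewrite (_ : x + s * u - x = s * u); last by ring.
    rewrite nE//; apply=> //; first by rewrite !mulr_ge0// powR_ge0.
    move=> z zu; apply: le_trans (hdf _ _ (le_trans zu u1)) _.
    by rewrite ler_wpM2l ?mulr_ge0// ge0_ler_powR ?nnegrE// ltW.
  - move=> u u1; have u0 : 0 < u by exact: lt_le_trans u1.
    rewrite (_ : b - 2 = b + (- 1 - 1)); last by ring.
    rewrite (@powRDp _ u b (- 1 - 1) u0) normrM (ger0_norm (powR_ge0 _ _)) mulrA ler_wpM2r ?powR_ge0//.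
    have := fb (x + s * u) x; rewrite (_ : x + s * u - x = s * u); last by ring.
    rewrite nE// => fu.
    have ub : 1 <= u `^ b by rewrite powR_ge1// ltW.
    have Lu : 0 <= L * u `^ b by rewrite mulr_ge0// powR_ge0.
    rewrite (_ : _ * u `^ b = D * u `^ b + (`|df x| * u `^ b + 2 * (L * u `^ b))); last by ring.
    (* The point u = 1 lies in both ranges and still carries the compensator, hence the summand
       [|df x|] in the constant. *)
    have [u1'|u1'] := leP u 1; last first.
      by rewrite h_gt1 ?nE// (le_trans fu)// lerDl addr_ge0 ?mulr_ge0 ?powR_ge0.
    rewrite h_le1 ?nE//; apply: (le_trans (ler_normB _ _)); apply: lerD => //.
    rewrite normrM nE// mulrC.
    have -> : u = 1 by apply/eqP; rewrite eq_le u1 u1'.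
    by rewrite powR1 !mulr1 lerDl mulr_ge0.
rewrite /cauchy_generator (@levy_integral _ 1 0 h)//.
- apply: eq_Rintegral => u _; rewrite /levy_const eqxx.
  have pn : pi != 0 :> R by rewrite gt_eqF ?pi_gt0.
  have [u1|u1] := leP `|u : R| 1.
    by rewrite (h_le1 _ u1) (h_le1 (- u)) ?normrN//; move: (pi : R) pn => q pn; field.
  by rewrite (h_gt1 _ u1) (h_gt1 (- u)) ?normrN//; move: (pi : R) pn => q pn; field.
- by have := I 1 (normr1 _); apply: eq_integrable => // u _ /=; rewrite mul1r.
- by have := I (-1) (normrN1 _); apply: eq_integrable => // u _ /=; rewrite mulN1r.
Qed.

End generators.

(** * The generators on a single wave *)

Section wave_generators.
Context {R : realType}.
Notation mu := (@lebesgue_measure R).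

Let Dc (cp cm : R) X s := cp * (cos (X + s) - cos X) + cm * (cos (X - s) - cos X).

Let DcE cp cm X s : Dc cp cm X s =
  - ((cp + cm) * cos X) * (1 - cos s) + - ((cp - cm) * sin X) * sin s.
Proof. by rewrite /Dc cosB cosD; ring. Qed.

Section stable.
Variables (a dl : R).
Hypothesis a01 : 0 < a < 1.
Let cp := levy_const a * ((1 + dl) / 2).
Let cm := levy_const a * ((1 - dl) / 2).

Let mE : measurable (`]0, +oo[%classic : set (measurableTypeR R)). Proof. by []. Qed.

Let i1 X k : mu.-integrable `]0, +oo[ (EFin \o (fun u =>
  - ((cp + cm) * cos X) * ((1 - cos (k * u)) * u `^ (- 1 - a)))).
Proof. by apply: integrableZl1 => //; exact: onem_cos_powR_integrable. Qed.

Let i2 X k : mu.-integrable `]0, +oo[ (EFin \o (fun u =>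
  - ((cp - cm) * sin X) * (sin (k * u) * u `^ (- 1 - a)))).
Proof. by apply: integrableZl1 => //; exact: sin_powR_integrable. Qed.

Lemma stable_wave_integrable X k : mu.-integrable `]0, +oo[
  (EFin \o (fun u => Dc cp cm X (k * u) * u `^ (- 1 - a))).
Proof.
have := integrableD1 mE (i1 X k) (i2 X k); apply: eq_integrable => // u _ /=.
by rewrite DcE; congr EFin; ring.
Qed.

(** cp + cm and cp - cm equal the Levy constant times 1 and [dl]. That constant is - 1 / (Gamma (-
    a) cos (pi a / 2)), so it cancels Gamma and leaves a tangent on the sine part only. *)
Lemma stable_wave X k : 0 <= k ->
  \int[mu]_(u in `]0, +oo[) (Dc cp cm X (k * u) * u `^ (- 1 - a)) =
    - (k `^ a * (cos X + dl * tan (pi * a / 2) * sin X)).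
Proof.
move=> k0; have /andP[a0 a1] := a01.
have [->|kn0] := eqVneq k 0.
  rewrite powR0 ?gt_eqF// mul0r oppr0.
  under eq_Rintegral => u _ do rewrite DcE mul0r cos0 sin0 subrr !mulr0 addr0 mul0r.
  by rewrite Rintegral_cst// mul0r.
have {kn0}k0 : 0 < k by rewrite lt_neqAle eq_sym kn0.
have [E1 E2] := stable_integrals a01 k0.
have G0 := Gamma_opp_gt0 a01; have c0 := cos_stable_gt0 a01.
have -> : \int[mu]_(u in `]0, +oo[) (Dc cp cm X (k * u) * u `^ (- 1 - a)) =
    \int[mu]_(u in `]0, +oo[) (- ((cp + cm) * cos X) * ((1 - cos (k * u)) * u `^ (- 1 - a))) +
    \int[mu]_(u in `]0, +oo[) (- ((cp - cm) * sin X) * (sin (k * u) * u `^ (- 1 - a))).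
  rewrite -RintegralD//; do ?[exact: i1|exact: i2].
  by apply: eq_Rintegral => u _; rewrite DcE; ring.
rewrite (eq_RintegralZl mE (onem_cos_powR_integrable a01 k) (fun _ _ => erefl)).
rewrite (eq_RintegralZl mE (sin_powR_integrable a01 k) (fun _ _ => erefl)) E1 E2.
have -> : cp + cm = levy_const a by rewrite /cp /cm; field.
have -> : cp - cm = levy_const a * dl by rewrite /cp /cm; field.
rewrite /levy_const lt_eqF// /tan.
move: G0 c0; move: (Gamma (- a)) (cos (pi * a / 2)) (sin (pi * a / 2)) => G c S G0 c0.
have Gn : G != 0 by rewrite -oppr_eq0 gt_eqF.
have cn : c != 0 by rewrite gt_eqF.
by field; rewrite Gn cn.
Qed.

Lemma stable_wave_le X s : 0 <= s -> `|Dc cp cm X s| <= 2 * (`|cp| + `|cm|) * s `^ 1.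
Proof.
move=> s0; rewrite powRr1// (le_trans (ler_normD _ _))// (normrM cp) (normrM cm).
have h1 := cos_lip (X + s) X; have h2 := cos_lip (X - s) X.
rewrite (_ : X + s - X = s) ?(ger0_norm s0) in h1; last by ring.
rewrite (_ : X - s - X = - s) ?normrN ?(ger0_norm s0) in h2; last by ring.
have p1 := ler_wpM2l (normr_ge0 cp) h1; have p2 := ler_wpM2l (normr_ge0 cm) h2.
apply: (le_trans (lerD p1 p2)); rewrite -mulrDl ler_wpM2r// ler_peMl//.
by rewrite ler1n.
Qed.

Lemma stable_wave_le1 X s : `|Dc cp cm X s| <= 2 * (`|cp| + `|cm|).
Proof.
rewrite (le_trans (ler_normD _ _))// (normrM cp) (normrM cm) mulrDr.
have h z : `|cos z - cos X| <= 2.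
  by rewrite (le_trans (ler_normB _ _))// (le_trans (lerD (cos_max _) (cos_max _))).
by rewrite lerD// mulrC ler_wpM2r.
Qed.

End stable.

Section cauchy.
Let cp : R := pi^-1.

Let mE : measurable (`]0, +oo[%classic : set (measurableTypeR R)). Proof. by []. Qed.

Let DE X s : Dc cp cp X s = - (2 / pi * cos X) * (1 - cos s).
Proof. by rewrite DcE subrr mul0r oppr0 mul0r addr0 /cp; ring. Qed.

Lemma cauchy_wave_integrable X k : mu.-integrable `]0, +oo[
  (EFin \o (fun u => Dc cp cp X (k * u) * u `^ (- 1 - 1))).
Proof.
have := integrableZl1 (- (2 / pi * cos X)) mE (cauchy_integrable k).
by apply: eq_integrable => // u _ /=; rewrite DE mulrA.
Qed.

Lemma cauchy_wave X k : 0 <= k ->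
  \int[mu]_(u in `]0, +oo[) (Dc cp cp X (k * u) * u `^ (- 1 - 1)) =
    - (k `^ 1 * (cos X + 0 * sin X)).
Proof.
move=> k0; have E : forall u, `]0, +oo[%classic u -> Dc cp cp X (k * u) * u `^ (- 1 - 1) =
    - (2 / pi * cos X) * ((1 - cos (k * u)) * u `^ (- 1 - 1)).
  by move=> u _; rewrite DE mulrA.
rewrite (eq_RintegralZl mE (cauchy_integrable k) E) cauchy_integral_norm ger0_norm// powRr1//.
have pn : pi != 0 :> R by rewrite gt_eqF ?pi_gt0.
by move: (pi : R) pn => q pn; field.
Qed.

Let cp0 : 0 < cp. Proof. by rewrite invr_gt0 pi_gt0. Qed.

Let DN X s : `|Dc cp cp X s| <= 2 * cp * (1 - cos s).
Proof.
rewrite DE normrM (ger0_norm (onem_cos_ge0 s)) ler_wpM2r ?onem_cos_ge0//.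
rewrite normrN normrM ger0_norm ?(ltW cp0) ?mulr_ge0 ?(ltW cp0)//.
by rewrite ler_piMr ?cos_max// mulr_ge0// ltW.
Qed.

(** With equal weights the term in sin s drops out, and the remaining 1 - cos s has order 2 at 0;
    this supplies the exponent q = 2 > 1 in the Stein equation. *)
Lemma cauchy_wave_le X s : 0 <= s -> `|Dc cp cp X s| <= 4 * cp * s `^ 2.
Proof.
move=> s0; apply: (le_trans (DN X s)); rewrite powR_mulrn//.
apply: (@le_trans _ _ (2 * cp * s ^+ 2)).
  by rewrite ler_wpM2l ?onem_cos_le2// mulr_ge0// ltW.
by rewrite ler_wpM2r ?sqr_ge0// ler_wpM2r ?(ltW cp0)// ler_nat.
Qed.

Lemma cauchy_wave_le1 X s : `|Dc cp cp X s| <= 4 * cp.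
Proof.
apply: (le_trans (DN X s)); rewrite (_ : 4 * cp = 2 * cp * 2); last by ring.
rewrite ler_wpM2l ?mulr_ge0 ?(ltW cp0)//.
by have := cos_geN1 s; lra.
Qed.

End cauchy.
End wave_generators.

(** * Approximation of the test functions by trigonometric polynomials *)

Section binomial_operator.
Context {R : realFieldType}.
Implicit Types (F G : nat -> R) (s t c : R) (n k : nat).

(** The Bernstein operator, as the mean of F under the binomial law with parameters n and t.
    Conditioning on one trial gives a recursion free of binomial coefficients, which
    [bernstein_list] can imitate. *)
Fixpoint binom_mean n F t : R :=
  if n is n'.+1 then (1 - t) * binom_mean n' F t + t * binom_mean n' (fun k => F k.+1) t
  else F 0.

Lemma binom_mean_le n F G t : 0 <= t <= 1 -> (forall k, F k <= G k) ->
  binom_mean n F t <= binom_mean n G t.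
Proof.
move=> /andP[t0 t1]; elim: n F G => [|n IH] F G FG /=; first exact: FG.
by rewrite lerD// ler_wpM2l ?subr_ge0// IH.
Qed.

Lemma binom_mean_lin n F a c t :
  binom_mean n (fun k => a * F k + c) t = a * binom_mean n F t + c.
Proof. by elim: n F => [|n IH] F //=; rewrite !IH; ring. Qed.

Lemma binom_mean_dist n F G t e : 0 <= t <= 1 -> (forall k, `|F k - G k| <= e) ->
  `|binom_mean n F t - binom_mean n G t| <= e.
Proof.
move=> t01 FG.
have h1 : binom_mean n F t <= binom_mean n (fun k => 1 * G k + e) t.
  by apply: binom_mean_le => // k; have := FG k; rewrite ler_norml => /andP[_]; lra.
have h2 : binom_mean n G t <= binom_mean n (fun k => 1 * F k + e) t.
  by apply: binom_mean_le => // k; have := FG k; rewrite ler_norml => /andP[+ _]; lra.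
rewrite binom_mean_lin in h1; rewrite binom_mean_lin in h2.
by rewrite ler_norml; apply/andP; split; lra.
Qed.

(** Changing the parameter of one trial from s to t costs at most D |s - t|, and there are n
    trials. *)
Lemma binom_mean_lipschitz n F D s t : 0 <= s <= 1 -> 0 <= t <= 1 ->
  (forall k, `|F k - F k.+1| <= D) ->
  `|binom_mean n F s - binom_mean n F t| <= n%:R * D * `|s - t|.
Proof.
move=> s01 t01; elim: n F => [|n IH] F FD /=; first by rewrite subrr normr0 !mul0r.
have /andP[s0 s1] := s01.
have h1 := IH _ FD; have h2 := IH (fun k => F k.+1) (fun k => FD k.+1).
have h3 := binom_mean_dist n (G := fun k => F k.+1) t01 FD.
set A := binom_mean n F s in h1 *; set B := binom_mean n F t in h1 h3 *.
set A' := binom_mean n _ s in h2 *; set B' := binom_mean n _ t in h2 h3 *.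
rewrite (_ : _ - _ = (1 - s) * (A - B) + s * (A' - B') + (t - s) * (B - B')); last by ring.
apply: (le_trans (ler_normD _ _)).
have e3 : `|(t - s) * (B - B')| <= D * `|s - t|.
  by rewrite normrM distrC mulrC ler_wpM2r.
have e1 : `|(1 - s) * (A - B)| <= (1 - s) * (n%:R * D * `|s - t|).
  by rewrite normrM ger0_norm ?subr_ge0// ler_wpM2l ?subr_ge0.
have e2 : `|s * (A' - B')| <= s * (n%:R * D * `|s - t|).
  by rewrite normrM ger0_norm// ler_wpM2l.
have := ler_normD ((1 - s) * (A - B)) (s * (A' - B')).
rewrite -natr1; set Q := n%:R * D * `|s - t| in e1 e2 *; move=> e4.
rewrite (_ : (n%:R + 1) * D * `|s - t| = Q + D * `|s - t|); last by rewrite /Q; ring.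
lra.
Qed.

(** Squared bias plus variance. The centre c stays general because the recursion shifts it by 1. *)
Lemma binom_mean_var n c t : binom_mean n (fun k => (k%:R - c) ^+ 2) t =
  (n%:R * t - c) ^+ 2 + n%:R * t * (1 - t).
Proof.
elim: n c => [|n IH] c /=; first by rewrite !mul0r addr0.
rewrite IH (_ : (fun k => _) = (fun k => (k%:R - (c - 1)) ^+ 2)); last first.
  by apply/funext => k; rewrite -natr1; ring.
by rewrite IH -natr1; ring.
Qed.

End binomial_operator.

Section trigonometric_approximation.
Context {R : realType}.
Implicit Types (p : @tpoly R) (x y s : R) (n k : nat).

Definition tscale (c : R) p : tpoly := [seq (c * t.1, t.2) | t <- p].

Lemma tpe_tscale c p x : tpe (tscale c p) x = c * tpe p x.
Proof. by rewrite /tpe big_map mulr_sumr; apply: eq_bigr => t _ /=; rewrite mulrA. Qed.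

Lemma tpos_tscale c p : tpos p -> tpos (tscale c p).
Proof. by move=> p0 t /mapP[u up ->]/=; exact: p0. Qed.

(* [cos A * sin B = (cos (A + B - pi / 2) + cos (A - B + pi / 2)) / 2], written with
   nonnegative frequencies. *)
Definition tmulsin s p : tpoly :=
  [seq (t.1 / 2, (t.2.1 + s, t.2.2 - pi / 2)) | t <- p] ++
  [seq (t.1 / 2, if s <= t.2.1 then (t.2.1 - s, t.2.2 + pi / 2)
                 else (s - t.2.1, - (t.2.2 + pi / 2))) | t <- p].

Lemma tpe_tmulsin s p x : tpe (tmulsin s p) x = sin (s * x) * tpe p x.
Proof.
rewrite /tmulsin tpe_cat /tpe !big_map -big_split mulr_sumr; apply: eq_bigr => t _ /=.
set A := t.2.1 * x + t.2.2.
have -> : cos ((t.2.1 + s) * x + (t.2.2 - pi / 2)) = sin (A + s * x).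
  by rewrite (_ : _ + (_ - _) = A + s * x - pi / 2) ?cosBpihalf// /A; ring.
have E : cos (A - s * x + pi / 2) = - sin (A - s * x) by rewrite cosDpihalf.
have -> : cos ((if s <= t.2.1 then (t.2.1 - s, t.2.2 + pi / 2)
    else (s - t.2.1, - (t.2.2 + pi / 2))).1 * x + (if s <= t.2.1 then (t.2.1 - s, t.2.2 + pi / 2)
    else (s - t.2.1, - (t.2.2 + pi / 2))).2) = - sin (A - s * x).
  rewrite -E; case: ifP => _ /=; first by congr cos; rewrite /A; ring.
  by rewrite -cosN; congr cos; rewrite /A; ring.
by rewrite sinD sinB; field.
Qed.

Lemma tpos_tmulsin s p : 0 <= s -> tpos p -> tpos (tmulsin s p).
Proof.
move=> s0 p0 t; rewrite mem_cat => /orP[] /mapP[u up ->]/=; have := p0 u up; first by move=> ?; rewrite addr_ge0.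
by case: (leP s u.2.1) => /= h _; rewrite subr_ge0// ltW.
Qed.

(** The recursion of [binom_mean] at t = (1 + sin (s x)) / 2, with the products by 1 - t and t
    written out as waves. *)
Fixpoint bernstein_list s n (F : nat -> R) : tpoly :=
  if n is n'.+1 then
    let p := bernstein_list s n' F in let q := bernstein_list s n' (fun k => F k.+1) in
    tscale 2^-1 (p ++ tneg (tmulsin s p) ++ q ++ tmulsin s q)
  else [:: (F 0, (0, 0))].

Lemma tpe_bernstein_list s n F x :
  tpe (bernstein_list s n F) x = binom_mean n F ((1 + sin (s * x)) / 2).
Proof.
elim: n F => [|n IH] F /=; first by rewrite /tpe big_seq1/= mul0r addr0 cos0 mulr1.
rewrite tpe_tscale (tpe_cat (bernstein_list s n F)) (tpe_cat (tneg _)) (tpe_cat (bernstein_list _ _ _)).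
rewrite tpe_tneg !tpe_tmulsin !IH.
by set A := binom_mean n F _; set B := binom_mean n _ _; clearbody A B; field.
Qed.

Lemma tpos_bernstein_list s n F : 0 <= s -> tpos (bernstein_list s n F).
Proof.
move=> s0; elim: n F => [|n IH] F /=; first by move=> t; rewrite inE => /eqP ->.
apply: tpos_tscale; apply: tpos_cat => //; apply: tpos_cat.
  by apply: tpos_tneg; exact: tpos_tmulsin.
by apply: tpos_cat => //; exact: tpos_tmulsin.
Qed.

Let half_sin01 y : 0 <= (1 + sin y) / 2 <= 1.
Proof. by have := sin_geN1 y; have := sin_le1 y => h1 h2; apply/andP; split; lra. Qed.

(** The Lipschitz constant is preserved exactly: m increments of size 2 N / m, the factor 1/2 in t,
    and the slope 1/N of sin (x / N) multiply to 1. *)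
Lemma trigonometric_approximation (h : R -> R) n : (0 < n)%N ->
  (forall x y, `|h x - h y| <= `|x - y|) ->
  exists p, [/\ tpos p, forall x y, `|tpe p x - tpe p y| <= `|x - y| &
    forall x, `|tpe p x - h (n%:R * sin (n%:R^-1 * x))| <= n%:R^-1].
Proof.
move=> n0 hL; set N : R := n%:R; have N0 : 0 < N by rewrite ltr0n.
have s0 : 0 <= N^-1 by rewrite invr_ge0 ltW.
(* With this degree the variance term 4 N^3 / m is 1 / (4 N); together with the remainder 1 / (4 N)
   of the mean inequality the error is at most 1 / (2 N). *)
pose m := (16 * n ^ 4)%N; have m0 : (0 < m)%N by rewrite muln_gt0 expn_gt0 n0.
have mE : m%:R = 16 * N ^+ 4 :> R by rewrite /m natrM natrX.
have mR0 : 0 < m%:R :> R by rewrite ltr0n.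
pose F k := h (N * (2 * (k%:R / m%:R) - 1)).
have FD k : `|F k - F k.+1| <= 2 * N / m%:R.
  apply: (le_trans (hL _ _)); rewrite le_eqVlt; apply/orP; left; apply/eqP.
  rewrite (_ : _ - _ = - (2 * N / m%:R)); last first.
    by rewrite -natr1; move: (m%:R : R) mR0 => q q0; field; rewrite gt_eqF.
  by rewrite normrN ger0_norm// divr_ge0 ?mulr_ge0// ltW.
exists (bernstein_list N^-1 m F); split.
- exact: tpos_bernstein_list.
- move=> x y; rewrite !tpe_bernstein_list.
  apply: (le_trans (binom_mean_lipschitz m (half_sin01 _) (half_sin01 _) FD)).
  rewrite (_ : (1 + sin (N^-1 * x)) / 2 - _ = (sin (N^-1 * x) - sin (N^-1 * y)) / 2); last by field.
  rewrite normrM (ger0_norm (_ : 0 <= 2^-1)); last by rewrite invr_ge0.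
  rewrite (_ : m%:R * _ * _ = N * `|sin (N^-1 * x) - sin (N^-1 * y)|); last first.
    by move: (m%:R : R) mR0 => q q0; field; rewrite gt_eqF.
  rewrite -ler_pdivlMl//; apply: (le_trans (sin_lip _ _)).
  by rewrite -mulrBr normrM ger0_norm.
- move=> x; rewrite tpe_bernstein_list; set t := (1 + sin _) / 2.
  have t01 : 0 <= t <= 1 := half_sin01 _.
  have -> : h (N * sin (N^-1 * x)) = h (N * (2 * t - 1)).
    by congr (h (N * _)); rewrite /t; field.
  have key k : `|F k - h (N * (2 * t - 1))| <=
      4 * N ^+ 3 / m%:R ^+ 2 * (k%:R - m%:R * t) ^+ 2 + (4 * N)^-1.
    apply: (le_trans (hL _ _)).
    rewrite (_ : _ - _ = 2 * N * ((k%:R - m%:R * t) / m%:R)); last first.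
      by move: (m%:R : R) mR0 => q q0; field; rewrite gt_eqF.
    rewrite normrM ger0_norm ?mulr_ge0 ?(ltW N0)//.
    rewrite (_ : _ * (k%:R - m%:R * t) ^+ 2 = 4 * N ^+ 3 * `|(k%:R - m%:R * t) / m%:R| ^+ 2); last first.
      by rewrite real_normK ?num_real// expr_div_n; ring.
    (* AM-GM: [2 N z <= 4 N^3 z^2 + 1 / (4 N)] *)
    move: `|_ / _| (normr_ge0 ((k%:R - m%:R * t) / m%:R)) => z z0.
    rewrite -subr_ge0 (_ : _ - _ = (4 * N)^-1 * (4 * N ^+ 2 * z - 1) ^+ 2); last first.
      by field; rewrite gt_eqF.
    by rewrite mulr_ge0 ?sqr_ge0// invr_ge0 mulr_ge0// ltW.
  pose G k := 4 * N ^+ 3 / m%:R ^+ 2 * (k%:R - m%:R * t) ^+ 2 + (4 * N)^-1.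
  have GE : binom_mean m G t <= N^-1.
    rewrite /G binom_mean_lin binom_mean_var subrr expr0n/= add0r.
    have tt : t * (1 - t) <= 1 by have /andP[t0 t1] := t01; nra.
    apply: (@le_trans _ _ (4 * N ^+ 3 / m%:R ^+ 2 * m%:R + (4 * N)^-1)).
      have K0 : 0 <= 4 * N ^+ 3 / m%:R ^+ 2.
        by rewrite divr_ge0 ?sqr_ge0// mulr_ge0// exprn_ge0// ltW.
      by rewrite lerD2r; apply: ler_wpM2l => //; rewrite -mulrA ler_piMr// ltW.
    rewrite mE (_ : _ + _ = (2 * N)^-1); last by field; rewrite gt_eqF.
    by rewrite lef_pV2 ?posrE ?mulr_gt0// ler_peMl ?ler1n// ltW.
  have h0 k : 1 * F k + (- h (N * (2 * t - 1))) <= G k.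
    by have := key k; rewrite ler_norml => /andP[_]; rewrite mul1r.
  have h1 k : -1 * F k + h (N * (2 * t - 1)) <= G k.
    by have := key k; rewrite ler_norml /G => /andP[+ _]; lra.
  have := binom_mean_le m t01 h0; have := binom_mean_le m t01 h1.
  rewrite !(binom_mean_lin m F) => e1 e2.
  by rewrite ler_norml; apply/andP; split; lra.
Qed.

End trigonometric_approximation.

Section approximating_class.
Context {R : realType}.
Implicit Types (p : @tpoly R) (x y b : R) (n : nat).

Lemma powR_le_base (c z z' : R) : 0 <= c -> 0 <= z -> z <= z' -> z `^ c <= z' `^ c.
Proof. by move=> c0 z0 zz'; rewrite ge0_ler_powR// nnegrE// (le_trans z0). Qed.

Lemma powR_le_id (z b : R) : 1 <= z -> b <= 1 -> z `^ b <= z.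
Proof.
move=> z1 b1; have z0 : 0 < z by exact: lt_le_trans z1.
rewrite -{2}(@powRr1 _ z (ltW z0)) [in leRHS](_ : 1 = b + (1 - b)); last by ring.
by rewrite (@powRDp _ z b (1 - b) z0) ler_peMr ?powR_ge0// powR_ge1// subr_ge0.
Qed.

Lemma powR_ge_id (z b : R) : 0 < z <= 1 -> b <= 1 -> z <= z `^ b.
Proof.
move=> /andP[z0 z1] b1; rewrite -{1}(@powRr1 _ z (ltW z0)) (_ : 1 = b + (1 - b)); last by ring.
by rewrite (@powRDp _ z b (1 - b) z0) ler_piMr ?powR_ge0// powR_le1 ?(ltW z0)// subr_ge0.
Qed.

(** The factor 3 is forced by the Hoelder modulus at distances above 1, where an approximation error
    of up to 1 is added at each of the two points. *)
Definition modulus_class b p := [/\ tpos p, forall x y, `|tpe p x - tpe p y| <= 3 * `|x - y| &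
  forall x y, `|tpe p x - tpe p y| <= 3 * `|x - y| `^ b].

Lemma Hclass_lipschitz b h x y : Hclass b h -> `|h x - h y| <= `|x - y|.
Proof. by move=> /(_ x y); rewrite le_min => /andP[]. Qed.

Lemma Hclass_holder b h x y : Hclass b h -> `|h x - h y| <= `|x - y| `^ b.
Proof. by move=> /(_ x y); rewrite le_min => /andP[]. Qed.

Lemma Hclass_continuous b h : Hclass b h -> continuous h.
Proof.
move=> hH x; apply/cvgrPdist_le => e e0; near=> y.
apply: (le_trans (Hclass_lipschitz x y hH)).
by near: y; exists e => //= y /=; exact: ltW.
Unshelve. all: by end_near. Qed.

Lemma sin_taylor x : `|sin x - x| <= x ^+ 2.
Proof.
have h := @is_derive_taylor R sin cos `|x| 0 x (normr_ge0 _) (fun z => is_derive_sin z).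
rewrite -real_normK ?num_real// expr2.
move: h; rewrite sin0 cos0 !subr0 mulr1; apply=> z; rewrite subr0; apply: le_trans.
by have := cos_lip z 0; rewrite cos0 subr0.
Qed.

(** At distance at most 1 the Lipschitz bound already implies the Hoelder one. Beyond it |x - y|^b
    >= 1 absorbs the two errors. The lower bound on [q n] serves Fatou, the bounds relative to 0
    serve dominated convergence. *)
Lemma Hclass_approximation b h : 0 < b <= 1 -> Hclass b h -> exists q : nat -> @tpoly R,
  [/\ forall n, modulus_class b (q n), forall n x, `|tpe (q n) x - tpe (q n) 0| <= 3 * `|x| `^ b,
      forall n, `|tpe (q n) 0 - h 0| <= 1,
      forall n x, h (n.+1%:R * sin (n.+1%:R^-1 * x)) - 1 <= tpe (q n) x &
      forall x, tpe (q n) x @[n --> \oo] --> h x].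
Proof.
move=> /andP[b0 b1] hH.
have /choice[q qP] n : exists p, [/\ tpos p, forall x y, `|tpe p x - tpe p y| <= `|x - y| &
    forall x, `|tpe p x - h (n.+1%:R * sin (n.+1%:R^-1 * x))| <= n.+1%:R^-1].
  exact: trigonometric_approximation (fun x y => Hclass_lipschitz x y hH).
have inv1 n : n.+1%:R^-1 <= 1 :> R by rewrite invf_le1// ler1n.
have sin_contr n x y : `|n.+1%:R * sin (n.+1%:R^-1 * x) - n.+1%:R * sin (n.+1%:R^-1 * y)| <= `|x - y|.
  rewrite -mulrBr normrM ger0_norm// -ler_pdivlMl//.
  by apply: (le_trans (sin_lip _ _)); rewrite -mulrBr normrM ger0_norm.
have aux (A B A' B' e r : R) : `|A - A'| <= e -> `|B - B'| <= e -> `|A' - B'| <= r ->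
    e <= 1 -> 1 <= r -> `|A - B| <= 3 * r.
  rewrite !ler_norml => /andP[? ?] /andP[? ?] /andP[? ?] ? ?.
  by apply/andP; split; lra.
have qb n x y : `|tpe (q n) x - tpe (q n) y| <= 3 * `|x - y| `^ b.
  have [_ qL qh] := qP n; have [r1|/ltW r1] := leP `|x - y| 1.
    apply: (le_trans (qL x y)); have [->|xy] := eqVneq x y.
      by rewrite subrr normr0 mulr_ge0// powR_ge0.
    have r0 : 0 < `|x - y| by rewrite normr_gt0 subr_eq0.
    apply: (@le_trans _ _ (`|x - y| `^ b)); first by rewrite powR_ge_id ?r0.
    by rewrite ler_peMl ?powR_ge0// ler1n.
  have rb : 1 <= `|x - y| `^ b by rewrite powR_ge1// ltW.
  have h1 := qh x; have h2 := qh y.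
  have h3 : `|h (n.+1%:R * sin (n.+1%:R^-1 * x)) - h (n.+1%:R * sin (n.+1%:R^-1 * y))| <= `|x - y| `^ b.
    apply: (le_trans (Hclass_holder _ _ hH)).
    by apply: powR_le_base; rewrite ?(ltW b0)// sin_contr.
  exact: aux h1 h2 h3 (inv1 n) rb.
exists q; split.
- move=> n; have [q0 qL _] := qP n; split => // x y; apply: (le_trans (qL x y)).
  by rewrite ler_peMl// ler1n.
- by move=> n x; have := qb n x 0; rewrite subr0.
- move=> n; have [_ _ /(_ 0)] := qP n; rewrite mulr0 sin0 mulr0 => /le_trans; exact.
- move=> n x; have [_ _ /(_ x)] := qP n; rewrite ler_norml => /andP[h1 _].
  have aux2 (A B e : R) : - e <= A - B -> e <= 1 -> B - 1 <= A by move=> ? ?; lra.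
  exact: aux2 h1 (inv1 n).
- move=> x; apply/cvgrPdist_le => e e0.
  have K0 : 0 < 1 + x ^+ 2 by rewrite ltr_pwDl// sqr_ge0.
  near=> n.
  have [_ _ /(_ x) h1] := qP n.
  have n0 : 0 < n.+1%:R :> R by rewrite ltr0n.
  (* N sin (x / N) differs from x by at most x^2 / N, so convergence is pointwise and not
     uniform. *)
  have h2 : `|h (n.+1%:R * sin (n.+1%:R^-1 * x)) - h x| <= x ^+ 2 / n.+1%:R.
    apply: (le_trans (Hclass_lipschitz _ _ hH)).
    rewrite (_ : _ - x = n.+1%:R * (sin (n.+1%:R^-1 * x) - n.+1%:R^-1 * x)); last first.
      by move: (n.+1%:R : R) n0 => N N0; field; rewrite gt_eqF.
    rewrite normrM ger0_norm//; apply: (@le_trans _ _ (n.+1%:R * (n.+1%:R^-1 * x) ^+ 2)).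
      by rewrite ler_wpM2l// sin_taylor.
    rewrite le_eqVlt; apply/orP; left; apply/eqP.
    by move: (n.+1%:R : R) n0 => N N0; field; rewrite gt_eqF.
  have h3 : n.+1%:R^-1 <= e / (1 + x ^+ 2).
    near: n; have := @cvg_invSn R 0 => /cvgrPdist_le /(_ (e / (1 + x ^+ 2))).
    rewrite divr_gt0// => /(_ isT); apply: filterS => n.
    by rewrite sub0r normrN ger0_norm// addn0.
  rewrite distrC (@le_trans _ _ ((1 + x ^+ 2) * n.+1%:R^-1))//; last first.
    by rewrite mulrC -ler_pdivlMr.
  rewrite (_ : tpe _ _ - h x = (tpe (q n) x - h (n.+1%:R * sin (n.+1%:R^-1 * x))) +
    (h (n.+1%:R * sin (n.+1%:R^-1 * x)) - h x)); last by ring.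
  by rewrite (le_trans (ler_normD _ _))// mulrDl mul1r lerD.
Unshelve. all: by end_near. Qed.

(** It grows like |x|^b, and the shift by 1 makes it Lipschitz at the origin, so that it belongs to
    the test class itself. *)
Definition moment_fun b x := (1 + `|x|) `^ b.

Lemma powR_subadd s t b : 0 < s -> 0 < t -> 0 < b <= 1 -> (s + t) `^ b <= s `^ b + t `^ b.
Proof.
move=> s0 t0 /andP[b0 b1]; have st0 : 0 < s + t by rewrite addr_gt0.
have sE z : 0 < z -> z `^ b = (s + t) `^ b * (z / (s + t)) `^ b.
  move=> z0; rewrite -(powRM b (ltW st0) (divr_ge0 (ltW z0) (ltW st0))).
  by rewrite mulrC divfK ?gt_eqF.
rewrite (sE s s0) (sE t t0) -mulrDr ler_peMr ?powR_ge0//.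
apply: (@le_trans _ _ (s / (s + t) + t / (s + t))); first by rewrite -mulrDl divff// gt_eqF.
by rewrite lerD// powR_ge_id// divr_gt0//= ler_pdivrMr// mul1r ?lerDl ?lerDr ltW.
Qed.

(** With s = 1 + |y| >= 1 and t = |x| - |y| the increment (s + t)^b - s^b is at most t^b by
    subadditivity, and at most s^(b - 1) t <= t because (1 + t / s)^b <= 1 + t / s. *)
Lemma moment_fun_Hclass b : 0 < b <= 1 -> Hclass b (moment_fun b).
Proof.
move=> b01; have /andP[b0 b1] := b01.
suff H x y : `|y| < `|x| -> `|moment_fun b x - moment_fun b y| <= Num.min `|x - y| (`|x - y| `^ b).
  move=> x y; have [xy|xy|xy] := ltgtP `|x| `|y|.
  - by rewrite distrC [`|x - y|]distrC H.
  - exact: H.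
  - by rewrite /moment_fun xy subrr normr0 le_min normr_ge0 powR_ge0.
move=> yx; set s := 1 + `|y|; pose t := `|x| - `|y|.
have s1 : 1 <= s by rewrite lerDl.
have s0 : 0 < s by exact: lt_le_trans s1.
have t0 : 0 < t by rewrite subr_gt0.
have txy : t <= `|x - y| by exact: lerB_dist.
have -> : moment_fun b x = (s + t) `^ b by rewrite /moment_fun /s /t; congr (_ `^ _); ring.
rewrite /moment_fun -/s.
have mono : s `^ b <= (s + t) `^ b.
  by apply: powR_le_base; rewrite ?(ltW b0) ?(ltW s0)// lerDl ltW.
rewrite ger0_norm ?subr_ge0// le_min; apply/andP; split; last first.
  rewrite lerBlDl (le_trans (powR_subadd s0 t0 b01))// lerD2l.
  by apply: powR_le_base; rewrite ?(ltW b0) ?(ltW t0).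
apply: le_trans txy; rewrite lerBlDl.
have -> : (s + t) `^ b = s `^ b * (1 + t / s) `^ b.
  rewrite -powRM ?(ltW s0)//; last by rewrite addr_ge0// divr_ge0 ?(ltW t0) ?(ltW s0).
  by rewrite mulrDr mulr1 mulrC divfK// gt_eqF.
have ts0 : 0 < t / s by rewrite divr_gt0.
have z1 : 1 <= 1 + t / s by rewrite lerDl ltW.
apply: (le_trans (ler_wpM2l (powR_ge0 s b) (powR_le_id z1 b1))).
rewrite mulrDr mulr1 lerD2l mulrCA ler_piMr ?(ltW t0)//.
by rewrite ler_pdivrMr// mul1r powR_le_id.
Qed.

End approximating_class.

(** * Expectations and passage to the limit *)

Section random_variables.
Context d (T : measurableType d) (R : realType) (P : probability T R).
Variable X : {RV P >-> R}.
Implicit Types (g h : R -> R) (p : @tpoly R) (b : R).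

Let mX : measurable_fun setT X. Proof. exact: measurable_funPT. Qed.

Lemma rv_measurable g : measurable_fun setT g -> measurable_fun setT (fun w => g (X w)).
Proof. by move=> mg; exact: (measurableT_comp mg mX). Qed.

Lemma cst_integrable (c : R) : P.-integrable setT (EFin \o (fun=> c)).
Proof. exact: finite_measure_integrable_cst. Qed.

Lemma Rintegral_cst1 (c : R) : \int[P]_w c = c.
Proof.
rewrite Rintegral_cst// (_ : fine _ = 1) ?mulr1//.
by transitivity (fine (1%:E : \bar R)) => //; congr fine; exact: probability_setT.
Qed.

Lemma bounded_integrable g M : measurable_fun setT g -> (forall x, `|g x| <= M) ->
  P.-integrable setT (EFin \o (fun w => g (X w))).
Proof.
move=> mg gM; apply: (le_integrable1 _ _ (cst_integrable M)) => //.
exact: rv_measurable.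
Qed.

Lemma tpe_rv_integrable p : P.-integrable setT (EFin \o (fun w => tpe p (X w))).
Proof.
have [M _ pM] := tpe_bounded p.
by apply: bounded_integrable pM; exact: tpe_measurable.
Qed.

Section characteristic_function.
Variables (al ka : R).
Hypothesis charC : forall l, 0 <= l ->
  \int[P]_w cos (l * X w) = expR (- l `^ al) * cos (ka * l `^ al).
Hypothesis charS : forall l, 0 <= l ->
  \int[P]_w sin (l * X w) = expR (- l `^ al) * sin (ka * l `^ al).

Lemma stable_mean_expectation p : tpos p -> stable_mean al ka p = \int[P]_w tpe p (X w).
Proof.
move=> p0; rewrite /stable_mean /tpe.
have ic l : P.-integrable setT (EFin \o (fun w => cos (l * X w))).
  apply: (@bounded_integrable (fun x => cos (l * x)) 1); first by mfun.
  by move=> x; exact: cos_max.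
have isn l : P.-integrable setT (EFin \o (fun w => sin (l * X w))).
  apply: (@bounded_integrable (fun x => sin (l * x)) 1); first by mfun.
  by move=> x; exact: sin_max.
have E (t : R * (R * R)) : (fun w => t.1 * cos (t.2.1 * X w + t.2.2)) =
    (fun w => t.1 * cos t.2.2 * cos (t.2.1 * X w) + - (t.1 * sin t.2.2) * sin (t.2.1 * X w)).
  by apply/funext => w; rewrite cosD; ring.
rewrite Rintegral_seq_sum//; last first.
  by move=> t tp; rewrite E; apply: integrableD1 => //; exact: integrableZl1.
rewrite !big_seq; apply: eq_bigr => t tp; rewrite E.
rewrite RintegralD//; do ?[exact: integrableZl1].
rewrite (eq_RintegralZl _ (ic _) (fun _ _ => erefl))//.
rewrite (eq_RintegralZl _ (isn _) (fun _ _ => erefl))//.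
by rewrite charC ?charS ?p0// cosD; ring.
Qed.

(** This is where the existence of [Z] is used: the formula of [stable_mean] alone does not show
    that it is an average. *)
Lemma stable_mean_bound p M : tpos p -> (forall x, `|tpe p x| <= M) ->
  `|stable_mean al ka p| <= M.
Proof.
move=> p0 pM; rewrite stable_mean_expectation// -[leRHS]Rintegral_cst1.
by apply: Rintegral_le_norm => //; [exact: rv_measurable (tpe_measurable p)|exact: cst_integrable].
Qed.

End characteristic_function.

(* Fatou along trigonometric approximations of [moment_fun b]. *)
Lemma moment_integrable b B : 0 < b <= 1 ->
  (forall p, modulus_class b p -> `|\int[P]_w tpe p (X w) - tpe p 0| <= B) ->
  P.-integrable setT (EFin \o (fun w => moment_fun b (X w))).
Proof.
move=> b01 HB; have mH := moment_fun_Hclass b01.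
have [q [qc _ q0 qm qcvg]] := Hclass_approximation b01 mH.
have mm : measurable_fun setT (fun w => moment_fun b (X w)).
  by apply: rv_measurable; apply: continuous_measurable_fun; exact: Hclass_continuous mH.
pose f n w : \bar R := (tpe (q n) (X w) + 1)%:E.
have f0 n w : setT w -> (0 <= f n w)%E.
  move=> _; rewrite lee_fin -lerBlDr sub0r (le_trans _ (qm n (X w)))// lerBrDr addNr.
  exact: powR_ge0.
have mf n : measurable_fun setT (f n).
  apply/measurable_EFinP; apply: measurable_funD1; last exact: measurable_cst.
  exact: rv_measurable (tpe_measurable _).
have int_f n : (\int[P]_w f n w <= (moment_fun b 0 + B + 2)%:E)%E.
  have i1 : P.-integrable setT (EFin \o (fun w => tpe (q n) (X w) + 1)).
    by apply: integrableD1 => //; [exact: tpe_rv_integrable|exact: cst_integrable].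
  rewrite -(fineK (integrable_fin_num _ i1))// lee_fin -/(Rintegral P setT (fun w => tpe (q n) (X w) + 1)).
  rewrite RintegralD//; [|exact: tpe_rv_integrable|exact: cst_integrable].
  rewrite Rintegral_cst1.
  have := HB _ (qc n); have := q0 n; rewrite !ler_norml => /andP[_ h1] /andP[_ h2]; lra.
have := fatou P measurableT mf f0.
have -> : (\int[P]_w limn_einf (f ^~ w) = \int[P]_w (moment_fun b (X w) + 1)%:E)%E.
  apply: eq_integral => w _; have c : f n w @[n --> \oo] --> (moment_fun b (X w) + 1)%:E.
    by apply: cvg_EFin; [exact: nearW|apply: cvgD; [exact: qcvg|exact: cvg_cst]].
  by rewrite is_cvg_limn_einfE; [exact/cvg_lim|apply/cvg_ex; eexists; exact: c].
move=> h; apply/integrableP; split; first exact/measurable_EFinP.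
apply: (@le_lt_trans _ _ (moment_fun b 0 + B + 2)%:E); last exact: ltry.
apply: (@le_trans _ _ (\int[P]_w (moment_fun b (X w) + 1)%:E)%E).
  apply: ge0_le_integral => //.
  - by apply/measurable_EFinP; exact: measurable_fun_norm.
  - by apply/measurable_EFinP; apply: measurable_funD1 => //; exact: measurable_cst.
  - by move=> w _; rewrite lee_fin ger0_norm ?powR_ge0// lerDl.
apply: (le_trans h); rewrite limn_einf_lim; apply: lime_le; first exact: is_cvg_einfs.
apply: nearW => n; apply: le_trans (int_f n).
by apply: ereal_inf_lbound; exists n => /=.
Qed.

Lemma Hclass_integrable b h : 0 < b <= 1 ->
  P.-integrable setT (EFin \o (fun w => moment_fun b (X w))) -> Hclass b h ->
  P.-integrable setT (EFin \o (fun w => h (X w))).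
Proof.
move=> /andP[b0 b1] im hH.
have ig := integrableD1 measurableT (cst_integrable `|h 0|) im.
apply: (le_integrable1 _ _ ig) => //.
  by apply: rv_measurable; apply: continuous_measurable_fun; exact: Hclass_continuous hH.
move=> w _; rewrite -lerBlDl (le_trans (lerB_dist _ _))//.
rewrite (le_trans (Hclass_holder _ _ hH))// subr0; apply: powR_le_base => //; first exact: ltW.
by rewrite lerDr.
Qed.

Lemma Hclass_cvg_expectation b h (q : nat -> @tpoly R) : 0 < b <= 1 ->
  P.-integrable setT (EFin \o (fun w => moment_fun b (X w))) -> Hclass b h ->
  (forall n x, `|tpe (q n) x - tpe (q n) 0| <= 3 * `|x| `^ b) ->
  (forall n, `|tpe (q n) 0 - h 0| <= 1) ->
  (forall x, tpe (q n) x @[n --> \oo] --> h x) ->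
  \int[P]_w tpe (q n) (X w) @[n --> \oo] --> \int[P]_w h (X w).
Proof.
move=> b01 im hH q1 q2 qc; have /andP[b0 b1] := b01.
have ih := Hclass_integrable b01 im hH.
pose g w := (`|h 0| + 1) + 3 * moment_fun b (X w).
have ig : P.-integrable setT (EFin \o g).
  by apply: integrableD1 => //; [exact: cst_integrable|exact: integrableZl1].
have mq n : measurable_fun setT (fun w => (tpe (q n) (X w))%:E).
  exact: measurable_int (tpe_rv_integrable (q n)).
have mh : measurable_fun setT (fun w => (h (X w))%:E) by exact: measurable_int ih.
have qcE : {ae P, forall w, setT w -> (tpe (q n) (X w))%:E @[n --> \oo] --> (h (X w))%:E}.
  by apply: aeW => w _; apply: cvg_EFin; [exact: nearW|exact: qc].
have qg : {ae P, forall w n, setT w -> (`|(tpe (q n) (X w))%:E| <= (EFin \o g) w)%E}.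
  apply: aeW => w n _; rewrite lee_fin /g.
  have h1 := q1 n (X w); have h2 := q2 n.
  have h3 : `|X w| `^ b <= moment_fun b (X w).
    by apply: powR_le_base => //; [exact: ltW|rewrite lerDr].
  rewrite (_ : tpe (q n) (X w) = (tpe (q n) (X w) - tpe (q n) 0) + ((tpe (q n) 0 - h 0) + h 0)); last by ring.
  rewrite (le_trans (ler_normD _ _))// addrC; apply: lerD.
    by rewrite (le_trans (ler_normD _ _))// addrC lerD2l.
  by rewrite (le_trans h1)// ler_wpM2l.
have [_ _ H] := dominated_convergence measurableT mq mh qcE ig qg.
have e : (\int[P]_w (h (X w))%:E)%E = (\int[P]_w h (X w))%:E.
  by rewrite fineK//; exact: integrable_fin_num.
move: H; rewrite /= e => /fine_cvg; exact.
Qed.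

End random_variables.

Lemma complex_affine (R : realType) (u v : R) :
  (u%:C * (1 - 'i * v%:C))%C = (u +i* (- u * v))%C :> R[i].
Proof. by apply/eqP; rewrite eq_complex; simpc. Qed.

Section stable_characteristic.
Context d (T : measurableType d) (R : realType) (P : probability T R).
Variable Z : {RV P >-> R}.

Let expectationE (g : T -> R) : fine ('E_P[g])%E = \int[P]_w g w.
Proof. by rewrite unlock. Qed.

Lemma stable_law_char (a dl : R) : 0 < a < 1 -> stable_law Z a dl -> forall l, 0 <= l ->
  \int[P]_w cos (l * Z w) = expR (- l `^ a) * cos (dl * tan (pi * a / 2) * l `^ a) /\
  \int[P]_w sin (l * Z w) = expR (- l `^ a) * sin (dl * tan (pi * a / 2) * l `^ a).
Proof.
move=> /andP[a0 a1] hZ l l0; have := hZ l; rewrite /char_fun lt_eqF// !expectationE ger0_norm//.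
set w := (X in cexp X).
have wE : w = (- l `^ a +i* (dl * tan (pi * a / 2) * l `^ a))%C.
  rewrite /w complex_affine opprK; congr (_ +i* _)%C.
  have [->|ln0] := eqVneq l 0; first by rewrite powR0 ?gt_eqF// mul0r mulr0.
  by rewrite gtr0_sg ?lt_neqAle 1?eq_sym ?ln0// mulr1 mulrC.
by rewrite wE /cexp/=; simpc => -[-> ->].
Qed.

Lemma cauchy_law_char : stable_law Z 1 0 -> forall l, 0 <= l ->
  \int[P]_w cos (l * Z w) = expR (- l `^ 1) * cos (0 * l `^ 1) /\
  \int[P]_w sin (l * Z w) = expR (- l `^ 1) * sin (0 * l `^ 1).
Proof.
move=> hZ l l0; have := hZ l; rewrite /char_fun eqxx !expectationE ger0_norm// powRr1//.
by rewrite /cexp/= cos0 sin0 mul0r cos0 sin0; simpc => -[-> ->]; rewrite ?mulr1 ?mulr0.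
Qed.

End stable_characteristic.

(** * From the Stein equation to the distance *)

Section stein_bound.
Context {R : realType}.
Variables (dZ : measure_display) (TZ : measurableType dZ) (PZ : probability TZ R).
Variable Z : {RV PZ >-> R}.
Implicit Types (p : @tpoly R).

Lemma abs_diff_expE d1 (T1 : measurableType d1) (P1 : probability T1 R) (X : T1 -> R) (k : R)
    d2 (T2 : measurableType d2) (P2 : probability T2 R) (Y : T2 -> R) :
  P1.-integrable setT (EFin \o X) -> P2.-integrable setT (EFin \o Y) ->
  abs_diff_exp P1 X k P2 Y = (`|\int[P1]_w X w - k * \int[P2]_w Y w|)%:E.
Proof.
move=> iX iY; rewrite /abs_diff_exp asboolT; last by split.
rewrite unlock -(fineK (integrable_fin_num _ iX))// -(fineK (integrable_fin_num _ iY))//.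
Qed.

Lemma dW_le_of_class (b B S : R) d (T : measurableType d) (P : probability T R)
    (F : {RV P >-> R}) : 0 < b <= 1 ->
  (forall p, modulus_class b p -> `|\int[PZ]_w tpe p (Z w) - tpe p 0| <= B) ->
  (forall p, modulus_class b p -> `|\int[P]_w tpe p (F w) - \int[PZ]_w tpe p (Z w)| <= S) ->
  (dW b F Z <= S%:E)%E.
Proof.
move=> b01 HB HS.
have mZ := moment_integrable b01 HB.
have mF : P.-integrable setT (EFin \o (fun w => moment_fun b (F w))).
  apply: (@moment_integrable _ _ _ P F b (S + B) b01) => p pc.
  have := ler_normD (\int[P]_w tpe p (F w) - \int[PZ]_w tpe p (Z w))
    (\int[PZ]_w tpe p (Z w) - tpe p 0).
  rewrite addrA subrK => /le_trans; apply; rewrite lerD//; [exact: HS|exact: HB].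
apply: ub_ereal_sup => _ [h hH <-].
rewrite abs_diff_expE; [|exact: Hclass_integrable b01 mF hH|exact: Hclass_integrable b01 mZ hH].
rewrite lee_fin mul1r.
have [q [qc q1 q2 _ q3]] := Hclass_approximation b01 hH.
have cF := Hclass_cvg_expectation b01 mF hH q1 q2 q3.
have cZ := Hclass_cvg_expectation b01 mZ hH q1 q2 q3.
apply: (cvgr_to_le (cvg_norm (cvgB cF cZ))).
by apply: nearW => n; exact: HS (qc n).
Qed.

Variables (al ka b k B : R) (L : (R -> R) -> R -> R).
Hypothesis b01 : 0 < b <= 1.
Hypothesis stein_eq : forall p, modulus_class b p -> forall x,
  L (stein al ka p) x - k * (x * dstein al ka p x) = tpe p x - \int[PZ]_w tpe p (Z w).
Hypothesis stein_der : forall p, modulus_class b p -> forall x,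
  derive1 (stein al ka p) x = dstein al ka p x.
Hypothesis stein_B : forall p, modulus_class b p -> `|L (stein al ka p) 0| <= B.

Definition stein_class : set (R -> R) :=
  [set f | exists2 p, modulus_class b p & f = stein al ka p].

(** If the supremum is infinite there is nothing to prove. If it is finite, no term can be the
    conventional +oo, so all its expectations converge, and the Stein equation can be integrated
    along F. *)
Lemma dW_le_stein_sup d (T : measurableType d) (P : probability T R) (F : {RV P >-> R}) :
  (dW b F Z <= stein_sup L k stein_class F)%E.
Proof.
set S := stein_sup _ _ _ _.
have Sup p : modulus_class b p -> (abs_diff_exp P (L (stein al ka p) \o F) k P
    (fun w => (F w * derive1 (stein al ka p) (F w))%R) <= S)%E.
  by move=> pc; apply: ereal_sup_ubound; exists (stein al ka p) => //; exists p.
(* The empty polynomial makes the class nonempty, which rules out a supremum equal to -oo. *)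
have c0 : modulus_class b [::].
  split=> // x y; rewrite /tpe !big_nil subrr normr0.
  - by rewrite mulr_ge0.
  - by rewrite mulr_ge0// powR_ge0.
have S0 : (0 <= S)%E.
  apply: le_trans (Sup _ c0); rewrite /abs_diff_exp; case: ifP => _; first exact: abse_ge0.
  exact: le0y.
case: (S) S0 Sup => [s| |//] _ Sup; last exact: leey.
apply: (@dW_le_of_class b B) => // p pc.
  (* At x = 0 the equation reads L f_p(0) = p(0) - E p(Z), so the bound on the generator bounds the
     moments of Z. *)
  by have := stein_B pc; have := stein_eq pc 0; rewrite mul0r mulr0 subr0 => ->; rewrite distrC.
have := Sup p pc; rewrite /abs_diff_exp; case: asboolP => [[i1 i2] _|_]; last by rewrite leye_eq.
have := Sup p pc; rewrite abs_diff_expE// lee_fin; apply: le_trans.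
rewrite le_eqVlt; apply/orP; left; apply/eqP; congr `| _ |.
rewrite -RintegralZl// -RintegralB//; last exact: integrableZl1.
rewrite -[X in _ - X](Rintegral_cst1 P) -RintegralB//; [|exact: tpe_rv_integrable|exact: cst_integrable].
by apply: eq_Rintegral => w _; rewrite -stein_eq// stein_der.
Qed.

End stein_bound.

(** * Norms, constants and conclusion *)

Section norms.
Context {R : realType}.

Lemma sup_norm_le (g : R -> R) (A : R) : (forall x, `|g x| <= A) -> (sup_norm g <= A%:E)%E.
Proof. by move=> gA; apply: ub_ereal_sup => _ [x _ <-]; rewrite lee_fin. Qed.

Lemma holder_norm_le (c : R) (g : R -> R) (A B C : R) : A + B <= C ->
  (forall x, `|g x| <= A) -> (forall x y, `|g x - g y| <= B * `|x - y| `^ c) ->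
  (holder_norm c g <= C%:E)%E.
Proof.
move=> ABC gA gB; apply: (@le_trans _ _ (A%:E + B%:E)%E); last by rewrite lee_fin.
apply: leeD; first exact: sup_norm_le.
apply: ub_ereal_sup => _ [[x y]/= xy <-]; rewrite lee_fin ler_pdivrMr ?gB//.
by rewrite powR_gt0// normr_gt0 subr_eq0.
Qed.

Lemma loglip_norm_le (g : R -> R) (A B C : R) : A + B <= C ->
  (forall x, `|g x| <= A) -> (forall x y, x != y -> `|x - y| <= 1 ->
    `|g x - g y| <= B * (`|x - y| * (1 - ln `|x - y|))) ->
  (loglip_norm g <= C%:E)%E.
Proof.
move=> ABC gA gB; apply: (@le_trans _ _ (A%:E + B%:E)%E); last by rewrite lee_fin.
apply: leeD; first exact: sup_norm_le.
apply: ub_ereal_sup => _ [[x y]/= [xy xy1] <-]; rewrite lee_fin ler_pdivrMr ?gB//.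
have r0 : 0 < `|x - y| by rewrite normr_gt0 subr_eq0.
by rewrite mulr_gt0// subr_gt0 (le_lt_trans (ln_le0 xy1)).
Qed.

End norms.

Section smoothing_choice.
Context {R : realType}.

(** The constant has to be a function of a fixed before the skewness is known, whence choice and the
    uniformity in k; outside (0, 1] it is set to 1. *)
Lemma smoothing_function : exists CS : R -> R, (forall a, 0 < CS a) /\
  forall a, 0 < a <= 1 -> forall (k : R) p M, `|k| <= `|tan (pi * a / 2)| -> tpos p ->
    (forall x, `|tpe p x| <= M) ->
    `|\sum_(t <- p) t.1 * t.2.1 * (expR (- t.2.1 `^ a) * sin (t.2.2 + k * t.2.1 `^ a))|
      <= CS a * M.
Proof.
have /choice[CS H] (a : R) : exists C : R, 0 < C /\ (0 < a <= 1 ->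
    forall (k : R) p M, `|k| <= `|tan (pi * a / 2)| -> tpos p ->
    (forall x, `|tpe p x| <= M) ->
    `|\sum_(t <- p) t.1 * t.2.1 * (expR (- t.2.1 `^ a) * sin (t.2.2 + k * t.2.1 `^ a))| <= C * M).
  have [a01|a01] := boolP (0 < a <= 1); last by exists 1.
  have [C C0 HC] := @smoothing_constant R a `|tan (pi * a / 2)| a01 (normr_ge0 _).
  by exists C.
exists CS; split=> [a|a a01]; first by have [] := H a.
by have [_ /(_ a01)] := H a.
Qed.

End smoothing_choice.

Section stable_part.
Context {R : realType}.
Variable CS : R -> R.
Hypothesis CS0 : forall a, 0 < CS a.
Hypothesis CSP : forall a, 0 < a <= 1 -> forall (k : R) p M, `|k| <= `|tan (pi * a / 2)| -> tpos p ->
    (forall x, `|tpe p x| <= M) ->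
    `|\sum_(t <- p) t.1 * t.2.1 * (expR (- t.2.1 `^ a) * sin (t.2.2 + k * t.2.1 `^ a))|
      <= CS a * M.

(** The Hoelder constant of f_p; since b <= 1 it also exceeds the Lipschitz constant 3 a. *)
Definition lip_const (a b : R) : R := 3 * (a / b).

Definition derivative_const (a : R) : R := (6 + 3 * CS a) * 2 `^ a^-1 / (a^-1 - 1).

(* [|cp| + |cm| = |levy_const a|], so the bounds are those of the pair [(levy_const a, 0)]. *)
Definition generator_const (a b g : R) : R :=
  half_generator_bound a b (levy_const a) 0 (lip_const a b) +
  half_generator_holder_const a b (levy_const a) 0 (lip_const a b) (derivative_const a) g.

Variables (a dl b : R).
Hypotheses (ha : 0 < a < 1) (hdl : -1 < dl < 1) (hb : 0 < b < a).
Variables (dZ : measure_display) (TZ : measurableType dZ) (PZ : probability TZ R).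
Variable Z : {RV PZ >-> R}.
Hypothesis hZ : stable_law Z a dl.

Let ka := dl * tan (pi * a / 2).
Let cp := levy_const a * ((1 + dl) / 2).
Let cm := levy_const a * ((1 - dl) / 2).

Let a0 : 0 < a. Proof. by case/andP: ha. Qed.
Let a1 : a < 1. Proof. by case/andP: ha. Qed.
Let a1' : a <= 1. Proof. exact: ltW. Qed.
Let a01 : 0 < a <= 1. Proof. by rewrite a0. Qed.
Let b0 : 0 < b. Proof. by case/andP: hb. Qed.
Let ba : b < a. Proof. by case/andP: hb. Qed.
Let b1 : b <= 1. Proof. by rewrite (le_trans (ltW ba)). Qed.

Let ka_le : `|ka| <= `|tan (pi * a / 2)|.
Proof.
rewrite /ka normrM ler_piMl// ler_norml; case/andP: hdl => h1 h2.
by rewrite !ltW.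
Qed.

Let charC l : 0 <= l -> \int[PZ]_w cos (l * Z w) = expR (- l `^ a) * cos (ka * l `^ a).
Proof. by move=> l0; have [] := stable_law_char ha hZ l0. Qed.

Let charS l : 0 <= l -> \int[PZ]_w sin (l * Z w) = expR (- l `^ a) * sin (ka * l `^ a).
Proof. by move=> l0; have [] := stable_law_char ha hZ l0. Qed.

Let mean_bound p M : tpos p -> (forall x, `|tpe p x| <= M) -> `|stable_mean a ka p| <= M.
Proof. exact: stable_mean_bound charC charS p M. Qed.

Let smooth p M : tpos p -> (forall x, `|tpe p x| <= M) ->
  `|\sum_(t <- p) t.1 * t.2.1 * (expR (- t.2.1 `^ a) * sin (t.2.2 + ka * t.2.1 `^ a))| <= CS a * M.
Proof. exact: (CSP a01 ka_le). Qed.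

Let D := lip_const a b.

Section one_function.
Variable p : @tpoly R.
Hypothesis pc : modulus_class b p.
Let p0 : tpos p. Proof. by case: pc. Qed.
Let pL : forall x y, `|tpe p x - tpe p y| <= 3 * `|x - y|. Proof. by case: pc. Qed.
Let pH : forall x y, `|tpe p x - tpe p y| <= 3 * `|x - y| `^ b. Proof. by case: pc. Qed.
Let f := stein a ka p.
Let df := dstein a ka p.

Let fdf x : is_derive x (1 : R) f (df x).
Proof. exact: is_derive_stein. Qed.

Let f_lip x y : `|f x - f y| <= D * `|x - y|.
Proof.
apply: (le_trans (stein_lipschitz a0 a1' mean_bound p0 pL x y)).
by rewrite ler_wpM2r// /D /lip_const ler_wpM2l// ler_pdivlMr// ler_piMr// ltW.
Qed.

Let f_hol x y : `|f x - f y| <= D * `|x - y| `^ b.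
Proof. exact: stein_holder. Qed.

Let df_hol x y : `|df x - df y| <= derivative_const a * `|x - y| `^ a.
Proof. exact: (dstein_holder a0 a1' (CS0 a) mean_bound smooth p0 pL x y a1). Qed.

Let genE x : stable_generator a dl f x = half_generator a cp cm f x.
Proof.
apply: (stable_generatorE dl _ ha ba _ f_lip f_hol).
by move=> y; exact: is_derive1_cont (fdf y).
Qed.

Lemma stable_stein_equation x :
  stable_generator a dl f x - a^-1 * (x * df x) = tpe p x - \int[PZ]_w tpe p (Z w).
Proof.
rewrite genE -(stable_mean_expectation charC charS p0).
exact: (stein_equation a0 a1' a1 (stable_wave dl ha)
  (fun X k _ => stable_wave_integrable dl ha X k) (stable_wave_le a dl) (stable_wave_le1 a dl) _ p0).
Qed.

Lemma stable_stein_derive x : derive1 f x = df x.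
Proof. exact: is_derive1_val (fdf x). Qed.

Let mE : `|cp| + `|cm| = `|levy_const a| + `|0 : R|.
Proof.
case/andP: hdl => h1 h2; rewrite /cp /cm (normrM (levy_const a)) (normrM (levy_const a)).
rewrite normr0 (ger0_norm (_ : 0 <= (1 + dl) / 2)); last lra.
by rewrite (ger0_norm (_ : 0 <= (1 - dl) / 2)); [field|lra].
Qed.

Let bE : half_generator_bound a b cp cm D = half_generator_bound a b (levy_const a) 0 D.
Proof. by rewrite /half_generator_bound mE. Qed.

Lemma stable_generator_le x :
  `|stable_generator a dl f x| <= half_generator_bound a b (levy_const a) 0 D.
Proof. by rewrite genE -bE; exact: (half_generator_le cp cm ha hb fdf f_lip f_hol). Qed.

Lemma stable_stein_estimates (C1 C2 : R) (C3 : R -> R) : D <= C1 ->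
  3 * a + derivative_const a <= C2 ->
  (forall g, generator_const a b g <= C3 g) ->
  [/\ forall x : R, derivable f x 1,
      forall x y : R, `|f x - f y| <= C1 * Num.min `|x - y| (`|x - y| `^ b),
      (holder_norm a (derive1 f) <= C2%:E)%E &
      forall g : R, 0 < g < 1 -> (holder_norm g (stable_generator a dl f) <= (C3 g)%:E)%E].
Proof.
move=> DC1 hC2 hC3; split.
- by move=> x; have [] := fdf x.
- move=> x y; apply: (@le_trans _ _ (D * Num.min `|x - y| (`|x - y| `^ b))).
    by rewrite minEle; case: ifP => _; [exact: f_lip|exact: f_hol].
  by rewrite ler_wpM2r// le_min normr_ge0 powR_ge0.
- apply: (holder_norm_le hC2) => x *; rewrite ?stable_stein_derive; last exact: df_hol.
  exact: (dstein_bound a0 a1' mean_bound p0 pL x).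
- move=> g g01; apply: (holder_norm_le (hC3 g) stable_generator_le) => x y.
  rewrite !genE; have := half_generator_holder cp cm ha hb fdf f_lip f_hol df_hol g01 x y.
  by rewrite /half_generator_holder_const bE mE.
Qed.

End one_function.

Lemma stable_dW_le d (T : measurableType d) (P : probability T R) (F : {RV P >-> R}) :
  (dW b F Z <= stein_sup (stable_generator a dl) a^-1 (stein_class a ka b) F)%E.
Proof.
apply: (@dW_le_stein_sup _ _ _ _ Z a ka b a^-1 (half_generator_bound a b (levy_const a) 0 D)).
- by rewrite b0.
- by move=> p pc x; exact: stable_stein_equation.
- by move=> p pc x; exact: stable_stein_derive.
- by move=> p pc; exact: stable_generator_le.
Qed.

End stable_part.

Section cauchy_part.
Context {R : realType}.
Variable CS : R.
Hypothesis CS0 : 0 < CS.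
Hypothesis smooth : forall p M, tpos p -> (forall x : R, `|tpe p x| <= M) ->
    `|\sum_(t <- p) t.1 * t.2.1 * (expR (- t.2.1 `^ 1) * sin (t.2.2 + 0 * t.2.1 `^ 1))| <= CS * M.

Definition loglip_const : R := (6 + 3 * CS) * 2.
Definition zygmund_const : R := (12 + 12 * CS ^+ 2) * 4.
Definition cauchy_const (b : R) : R :=
  half_cauchy_bound b pi^-1 (lip_const 1 b) loglip_const +
  half_cauchy_loglip_const pi^-1 (lip_const 1 b) loglip_const zygmund_const.

Variable b : R.
Hypothesis hb : 0 < b < 1.
Variables (dZ : measure_display) (TZ : measurableType dZ) (PZ : probability TZ R).
Variable Z : {RV PZ >-> R}.
Hypothesis hZ : stable_law Z 1 0.

Let b0 : 0 < b. Proof. by case/andP: hb. Qed.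
Let b1 : b < 1. Proof. by case/andP: hb. Qed.

Let charC l : 0 <= l -> \int[PZ]_w cos (l * Z w) = expR (- l `^ 1) * cos (0 * l `^ 1).
Proof. by move=> l0; have [] := cauchy_law_char hZ l0. Qed.

Let charS l : 0 <= l -> \int[PZ]_w sin (l * Z w) = expR (- l `^ 1) * sin (0 * l `^ 1).
Proof. by move=> l0; have [] := cauchy_law_char hZ l0. Qed.

Let mean_bound p M : tpos p -> (forall x : R, `|tpe p x| <= M) -> `|stable_mean 1 0 p| <= M.
Proof. exact: stable_mean_bound charC charS p M. Qed.

Let D := lip_const 1 b.
Let D0 : 0 <= D. Proof. by rewrite /D /lip_const mulr_ge0// divr_ge0// ltW. Qed.
Let L0 : 0 <= loglip_const. Proof. by rewrite /loglip_const; move: CS0 => h; lra. Qed.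
Let Z0 : 0 <= zygmund_const.
Proof. by rewrite mulr_ge0// addr_ge0// mulr_ge0// sqr_ge0. Qed.

Section one_function.
Variable p : @tpoly R.
Hypothesis pc : modulus_class b p.
Let p0 : tpos p. Proof. by case: pc. Qed.
Let pL : forall x y, `|tpe p x - tpe p y| <= 3 * `|x - y|. Proof. by case: pc. Qed.
Let pH : forall x y, `|tpe p x - tpe p y| <= 3 * `|x - y| `^ b. Proof. by case: pc. Qed.
Let f := stein 1 0 p.
Let df := dstein 1 0 p.

Let fdf x : is_derive x (1 : R) f (df x).
Proof. exact: is_derive_stein. Qed.

Let f_lip x y : `|f x - f y| <= D * `|x - y|.
Proof.
apply: (le_trans (stein_lipschitz ltr01 (lexx 1) mean_bound p0 pL x y)).
by rewrite ler_wpM2r// /D /lip_const ler_wpM2l// ler_pdivlMr// mul1r ltW.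
Qed.

Let f_hol x y : `|f x - f y| <= D * `|x - y| `^ b.
Proof. exact: stein_holder. Qed.

Let df_loglip x y : x != y -> `|x - y| <= 1 ->
  `|df x - df y| <= loglip_const * (`|x - y| * (1 - ln `|x - y|)).
Proof. exact: (dstein_loglip ltr01 (lexx 1) CS0 mean_bound smooth p0 pL (erefl 1)). Qed.

Let df_zygmund x u : 0 < u -> `|df (x + u) + df (x - u) - 2 * df x| <= zygmund_const * u.
Proof. exact: (dstein_zygmund mean_bound smooth x p0 pL). Qed.

Let genE x : cauchy_generator f x = half_generator 1 pi^-1 pi^-1 f x.
Proof. exact: (cauchy_generatorE x hb fdf f_hol D0 L0 df_loglip). Qed.

Lemma cauchy_stein_equation x :
  cauchy_generator f x - 1 * (x * df x) = tpe p x - \int[PZ]_w tpe p (Z w).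
Proof.
rewrite genE -(stable_mean_expectation charC charS p0) -[X in X * (x * _)]invr1.
exact: (stein_equation ltr01 (lexx 1) (ltr1n R 2) cauchy_wave
  (fun X k _ => cauchy_wave_integrable X k) cauchy_wave_le cauchy_wave_le1 _ p0).
Qed.

Lemma cauchy_stein_derive x : derive1 f x = df x.
Proof. exact: is_derive1_val (fdf x). Qed.

Lemma cauchy_generator_le x : `|cauchy_generator f x| <= half_cauchy_bound b pi^-1 D loglip_const.
Proof. by rewrite genE; exact: (half_cauchy_le _ hb fdf f_lip f_hol L0 df_loglip). Qed.

Lemma cauchy_stein_estimates (C1 C2 C3 : R) : D <= C1 ->
  3 + loglip_const <= C2 -> cauchy_const b <= C3 ->
  [/\ forall x : R, derivable f x 1,
      forall x y : R, `|f x - f y| <= C1 * Num.min `|x - y| (`|x - y| `^ b),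
      (loglip_norm (derive1 f) <= C2%:E)%E &
      (loglip_norm (cauchy_generator f) <= C3%:E)%E].
Proof.
move=> DC1 hC2 hC3; split.
- by move=> x; have [] := fdf x.
- move=> x y; apply: (@le_trans _ _ (D * Num.min `|x - y| (`|x - y| `^ b))).
    by rewrite minEle; case: ifP => _; [exact: f_lip|exact: f_hol].
  by rewrite ler_wpM2r// le_min normr_ge0 powR_ge0.
- apply: (loglip_norm_le hC2) => [x|x y xy xy1]; rewrite !cauchy_stein_derive; last exact: df_loglip.
  have := dstein_bound ltr01 (lexx 1) mean_bound p0 pL x.
  by rewrite mulr1.
- apply: (loglip_norm_le hC3 cauchy_generator_le) => x y xy xy1.
  rewrite !genE; exact: (half_cauchy_loglip _ hb fdf f_lip f_hol L0 df_loglip Z0 df_zygmund).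
Qed.

End one_function.

Lemma cauchy_dW_le d (T : measurableType d) (P : probability T R) (F : {RV P >-> R}) :
  (dW b F Z <= stein_sup cauchy_generator 1 (stein_class 1 0 b) F)%E.
Proof.
apply: (@dW_le_stein_sup _ _ _ _ Z 1 0 b 1 (half_cauchy_bound b pi^-1 D loglip_const)).
- by rewrite b0 ltW.
- by move=> p pc x; exact: cauchy_stein_equation.
- by move=> p pc x; exact: cauchy_stein_derive.
- by move=> p pc; exact: cauchy_generator_le.
Qed.

End cauchy_part.

Theorem theorem1p3 (R : realType) :
  (exists (c1 : R -> R -> R) (c2 : R -> R) (c3 : R -> R -> R -> R),
     [/\ forall a b : R, 0 < c1 a b,
         forall a : R, 0 < c2 a,
         forall a b g : R, 0 < c3 a b g &
     forall (a dl b : R) (ha : 0 < a < 1) (hdl : -1 < dl < 1) (hb : 0 < b < a)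
       (dZ : measure_display) (TZ : measurableType dZ) (PZ : probability TZ R)
       (Z : {RV PZ >-> R}) (hZ : stable_law Z a dl),
     exists C : set (R -> R),
       (forall (d : measure_display) (T : measurableType d)
          (P : probability T R) (F : {RV P >-> R}),
          (dW b F Z <= stein_sup (stable_generator a dl) a^-1 C F)%E) /\
       (forall f : R -> R, C f ->
          [/\ forall x : R, derivable f x 1,
              forall x y : R,
                `|f x - f y| <= c1 a b * Num.min `|x - y| (`|x - y| `^ b),
              (holder_norm a (derive1 f) <= (c2 a)%:E)%E &
              forall g : R, 0 < g < 1 ->
                (holder_norm g (stable_generator a dl f) <= (c3 a b g)%:E)%E])])
  /\
  (exists (c1 : R -> R) (c2 : R) (c3 : R -> R),
     [/\ forall b : R, 0 < c1 b,
         0 < c2,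
         forall b : R, 0 < c3 b &
     forall (b : R) (hb : 0 < b < 1)
       (dZ : measure_display) (TZ : measurableType dZ) (PZ : probability TZ R)
       (Z : {RV PZ >-> R}) (hZ : stable_law Z 1 0),
     exists C : set (R -> R),
       (forall (d : measure_display) (T : measurableType d)
          (P : probability T R) (F : {RV P >-> R}),
          (dW b F Z <= stein_sup cauchy_generator 1 C F)%E) /\
       (forall f : R -> R, C f ->
          [/\ forall x : R, derivable f x 1,
              forall x y : R,
                `|f x - f y| <= c1 b * Num.min `|x - y| (`|x - y| `^ b),
              (loglip_norm (derive1 f) <= c2%:E)%E &
              (loglip_norm (cauchy_generator f) <= (c3 b)%:E)%E])]).
Proof.
have [CS [CS0 CSP]] := @smoothing_function R.
have pos (x : R) : 0 < 1 + `|x| by rewrite ltr_pwDl.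
have le_pos (x : R) : x <= 1 + `|x| by have := ler_norm x; lra.
split.
  (* The form 1 + |x| makes the constants positive for all real arguments, also outside the range
     where they serve as bounds. *)
  exists (fun a b => 1 + `|lip_const a b|), (fun a => 1 + `|3 * a + derivative_const CS a|),
    (fun a b g => 1 + `|generator_const CS a b g|); split => //.
  move=> a dl b ha hdl hb dZ TZ PZ Z hZ.
  exists (stein_class a (dl * tan (pi * a / 2)) b); split.
    by move=> d T P F; exact: stable_dW_le.
  move=> f [p pc ->].
  by apply: (stable_stein_estimates CS0 CSP ha hdl hb hZ pc).
have smooth p M : tpos p -> (forall x : R, `|tpe p x| <= M) ->
    `|\sum_(t <- p) t.1 * t.2.1 * (expR (- t.2.1 `^ 1) * sin (t.2.2 + 0 * t.2.1 `^ 1))| <= CS 1 * M.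
  by apply: CSP; rewrite ?ltr01 ?lexx// normr0.
exists (fun b => 1 + `|lip_const 1 b|), (1 + `|3 + loglip_const (CS 1)|),
  (fun b => 1 + `|cauchy_const (CS 1) b|); split => //.
move=> b hb dZ TZ PZ Z hZ; exists (stein_class 1 0 b); split.
  by move=> d T P F; exact: (cauchy_dW_le (CS0 1) smooth).
move=> f [p pc ->].
by apply: (cauchy_stein_estimates (CS0 1) smooth hb hZ pc).
Qed.
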